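(* Let $C_1,\dots,C_d$ and $C$ be mutually independent standard Cauchy processes. The density of the vector process $J_{CC}^d(t)=\big(C_1(|C(t)|),\dots,C_d(|C(t)|)\big)$, $t>0$, can be expressed as $$p_{CC}^d(x_1,\dots,x_d,t)=\frac{2}{\pi^{d+1}}\int_0^{+\infty}\prod_{j=1}^d\frac{s}{s^2+x_j^2}\,\frac{t}{t^2+s^2}\,ds$$ and satisfies, for $d>1$, the fractional equation $$\frac{\partial^2p}{\partial t^2}=\sum_{k=1}^d\frac{\partial^2p}{\partial x_k^2}-2\sum_{k=2}^d\sum_{j=1}^{k-1}\frac{\partial^2p}{\partial|x_k|\,\partial|x_j|},\qquad x_j\in\mathbb{R},\ j=1,\dots,d,\ t>0,$$ with initial condition $p(x_1,\dots,x_d,0)=\prod_{j=1}^d\delta(x_j)$.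
   Context: $\delta$ is the Dirac delta function. A standard Cauchy process at time $s$ has density $\frac{s}{\pi(s^2+x^2)}$. $\frac{\partial}{\partial|x|}$ denotes the first-order Riesz fractional derivative $$\frac{\partial}{\partial|x|}f(x)=-\frac1\pi\int_0^{+\infty}\frac{f(x-y)-2f(x)+f(x+y)}{y^2}\,dy,$$ equivalently $\frac{\partial}{\partial|x|}f(x)=\frac1\pi\frac{d}{dx}\left[\int_{-\infty}^x\frac{f(y)}{x-y}dy-\int_x^\infty\frac{f(y)}{y-x}dy\right]$, whose Fourier transform is $\int_{-\infty}^{+\infty}e^{i\beta x}\frac{\partial}{\partial|x|}f(x)\,dx=|\beta|\int_{-\infty}^{+\infty}e^{i\beta x}f(x)\,dx$ (with this sign convention the Cauchy density satisfies $\frac{\partial}{\partial s}p_C=-\frac{\partial}{\partial|x|}p_C$). For a function of several variables, $\frac{\partial}{\partial|x_j|}$ acts on the variable $x_j$, and $\frac{\partial^2}{\partial|x_k|\partial|x_j|}$ is the composition of $\frac{\partial}{\partial|x_k|}$ and $\frac{\partial}{\partial|x_j|}$.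
   Formalization: The equation is stated not at all real x_j but only where 2·#{j : x_j = 0} + 2 ≤ d (always so if no x_j is 0); at other points p is infinite or some ∂²p/∂x_k² fails to exist, e.g. d = 2, x_1 = 0. *)

(* Defs.v *)
From HB Require Import structures.
From mathcomp Require Import all_boot all_order all_algebra.
From mathcomp Require Import all_classical all_reals all_analysis.
Import Order.TTheory GRing.Theory Num.Theory.
Import numFieldNormedType.Exports.

Set Implicit Arguments.
Unset Strict Implicit.
Unset Printing Implicit Defensive.

Local Open Scope classical_set_scope.
Local Open Scope ring_scope.

Section lebesgue_tuple.
Context {R : realType}.

Definition tuple_cons n (p : n.-tuple R * R) : n.+1.-tuple R :=
  [tuple of p.2 :: p.1].

Lemma measurable_tuple_cons n :
  measurable_fun [set: n.-tuple R * R] (@tuple_cons n).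
Proof. exact: (measurable_cons (f := snd) (g := fst)). Qed.

(* Lebesgue measure on R^n, with R^n represented by the measurable space
   n.-tuple R: lambda^0 is the unit mass and lambda^(n+1) is the image of the
   product measure lambda^n \x lambda under (v, u) |-> u :: v. *)
Fixpoint lebesgue_tuple n : {measure set (n.-tuple R) -> \bar R} :=
  match n with
  | 0 => \d_ ([tuple] : 0.-tuple R)
  | n'.+1 => measure_function_pushforward__canonical__measure_function_Measure
      (lebesgue_tuple n' \x lebesgue_measure)%E (measurable_tuple_cons (n := n'))
  end.

End lebesgue_tuple.

Section processes.
Context {R : realType} {dsp : measure_display} {T : measurableType dsp}.
Variable P : probability T R.

(* A stochastic process is a family of random variables X s, of which only the
   times s >= 0 matter. *)

Definition process_sigma_algebra (X : R -> T -> R) : set (set T) :=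
  <<s [set A | exists s (B : set R),
         [/\ 0 <= s, measurable B & A = X s @^-1` B]] >>.

(* The product rule over the whole finite family gives it for every subfamily,
   by taking E i = setT. *)
Definition mutually_independent (I : finType) (X : I -> R -> T -> R) :=
  forall E : I -> set T, (forall i, process_sigma_algebra (X i) (E i)) ->
  P (\bigcap_i E i) = (\prod_i P (E i))%E.

Definition cauchy_density (s x : R) : R := s / (pi * (s ^+ 2 + x ^+ 2)).

Definition independent_increments (X : R -> T -> R) :=
  forall (n : nat) (s : nat -> R) (B : nat -> set R),
  0 <= s 0%N -> (forall i, s i <= s i.+1) -> (forall i, measurable (B i)) ->
  let E i := [set w | B i (X (s i.+1) w - X (s i) w)] in
  P (\bigcap_(i < n) E i) = (\prod_(i < n) P (E i))%E.

Definition cauchy_increments (X : R -> T -> R) :=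
  forall (s t : R) (B : set R), 0 <= s -> s < t -> measurable B ->
  P [set w | B (X t w - X s w)] =
  (\int[lebesgue_measure]_(x in B) (cauchy_density (t - s) x)%:E)%E.

Definition cadlag (f : R -> R) :=
  (forall s, 0 <= s -> f u @[u --> s^'+] --> f s) /\
  (forall s, 0 < s -> cvg (f u @[u --> s^'-])).

(* The Levy process whose law at time s is the Cauchy law of scale s. *)
Definition standard_cauchy_process (X : R -> {RV P >-> R}) :=
  [/\ {ae P, forall w, X 0 w = 0},
      independent_increments (fun s => X s),
      cauchy_increments (fun s => X s) &
      {ae P, forall w, cadlag (fun s => X s w)}].

(* f is a density of J.  J is only required to coincide almost surely with a
   random vector Y: a Cauchy process sampled at a random time is measurable up
   to a P-null set, its paths being cadlag almost surely. *)
Definition has_density d (J : T -> d.-tuple R) (f : d.-tuple R -> R) :=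
  exists Y : {RV P >-> d.-tuple R},
    {ae P, forall w, J w = Y w} /\
    forall B : set (d.-tuple R), measurable B ->
      distribution P Y B = (\int[lebesgue_tuple d]_(x in B) (f x)%:E)%E.

Definition J_CC d (C : 'I_d -> R -> T -> R) (C0 : R -> T -> R) (t : R) (w : T) :
  d.-tuple R := [tuple (C j `|C0 t w| w) | j < d].

(* The family C_1, ..., C_d, C, where None stands for the last process. *)
Definition with_last d (C : 'I_d -> R -> T -> R) (C0 : R -> T -> R)
  (i : option 'I_d) : R -> T -> R := if i is Some j then C j else C0.

End processes.

Section fractional_equation.
Context {R : realType}.

Definition riesz_integrand (f : R -> R) (x y : R) : R :=
  (f (x - y) - 2 * f x + f (x + y)) / y ^+ 2.

Definition riesz_ex (f : R -> R) (x : R) : Prop :=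
  lebesgue_measure.-integrable `]0, +oo[ (EFin \o riesz_integrand f x).

Definition riesz (f : R -> R) (x : R) : R :=
  - pi^-1 * \int[lebesgue_measure]_(y in `]0, +oo[) riesz_integrand f x y.

Definition twice_derivable (f : R -> R) (x : R) : Prop :=
  (\forall y \near x, derivable f y 1) /\ derivable (f^`())%classic x 1.

Variable d : nat.
Implicit Types (f : d.-tuple R -> R) (x : d.-tuple R).

Definition upd x (k : 'I_d) (u : R) : d.-tuple R :=
  [tuple (if i == k then u else tnth x i) | i < d].

Definition slice f x (k : 'I_d) : R -> R := fun u => f (upd x k u).

Definition pderive2_ex (k : 'I_d) f x : Prop :=
  twice_derivable (slice f x k) (tnth x k).

Definition pderive2 (k : 'I_d) f x : R := ((slice f x k)^`(2))%classic (tnth x k).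

Definition priesz_ex (k : 'I_d) f x : Prop := riesz_ex (slice f x k) (tnth x k).

Definition priesz (k : 'I_d) f x : R := riesz (slice f x k) (tnth x k).

(* All the integrals in the composition priesz k (priesz j f) at x converge
   absolutely; the inner one may diverge on a null set of the integration
   variable of the outer one. *)
Definition mixed_priesz_ex (k j : 'I_d) f x : Prop :=
  [/\ priesz_ex j f x,
      {ae lebesgue_measure, forall u : R, priesz_ex j f (upd x k u)} &
      priesz_ex k (priesz j f) x].

Definition fractional_equation_at (p : d.-tuple R -> R -> R) x (t : R) : Prop :=
  [/\ twice_derivable (p x) t,
      forall k, pderive2_ex k (p ^~ t) x,
      forall k j : 'I_d, (j < k)%N -> mixed_priesz_ex k j (p ^~ t) x &
      ((p x)^`(2))%classic t =
        \sum_(k < d) pderive2 k (p ^~ t) x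
        - 2 * \sum_(k < d) \sum_(j < d | (j < k)%N)
                priesz k (priesz j (p ^~ t)) x].

(* p(x, 0) = \prod_j delta(x_j): the measures p(x, t) dx converge weakly to the
   unit mass at the origin as t decreases to 0.  Test functions live on 'rV[R]_d
   because tuples carry no topology. *)
Definition initial_delta (p : d.-tuple R -> R -> R) : Prop :=
  forall phi : 'rV[R]_d -> R,
    continuous phi -> (exists M : R, forall y, `|phi y| <= M) ->
    \int[lebesgue_tuple d]_x (phi (\row_j tnth x j) * p x t)
      @[t --> 0^'+] --> phi 0.

Definition p_CC_integrand x (t s : R) : R :=
  (\prod_(j < d) (s / (s ^+ 2 + tnth x j ^+ 2))) * (t / (t ^+ 2 + s ^+ 2)).

(* Where the integral diverges (for instance at x = 0 when d >= 1) the value is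
   the default 0; this happens only on a null set of x. *)
Definition p_CC x (t : R) : R :=
  2 / pi ^+ d.+1 *
  \int[lebesgue_measure]_(s in `]0, +oo[) p_CC_integrand x t s.

(* With m vanishing coordinates, s |-> \prod_j s / (s^2 + x_j^2) behaves like
   s^(d - 2m) at 0.  Then p_CC is twice differentiable at x in every x_k exactly
   when d - 2m >= 2: if d - 2m = 1 the second derivatives in the vanishing
   coordinates diverge logarithmically, if d - 2m = 0 the density has a kink in
   them (e.g. d = 2, x_1 = 0), if d - 2m < 0 it is infinite.  When no coordinate
   vanishes the condition is d > 1. *)
Definition regular_point x : Prop := (2 * count_mem 0%R x + 2 <= d)%N.

End fractional_equation.

(* Main.v *)
(* Write P_s(x) = s / (s^2 + x^2), so that up to constants the density of
   J_CC^d(t) is p(x, t) = int_0^oo W(s) P_t(s) ds with W(s) = prod_j P_s(x_j).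

   Equation.  The kernel P is harmonic: d^2/ds^2 P = - d^2/dx^2 P.  The Riesz
   integrand of P_s is a rational function with an explicit primitive (logarithms
   and arctangents), and its integral gives d/d|x| P_s = - d/ds P_s.  By Fubini
   and differentiation under the integral sign, the right-hand side of the
   equation becomes the integral of
     sum_k d^2/dx_k^2 W
       - 2 sum_(j<k) (d/ds P_s(x_j)) (d/ds P_s(x_k)) prod_(i<>j,k) P_s(x_i)
     = - d^2/ds^2 W
   against P_t.  Two integrations by parts turn this into
   - int W d^2/ds^2 P_t ds, which is d^2/dt^2 p by harmonicity again.  At a regular
   point W(s) = O(s^2), so the boundary terms vanish and all the integrals are
   dominated by W(s) P_t(s) / s^2 near 0.

   Density.  Sample the processes C_j at a grid time T_n tending to |C(t)| from above.
   Since T_n takes countably many values, independence gives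
   P(C_j(T_n) in B_j for all j) = E[prod_j m_j(T_n)], where m_j(s) is the Cauchy
   mass of B_j at time s.  This tends to E[prod_j m_j(|C(t)|)], which is the
   integral of p over the box by Tonelli.  The sampled vectors converge almost
   surely by right-continuity, and open lower orthants determine the law.

   Initial condition.  C(t) and then C_j(|C(t)|) tend to 0 almost surely by
   right-continuity at time 0, hence also in law. *)

(* The obstacle in the equation is that moving along a slice may leave the regular points: setting a
   nonzero coordinate to 0 lowers d - 2m by two, and the integral defining [p_CC] may then diverge
   and take its default value. Formulas along a slice are therefore asserted only under
   [(u != 0) || (u == tnth x k)]; an outer Riesz integral meets the lost point u = 0 only at y =
   |x_k|, a null set. The interchanges of limits at a regular point reduce to one integrability
   test. Each integrand is compared with [weight x] times a multiplier times [pker t], where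
   [pker_ld] and [pker_ldx] express derivatives as multipliers of size s^-1 and s^-2. Multipliers up
   to 1 + s^-2 are allowed, which is the size of the second-order terms, so the equation becomes a
   relation between multipliers, proved by one explicit antiderivative. In the probabilistic half,
   joint measurability of C_j(s, w) in (s, w) is not assumed; the countably valued grid times supply
   the measurability of the sampled vector as well as its law. *)
Require Import Defs.
From HB Require Import structures.
From mathcomp Require Import all_boot all_order all_algebra.
From mathcomp Require Import all_classical all_reals all_analysis.
From mathcomp Require Import measurable_realfun ring lra.
Import Order.TTheory GRing.Theory Num.Theory.
Import numFieldNormedType.Exports.

Set Implicit Arguments.
Unset Strict Implicit.
Unset Printing Implicit Defensive.

Local Open Scope classical_set_scope.
Local Open Scope ring_scope.

(** * Measurability and differentiation rules for real functions *)

Section real_functions.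
Context {R : realType}.

Lemma measurable_inv (D : set R) : measurable D ->
  measurable_fun D (fun x : R => x^-1).
Proof.
move=> mD; apply: measurable_funTS.
have -> : [set: R] = [set 0] `|` [set~ 0] by rewrite setUv.
apply/measurable_funU => //; first exact: measurableC.
split; last first.
  apply: measurable_realfun.open_continuous_measurable_fun.
    by apply: closed_openC; exact: closed_eq.
  by move=> x; rewrite inE/= => /eqP x0; exact: inv_continuous.
apply: (@eq_measurable_fun _ _ _ _ _ (cst (0 : R))) => // x.
by rewrite inE/= => ->; rewrite invr0.
Qed.

Lemma measurable_funV d (T : measurableType d) (D : set T) (f : T -> R) :
  measurable_fun D f -> measurable_fun D (fun x => (f x)^-1).
Proof. by move=> mf; apply: measurableT_comp mf; exact: measurable_inv. Qed.

Lemma measurable_funf_div d (T : measurableType d) (D : set T) (f g : T -> R) :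
  measurable_fun D f -> measurable_fun D g ->
  measurable_fun D (fun x => f x / g x).
Proof. by move=> mf mg; apply: measurable_funM => //; exact: measurable_funV. Qed.

Lemma is_derive_div (f g : R -> R) (x df dg : R) : g x != 0 ->
  is_derive x 1 f df -> is_derive x 1 g dg ->
  is_derive x 1 (fun y => f y / g y) ((df * g x - f x * dg) / g x ^+ 2).
Proof.
move=> gx0 hf hg.
have hV : is_derive x 1 (fun y => (g y)^-1) (- (g x) ^- 2 *: dg).
  exact: is_deriveV.
apply: (is_derive_eq (is_deriveM hf hV)).
rewrite /GRing.scale/=; field; exact: gx0.
Qed.

Lemma is_derive_ext (f g : R -> R) (x df dg : R) :
  is_derive x 1 f df -> f =1 g -> df = dg -> is_derive x 1 g dg.
Proof. by move=> hf /funext <- <-. Qed.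

Lemma is_derive_mul (f g : R -> R) (x df dg : R) :
  is_derive x 1 f df -> is_derive x 1 g dg ->
  is_derive x 1 (fun y => f y * g y) (df * g x + f x * dg).
Proof.
move=> hf hg; apply: (is_derive_eq (is_deriveM hf hg)).
by rewrite /GRing.scale/=; ring.
Qed.

Lemma is_derive_add (f g : R -> R) (x df dg : R) :
  is_derive x 1 f df -> is_derive x 1 g dg ->
  is_derive x 1 (fun y => f y + g y) (df + dg).
Proof. by move=> hf hg; exact: is_deriveD. Qed.

Lemma is_derive_sub (f g : R -> R) (x df dg : R) :
  is_derive x 1 f df -> is_derive x 1 g dg ->
  is_derive x 1 (fun y => f y - g y) (df - dg).
Proof. by move=> hf hg; exact: is_deriveB. Qed.

Lemma is_derive_sqr (f : R -> R) (x df : R) :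
  is_derive x 1 f df -> is_derive x 1 (fun y => f y ^+ 2) (2 * f x * df).
Proof.
move=> hf; apply: (is_derive_eq (is_deriveM hf hf)).
by rewrite /GRing.scale/=; ring.
Qed.

Lemma is_derive_scale (k x : R) : is_derive x 1 (fun y => k * y) k.
Proof.
apply: (is_derive_eq (is_derive_mul (is_derive_cst k x 1) (is_derive_id x 1))).
by rewrite mul0r add0r mulr1.
Qed.

Lemma is_derive_sqr_addr (x c : R) : is_derive x 1 (fun y : R => c + y ^+ 2) (2 * x).
Proof.
apply: (is_derive_eq (is_deriveD (is_derive_cst c x 1)
  (is_deriveM (is_derive_id x 1) (is_derive_id x 1)))).
by rewrite /GRing.scale/=; ring.
Qed.

Lemma is_derive_sqr_addl (x c : R) : is_derive x 1 (fun y : R => y ^+ 2 + c) (2 * x).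
Proof.
rewrite (_ : (fun y => _) = (fun y : R => c + y ^+ 2)).
  exact: is_derive_sqr_addr.
by apply/funext => y; rewrite addrC.
Qed.

(** The derivative is kept in logarithmic form, with [a i] the logarithmic derivative of [q i]: the
    whole product survives as a factor and no product with a missing factor appears. *)
Lemma is_derive_bigprod (I : Type) (r : seq I) (q a : I -> R -> R) (s : R) :
  (forall i, is_derive s 1 (q i) (q i s * a i s)) ->
  is_derive s 1 (fun s => \prod_(i <- r) q i s)
    ((\prod_(i <- r) q i s) * \sum_(i <- r) a i s).
Proof.
move=> dq; elim: r => [|i r IH].
  under eq_fun do rewrite big_nil.
  by rewrite !big_nil mulr0; exact: is_derive_cst.
under eq_fun do rewrite big_cons.
apply: (is_derive_eq (is_deriveM (dq i) IH)).
by rewrite /GRing.scale/= !big_cons; ring.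
Qed.

End real_functions.

(** * The kernel s / (s^2 + x^2): derivatives and bounds *)

Section kernel.
Context {R : realType}.
Implicit Types s t x y u : R.

Lemma sqrD_gt0 s x : 0 < s -> 0 < s ^+ 2 + x ^+ 2.
Proof. by move=> s0; rewrite ltr_pwDl ?exprn_gt0 ?sqr_ge0. Qed.

Definition pker s x : R := s / (s ^+ 2 + x ^+ 2).

Definition pker_ds s x : R := (x ^+ 2 - s ^+ 2) / (s ^+ 2 + x ^+ 2) ^+ 2.

Lemma pker_gt0 s x : 0 < s -> 0 < pker s x.
Proof. by move=> s0; rewrite divr_gt0 ?sqrD_gt0. Qed.

Lemma is_derive_pker_s s x : 0 < s -> is_derive s 1 (pker ^~ x) (pker_ds s x).
Proof.
move=> s0; have A0 := lt0r_neq0 (sqrD_gt0 x s0).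
apply: (is_derive_ext (is_derive_div _ (is_derive_id s 1)
  (is_derive_sqr_addl s (x ^+ 2)))) => //=.
by rewrite /pker_ds; field.
Qed.

Lemma is_derive_pker_ss s x : 0 < s ->
  is_derive s 1 (pker_ds ^~ x)
    (2 * s * (s ^+ 2 - 3 * x ^+ 2) / (s ^+ 2 + x ^+ 2) ^+ 3).
Proof.
move=> s0; have A0 := lt0r_neq0 (sqrD_gt0 x s0).
apply: (is_derive_ext (is_derive_div _
  (is_derive_sub (is_derive_cst (x ^+ 2) s 1) (is_derive_sqr (is_derive_id s 1)))
  (is_derive_sqr (is_derive_sqr_addl s (x ^+ 2))))) => //.
  by rewrite sqrf_eq0.
by rewrite /cst/=; field.
Qed.

Definition pker_dx s x : R := - (2 * s * x) / (s ^+ 2 + x ^+ 2) ^+ 2.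

Definition pker_dxx s x : R :=
  s * (6 * x ^+ 2 - 2 * s ^+ 2) / (s ^+ 2 + x ^+ 2) ^+ 3.

Lemma is_derive_pker_x s x : 0 < s -> is_derive x 1 (pker s) (pker_dx s x).
Proof.
move=> s0; have A0 := lt0r_neq0 (sqrD_gt0 x s0).
apply: (is_derive_ext (is_derive_div _ (is_derive_cst s x 1)
  (is_derive_sqr_addr x (s ^+ 2)))) => //=.
by rewrite /pker_dx/=; field.
Qed.

Lemma is_derive_pker_xx s x : 0 < s ->
  is_derive x 1 (pker_dx s) (pker_dxx s x).
Proof.
move=> s0; have A0 := lt0r_neq0 (sqrD_gt0 x s0).
apply: (is_derive_ext (is_derive_div _ (is_derive_scale (- (2 * s)) x)
    (is_derive_sqr (is_derive_sqr_addr x (s ^+ 2))))).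
- by rewrite sqrf_eq0.
- by move=> y; rewrite /pker_dx mulNr.
- by rewrite /pker_dxx; field.
Qed.

Lemma pker_ds_bound s x : 0 < s -> `|pker_ds s x| <= (s ^+ 2 + x ^+ 2)^-1.
Proof.
move=> s0; have A0 := sqrD_gt0 x s0.
rewrite /pker_ds normf_div [X in _ / X]gtr0_norm ?exprn_gt0//.
rewrite ler_pdivrMr ?exprn_gt0// expr2 mulrA mulVf ?gt_eqF// mul1r.
have := sqr_ge0 s; have := sqr_ge0 x; rewrite ler_norml => ? ?.
by apply/andP; split; lra.
Qed.

Lemma pker_dx_bound s x : 0 < s -> `|pker_dx s x| <= (s ^+ 2 + x ^+ 2)^-1.
Proof.
move=> s0; have A0 := sqrD_gt0 x s0.
rewrite /pker_dx normf_div [X in _ / X]gtr0_norm ?exprn_gt0//.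
rewrite ler_pdivrMr ?exprn_gt0// expr2 mulrA mulVf ?gt_eqF// mul1r.
rewrite ler_norml; have := sqr_ge0 (s - x); have := sqr_ge0 (s + x) => ? ?.
by apply/andP; split; nra.
Qed.

Lemma pker_dxx_bound s x : 0 < s ->
  `|pker_dxx s x| <= 6 * pker s x / (s ^+ 2 + x ^+ 2).
Proof.
move=> s0; have A0 := sqrD_gt0 x s0.
rewrite /pker_dxx normf_div [X in _ / X]gtr0_norm ?exprn_gt0//.
rewrite ler_pdivrMr ?exprn_gt0// normrM gtr0_norm//.
rewrite [leRHS](_ : _ = s * (6 * (s ^+ 2 + x ^+ 2))); last first.
  by rewrite /pker; field; exact: lt0r_neq0.
rewrite ler_pM2l// ler_norml; have := sqr_ge0 s; have := sqr_ge0 x => ? ?.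
by apply/andP; split; lra.
Qed.

(** By harmonicity the left-hand quantity is the opposite of [pker_dxx], so it inherits the same
    bound. *)
Lemma pker_ss_bound s x : 0 < s ->
  `|2 * s * (s ^+ 2 - 3 * x ^+ 2) / (s ^+ 2 + x ^+ 2) ^+ 3| <=
  6 * pker s x / (s ^+ 2 + x ^+ 2).
Proof.
move=> s0; rewrite (_ : 2 * s * _ / _ = - pker_dxx s x); last first.
  by rewrite /pker_dxx -[RHS]mulNr; congr (_ / _); ring.
by rewrite normrN; exact: pker_dxx_bound.
Qed.

(* The logarithmic derivative of [pker] in [s]. *)
Definition pker_ld s x : R := (x ^+ 2 - s ^+ 2) / (s * (s ^+ 2 + x ^+ 2)).

Lemma pker_dsE s x : 0 < s -> pker_ds s x = pker s x * pker_ld s x.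
Proof.
move=> s0; have A0 := lt0r_neq0 (sqrD_gt0 x s0).
by rewrite /pker_ds /pker /pker_ld; field; rewrite A0 gt_eqF.
Qed.

Lemma pker_ld_bound s x : 0 < s -> `|pker_ld s x| <= s^-1.
Proof.
move=> s0; have A0 := sqrD_gt0 x s0.
rewrite /pker_ld normf_div [X in _ / X]gtr0_norm ?mulr_gt0//.
rewrite ler_pdivrMr ?mulr_gt0// mulrA mulVf ?gt_eqF// mul1r.
have := sqr_ge0 s; have := sqr_ge0 x; rewrite ler_norml => ? ?.
by apply/andP; split; lra.
Qed.

(* By harmonicity of [pker], [pker_ld ^+ 2 + d/ds pker_ld = - pker_dxx / pker]. *)
Lemma is_derive_pker_ld s x : 0 < s -> is_derive s 1 (pker_ld ^~ x)
  (- (6 * x ^+ 2 - 2 * s ^+ 2) / (s ^+ 2 + x ^+ 2) ^+ 2 - pker_ld s x ^+ 2).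
Proof.
move=> s0; have A0 := lt0r_neq0 (sqrD_gt0 x s0).
apply: (is_derive_ext (is_derive_div _
  (is_derive_sub (is_derive_cst (x ^+ 2) s 1) (is_derive_sqr (is_derive_id s 1)))
  (is_derive_mul (is_derive_id s 1) (is_derive_sqr_addl s (x ^+ 2))))) => //.
  by rewrite mulf_neq0// gt_eqF.
by rewrite /pker_ld /cst/=; field; rewrite A0 gt_eqF.
Qed.

End kernel.

(** * Integration on the half-line and the Riesz integrand of the kernel *)

Section half_line.
Context {R : realType}.
Notation mu := (@lebesgue_measure R).
Implicit Types s t x y : R.

Lemma continuous_measurable_EFin (D : set (measurableTypeR R)) (f : R -> R) :
  continuous f -> measurable_fun D (fun x => (f x)%:E).
Proof.
move=> cf; apply/measurable_EFinP.
have mf : measurable_fun [set: measurableTypeR R] f.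
  exact: continuous_measurable_fun.
exact: measurable_funTS mf.
Qed.

(** Since [f] may change sign, the compact intervals [[a n, b n]] exhausting the half-line are
    handled by dominated convergence, with |f| itself as dominating function. Only one-sided limits
    of [F] are used at the ends. *)
Lemma FTC_0y (f F : R -> R) (l0 l : R) :
  mu.-integrable `]0, +oo[ (EFin \o f) ->
  (forall x : R, 0 < x -> {for x, continuous f}) ->
  (forall x : R, 0 < x -> is_derive x 1 F (f x)) ->
  F x @[x --> 0^'+] --> l0 -> F x @[x --> +oo] --> l ->
  (\int[mu]_(x in `]0%R, +oo[) (f x)%:E = (l - l0)%:E)%E.
Proof.
move=> intf cf dF Fl0 Fl.
pose a n : R := n.+1%:R^-1; pose b n : R := n.+2%:R.
have a0 n : 0 < a n by rewrite invr_gt0.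
have ab n : a n < b n.
  by rewrite (@le_lt_trans _ _ 1)// ?invf_le1 ?ler1n ?ltr1n.
pose f_ n := (EFin \o f) \_ `[a n, b n].
have subD n : `[a n, b n] `<=` `]0, +oo[.
  by move=> x /=; rewrite !in_itv/= andbT => /andP[ax _]; exact: lt_le_trans ax.
have mf : measurable_fun (`]0, +oo[ : set (measurableTypeR R)) (EFin \o f).
  exact: measurable_int intf.
have f_f x : (`]0, +oo[%classic : set R) x -> f_ n x @[n --> \oo] --> (EFin \o f) x.
  rewrite /= in_itv/= andbT => x0; apply: (@cvg_near_cst _ (\bar R)).
  have := @cvg_harmonic R => /cvgrPdist_lt/(_ _ x0) H1.
  have := @cvgr_idn R => /cvgryPge/(_ x) H2.
  near=> n; rewrite /f_ patchE mem_set// /= in_itv/=; apply/andP; split.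
    have : `|0 - harmonic n| < x by near: n.
    by rewrite sub0r normrN gtr0_norm// => /ltW.
  rewrite (@le_trans _ _ (n%:R))//; first by near: n.
  by rewrite ler_nat ltnW// ltnW.
have mf_ n : measurable_fun (`]0, +oo[ : set (measurableTypeR R)) (f_ n).
  apply/measurable_restrict => //; apply: measurable_funS mf => //.
have f_le : {ae mu, forall x n, (`]0, +oo[%classic : set R) x -> (`|f_ n x| <= `|(f x)%:E|)%E}.
  by apply: aeW => x n _; rewrite /f_ patchE; case: ifPn => // _; rewrite abse0.
have f_f' := aeW mu f_f.
have [_ _] := @dominated_convergence _ _ _ mu _ (measurable_itv _) _ _ _ mf_ mf f_f'
  (integrable_abse intf) f_le.
have -> : (fun n => \int[mu]_(x in `]0%R, +oo[) f_ n x)%E =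
    (fun n => (F (b n) - F (a n))%:E).
  apply/funext => n; rewrite /f_ -integral_mkcondr (setIidr (subD n)).
  have dFx x : a n <= x -> is_derive x 1 F (f x).
    by move=> ax; apply: dF; exact: lt_le_trans ax.
  have cF x : a n <= x -> {for x, continuous F}.
    move=> ax; apply/differentiable_continuous/derivable1_diffP.
    by have := dFx _ ax; case.
  rewrite (@continuous_FTC2 _ f F)//.
  - apply: continuous_in_subspaceT => x; rewrite inE/= in_itv/= => /andP[ax _].
    by apply: cf; exact: lt_le_trans ax.
  - split.
    + by move=> x; rewrite in_itv/= => /andP[/ltW/dFx[]].
    + by apply: cvg_at_right_filter; exact: cF.
    + by apply: cvg_at_left_filter; exact/cF/ltW.
  - move=> x; rewrite in_itv/= => /andP[/ltW/dFx dfx _].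
    by rewrite derive1E derive_val.
move=> H; apply/esym; apply: cvg_unique H => //.
apply: cvg_EFin; first exact: nearW.
apply: cvgB.
- move/cvg_pinftyP : Fl; apply.
  rewrite (_ : b = fun n => (n + 2)%:R); last by apply/funext => n; rewrite addn2.
  by rewrite (@cvg_shiftn 2 _ (fun n => n%:R : R)); exact: cvgr_idn.
- by move/cvg_at_rightP : Fl0; apply; split => //; exact: cvg_harmonic.
Unshelve. all: by end_near.
Qed.

(** The Riesz integrand of [pker s] after cancellation of y^2, hence continuous through y = 0. *)
Definition pker_riesz s x y : R := 2 * s * (3 * x ^+ 2 - s ^+ 2 - y ^+ 2) /
  ((s ^+ 2 + x ^+ 2) * ((s ^+ 2 + (x - y) ^+ 2) * (s ^+ 2 + (x + y) ^+ 2))).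

Lemma pker_rieszE s x y : 0 < s -> y != 0 ->
  riesz_integrand (pker s) x y = pker_riesz s x y.
Proof.
move=> s0 y0; rewrite /riesz_integrand /pker /pker_riesz.
have A1 := lt0r_neq0 (sqrD_gt0 x s0).
have A2 := lt0r_neq0 (sqrD_gt0 (x - y) s0).
have A3 := lt0r_neq0 (sqrD_gt0 (x + y) s0).
by field; rewrite A1 A2 A3 y0.
Qed.

(** Over the common denominator the two translated kernels add up to 2 s (s^2 + x^2 + y^2), so only
    |3 x^2 - s^2 - y^2| <= 3 (s^2 + x^2 + y^2) is at stake. *)
Lemma pker_riesz_bound s x y : 0 < s -> `|pker_riesz s x y| <=
  3 / (s ^+ 2 + x ^+ 2) * (pker s (y - x) + pker s (y + x)).
Proof.
move=> s0.
have A1 := sqrD_gt0 x s0; have A2 := sqrD_gt0 (x - y) s0.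
have A3 := sqrD_gt0 (x + y) s0.
have A4 := lt0r_neq0 (sqrD_gt0 (y - x) s0).
have A5 := lt0r_neq0 (sqrD_gt0 (y + x) s0).
rewrite /pker_riesz normf_div [X in _ / X <= _]gtr0_norm ?mulr_gt0//.
rewrite ler_pdivrMr ?mulr_gt0//.
rewrite [leRHS](_ : _ = 2 * s * (3 * (s ^+ 2 + x ^+ 2 + y ^+ 2))); last first.
  by rewrite /pker; field; rewrite A4 A5 lt0r_neq0.
rewrite normrM gtr0_norm ?mulr_gt0// ler_pM2l ?mulr_gt0// ler_norml.
have := sqr_ge0 s; have := sqr_ge0 x; have := sqr_ge0 y => ? ? ?.
by apply/andP; split; lra.
Qed.

Lemma is_derive_shift_atan s c y : 0 < s ->
  is_derive y 1 (fun y => atan ((y + c) / s)) (pker s (y + c)).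
Proof.
move=> s0.
have h : is_derive y 1 (fun y => (y + c) / s) s^-1.
  apply: (is_derive_ext (is_derive_mul
    (is_derive_add (is_derive_id y 1) (is_derive_cst c y 1))
    (is_derive_cst s^-1 y 1))) => //=.
  by rewrite /cst/=; ring.
apply: (is_derive_ext (@is_derive1_comp _ atan (fun y => (y + c) / s) _ _ _
  (is_derive1_atan ((y + c) / s)) h)) => //.
move: (y + c) => z; have A0 := lt0r_neq0 (sqrD_gt0 z s0).
by rewrite /pker; field; rewrite A0 gt_eqF.
Qed.

Lemma is_derive_shift_ln s c y : 0 < s ->
  is_derive y 1 (fun y => ln (s ^+ 2 + (y + c) ^+ 2))
    (2 * (y + c) / (s ^+ 2 + (y + c) ^+ 2)).
Proof.
move=> s0; have A0 := sqrD_gt0 (y + c) s0.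
have h : is_derive y 1 (fun y => s ^+ 2 + (y + c) ^+ 2) (2 * (y + c)).
  apply: (is_derive_ext (is_derive_add (is_derive_cst (s ^+ 2) y 1)
    (is_derive_sqr (is_derive_add (is_derive_id y 1) (is_derive_cst c y 1)))))
     => //=.
  by rewrite /cst/=; ring.
have hc := @is_derive1_comp _ (@ln R) (fun y => s ^+ 2 + (y + c) ^+ 2) y _ _
  (is_derive1_ln A0) h.
by apply: (is_derive_ext hc) => //; rewrite mulrC.
Qed.

Lemma cvg_shift_atan s c : 0 < s ->
  atan ((y + c) / s) @[y --> +oo] --> (pi / 2 : R).
Proof.
move=> s0; apply: cvg_comp (@cvgy_atan R).
apply/cvgryPge => A; near=> y.
rewrite ler_pdivlMr// -lerBlDr; near: y.
by apply: nbhs_pinfty_ge; rewrite num_real.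
Unshelve. all: by end_near. Qed.

Lemma cvg_ratio_ln s x : 0 < s ->
  ln (s ^+ 2 + (y - x) ^+ 2) - ln (s ^+ 2 + (y + x) ^+ 2) @[y --> +oo] --> (0 : R).
Proof.
move=> s0.
have -> : (fun y => ln (s ^+ 2 + (y - x) ^+ 2) - ln (s ^+ 2 + (y + x) ^+ 2)) =
    @ln R \o (fun y => (s ^+ 2 + (y - x) ^+ 2) / (s ^+ 2 + (y + x) ^+ 2)).
  by apply/funext => y /=; rewrite ln_div// posrE sqrD_gt0.
rewrite -(@ln1 R); apply: continuous_cvg; first exact/continuous_ln.
apply/cvgrPdist_le => e e0; near=> y.
have A0 := sqrD_gt0 (y + x) s0.
have y1 : 1 <= y by near: y; apply: nbhs_pinfty_ge; rewrite num_real.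
have y2 : 2 * `|x| <= y by near: y; apply: nbhs_pinfty_ge; rewrite num_real.
(* The bound [y2] gives y + x >= y / 2, so it suffices that 4 |x| y <= e y^2 / 4, whence the
   constant 16. *)
have y3 : 16 * `|x| / e <= y by near: y; apply: nbhs_pinfty_ge; rewrite num_real.
have -> : 1 - (s ^+ 2 + (y - x) ^+ 2) / (s ^+ 2 + (y + x) ^+ 2) =
    4 * x * y / (s ^+ 2 + (y + x) ^+ 2) by field; rewrite gt_eqF.
rewrite normf_div [X in _ / X]gtr0_norm// ler_pdivrMr//.
rewrite !normrM [`|y|]ger0_norm ?(le_trans _ y1)// ger0_norm//.
move: y3; rewrite ler_pdivrMr// => y3.
have yx : y / 2 <= y + x.
  have : - `|x| <= x by rewrite lerNl -normrN ler_norm.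
  lra.
have : (y / 2) ^+ 2 <= (y + x) ^+ 2.
  rewrite ler_sqr ?nnegrE//; lra.
have := sqr_ge0 s.
nra.
Unshelve. all: by end_near. Qed.

Let pker_pair_antideriv s x y := atan ((y - x) / s) + atan ((y + x) / s).

Lemma is_derive_pker_pair s x y : 0 < s ->
  is_derive y 1 (pker_pair_antideriv s x) (pker s (y - x) + pker s (y + x)).
Proof.
by move=> s0; apply: is_derive_add; exact: is_derive_shift_atan.
Qed.

Lemma is_derive_continuous (f : R -> R) (x df : R) :
  is_derive x 1 f df -> {for x, continuous f}.
Proof.
by move=> [? _]; apply/differentiable_continuous/derivable1_diffP.
Qed.

Lemma pker_continuous s : 0 < s -> continuous (pker s).
Proof.
by move=> s0 x; apply: is_derive_continuous; exact: is_derive_pker_x.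
Qed.

Lemma continuous_pker_pair s x : 0 < s ->
  continuous (fun y => pker s (y - x) + pker s (y + x)).
Proof.
move=> s0 y; apply: cvgD.
- apply: (@continuous_comp _ _ _ (fun y => y - x)); last exact: pker_continuous.
  by apply: cvgB; [exact: cvg_id|exact: cvg_cst].
- apply: (@continuous_comp _ _ _ (fun y => y + x)); last exact: pker_continuous.
  by apply: cvgD; [exact: cvg_id|exact: cvg_cst].
Qed.

(** Reflecting one of the two terms turns this into the integral of a translated kernel over the
    whole line, so the value does not depend on x. *)
Lemma integral_pker_pair s x : 0 < s ->
  (\int[mu]_(y in `]0%R, +oo[) (pker s (y - x) + pker s (y + x))%:E = pi%:E)%E.
Proof.
move=> s0; rewrite integral_itv_obnd_cbnd; last first.
  by apply: continuous_measurable_EFin; exact: continuous_pker_pair.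
have F0 : pker_pair_antideriv s x 0 = 0.
  by rewrite /pker_pair_antideriv sub0r add0r mulNr atanN addNr.
rewrite (_ : pi%:E = pi%:E - (pker_pair_antideriv s x 0)%:E)%E; last first.
  by rewrite F0 sube0.
apply: (@ge0_continuous_FTC2y _ (fun y => pker s (y - x) + pker s (y + x))).
- by move=> y _; rewrite addr_ge0// ltW// pker_gt0.
- by apply: continuous_subspaceT; exact: continuous_pker_pair.
- rewrite (_ : pi = pi / 2 + pi / 2); last by rewrite -splitr.
  by apply: cvgD; exact: cvg_shift_atan.
- by move=> y _; have [] := is_derive_pker_pair x y s0.
- apply: cvg_at_right_filter.
  by apply: is_derive_continuous; exact: is_derive_pker_pair.
- move=> y _; rewrite derive1E; have h := is_derive_pker_pair x y s0.
  by rewrite derive_val.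
Qed.

Lemma integrable_pker_pair s x : 0 < s ->
  mu.-integrable `]0, +oo[ (fun y => (pker s (y - x) + pker s (y + x))%:E).
Proof.
move=> s0; apply/integrableP; split.
  by apply: continuous_measurable_EFin; exact: continuous_pker_pair.
under eq_integral => y _.
  rewrite gee0_abs ?lee_fin ?addr_ge0// ?(ltW (pker_gt0 _ s0))//.
  over.
by rewrite integral_pker_pair// ltry.
Qed.

End half_line.

(** * The Riesz derivative of the kernel *)

Section riesz_kernel.
Context {R : realType}.
Notation mu := (@lebesgue_measure R).
Implicit Types s t x y : R.

Lemma continuous_pker_riesz s x : 0 < s -> continuous (pker_riesz s x).
Proof.
move=> s0 y.
have -> : pker_riesz s x = (fun y => (2 / (s * (s ^+ 2 + x ^+ 2)) *
    (3 * x ^+ 2 - s ^+ 2 - y ^+ 2)) * (pker s (x - y) * pker s (x + y))).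
  apply/funext => z; rewrite /pker_riesz /pker.
  have A1 := lt0r_neq0 (sqrD_gt0 x s0).
  have A2 := lt0r_neq0 (sqrD_gt0 (x - z) s0).
  have A3 := lt0r_neq0 (sqrD_gt0 (x + z) s0).
  by field; rewrite A1 A2 A3 gt_eqF.
have h : {for y, continuous (fun y => 2 / (s * (s ^+ 2 + x ^+ 2)) *
    (3 * x ^+ 2 - s ^+ 2 - y ^+ 2))}.
  exact: (is_derive_continuous (is_derive_mul (is_derive_cst _ y 1)
    (is_derive_sub (is_derive_cst _ y 1) (is_derive_sqr (is_derive_id y 1))))).
apply: cvgM; first exact: h.
apply: cvgM.
- apply: (@continuous_comp _ _ _ (fun y => x - y)); last exact: pker_continuous.
  by apply: cvgB; [exact: cvg_cst|exact: cvg_id].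
- apply: (@continuous_comp _ _ _ (fun y => x + y)); last exact: pker_continuous.
  by apply: cvgD; [exact: cvg_cst|exact: cvg_id].
Qed.

Lemma integrable_pker_riesz_bound s x : 0 < s ->
  mu.-integrable `]0, +oo[ (fun y =>
    (3 / (s ^+ 2 + x ^+ 2) * (pker s (y - x) + pker s (y + x)))%:E).
Proof.
move=> s0; rewrite [X in mu.-integrable _ X](_ : _ =
    (fun y => (3 / (s ^+ 2 + x ^+ 2))%:E *
              (pker s (y - x) + pker s (y + x))%:E)%E) //.
by apply: integrableZl => //; exact: integrable_pker_pair.
Qed.

(** This decay in s is what lets Fubini exchange the Riesz integral with an integral over s: a
    weight h is acceptable when h(s) / (s^2 + x^2) is integrable. *)
Lemma integral_pker_riesz_bound s x : 0 < s ->
  (\int[mu]_(y in `]0%R, +oo[) `|(pker_riesz s x y)%:E| <=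
    (3 * pi / (s ^+ 2 + x ^+ 2))%:E)%E.
Proof.
move=> s0; have A0 := sqrD_gt0 x s0.
have -> : (3 * pi / (s ^+ 2 + x ^+ 2))%:E = (\int[mu]_(y in `]0%R, +oo[)
    (3 / (s ^+ 2 + x ^+ 2) * (pker s (y - x) + pker s (y + x)))%:E)%E.
  rewrite (mulrAC 3) EFinM -(integral_pker_pair x s0).
  under [RHS]eq_integral do rewrite EFinM.
  by rewrite integralZl//; exact: integrable_pker_pair.
apply: ge0_le_integral => //.
- apply: (@measurableT_comp _ _ _ _ _ _ (@abse R)) => //.
  by apply: continuous_measurable_EFin; exact: continuous_pker_riesz.
- by have /measurable_int := integrable_pker_riesz_bound x s0.
- by move=> y _; rewrite lee_fin pker_riesz_bound.
Qed.

Lemma integrable_pker_riesz s x : 0 < s ->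
  mu.-integrable `]0, +oo[ (EFin \o pker_riesz s x).
Proof.
move=> s0; apply: le_integrable (integrable_pker_riesz_bound x s0) => //.
- by apply: continuous_measurable_EFin; exact: continuous_pker_riesz.
- move=> y _; rewrite lee_fin (le_trans (pker_riesz_bound x y s0))//.
  exact: ler_norm.
Qed.

Lemma integral_pker_riesz s x : 0 < s ->
  (\int[mu]_(y in `]0%R, +oo[) (pker_riesz s x y)%:E = (pi * pker_ds s x)%:E)%E.
Proof.
move=> s0; have A0 := lt0r_neq0 (sqrD_gt0 x s0).
pose A := s ^+ 2 + x ^+ 2.
(* [c1] and [c2] come from the partial fraction decomposition of [pker_riesz s x] in y. The
   logarithmic part vanishes at 0 and at infinity; the arctangents contribute pi times [c2], which
   is [pker_ds s x]. *)
pose c1 := - (s * x / A ^+ 2).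
pose c2 := (x ^+ 2 - s ^+ 2) / A ^+ 2.
pose L y := ln (s ^+ 2 + (y - x) ^+ 2) - ln (s ^+ 2 + (y + x) ^+ 2).
pose G y := atan ((y - x) / s) + atan ((y + x) / s).
pose F y := c1 * L y + c2 * G y.
have dF y : is_derive y 1 F (pker_riesz s x y).
  apply: (is_derive_ext (is_derive_add
    (is_derive_mul (is_derive_cst c1 y 1) (is_derive_sub
       (is_derive_shift_ln (- x) y s0) (is_derive_shift_ln x y s0)))
    (is_derive_mul (is_derive_cst c2 y 1)
       (is_derive_pker_pair x y s0)))) => //=.
  rewrite /cst !mul0r !add0r /pker_riesz /pker /c1 /c2 /A.
  have A2 := lt0r_neq0 (sqrD_gt0 (x - y) s0).
  have A3 := lt0r_neq0 (sqrD_gt0 (x + y) s0).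
  rewrite -[y - x]opprB sqrrN (addrC y x).
  by field; rewrite A0 A2 A3.
have F0 : F 0 = 0.
  rewrite /F /L /G sub0r add0r sqrrN (mulNr x) atanN; ring.
have dFpos y : 0 < y -> is_derive y 1 F (pker_riesz s x y) by move=> _.
have cr y : 0 < y -> {for y, continuous (pker_riesz s x)}.
  by move=> _; exact: continuous_pker_riesz.
rewrite (@FTC_0y _ _ F (F 0) (pi * pker_ds s x) (integrable_pker_riesz x s0) cr dFpos).
- by rewrite F0 subr0.
- apply: cvg_at_right_filter.
  by apply: is_derive_continuous; exact: dF.
- rewrite (_ : pi * _ = c1 * 0 + c2 * (pi / 2 + pi / 2)); last first.
    by rewrite -splitr mulr0 add0r /c2 mulrC.
  apply: cvgD; apply: cvgM; try exact: cvg_cst.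
    exact: cvg_ratio_ln.
  by apply: cvgD; exact: cvg_shift_atan.
Qed.

End riesz_kernel.

(** * Integrability of real-valued combinations *)

Section integrable_real.
Context d (T : measurableType d) {R : realType} (mu : {measure set T -> \bar R}).
Variables (D : set T) (mD : measurable D).
Implicit Types f g : T -> R.

Lemma integrable_EFinD f g : mu.-integrable D (EFin \o f) ->
  mu.-integrable D (EFin \o g) ->
  mu.-integrable D (EFin \o (fun x => f x + g x)).
Proof.
move=> hf hg; rewrite [X in integrable _ _ X](_ : _ = (EFin \o f) \+ (EFin \o g))%E //.
exact: integrableD.
Qed.

Lemma integrable_EFinB f g : mu.-integrable D (EFin \o f) ->
  mu.-integrable D (EFin \o g) ->
  mu.-integrable D (EFin \o (fun x => f x - g x)).
Proof.
move=> hf hg; rewrite [X in integrable _ _ X](_ : _ = (EFin \o f) \- (EFin \o g))%E //.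
exact: integrableB.
Qed.

Lemma integrable_EFinZl k f : mu.-integrable D (EFin \o f) ->
  mu.-integrable D (EFin \o (fun x => k * f x)).
Proof.
move=> hf; rewrite [X in integrable _ _ X](_ : _ = fun x => k%:E * (f x)%:E)%E //.
exact: integrableZl.
Qed.

Lemma integrable_EFin_le f g : measurable_fun D f ->
  (forall x, D x -> `|f x| <= g x) ->
  mu.-integrable D (EFin \o g) -> mu.-integrable D (EFin \o f).
Proof.
move=> mf fg; apply: le_integrable => //; first exact/measurable_EFinP.
by move=> x Dx; rewrite lee_fin (le_trans (fg _ Dx))// ler_norm.
Qed.

Lemma EFin_Rintegral f : mu.-integrable D (EFin \o f) ->
  (\int[mu]_(x in D) f x)%:E = (\int[mu]_(x in D) (f x)%:E)%E.
Proof. by move=> hf; rewrite fineK//; exact: integrable_fin_num. Qed.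

End integrable_real.

(** * The Riesz derivative of a mixture of kernels *)

Section riesz_under_integral.
Context {R : realType}.
Notation mu := (@lebesgue_measure R).
Notation RL := (measurableTypeR R).
Notation pos := (`]0%R, +oo[%classic : set (measurableTypeR R)).

(** Needed because the integral formula for a Riesz integrand is lost at one value of y, where the
    integrand may take a default value. *)
Lemma measurable_fun_off_point (D : set RL) (a : R) (f g : RL -> \bar R) :
  measurable D -> measurable_fun D f ->
  (forall x, D x -> x != a -> f x = g x) -> measurable_fun D g.
Proof.
move=> mD mf fg.
have ma : measurable ([set a] : set RL) by exact: measurable_set1.
have mDa : measurable (D `\` [set a]) by exact: measurableD.
apply: (@measurable_funS _ _ _ _ ((D `\` [set a]) `|` [set a])).
- exact: measurableU.
- by move=> x Dx; have [->|/eqP xa] := eqVneq x a; [right|left].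
- apply/measurable_funU => //; split.
    apply: (@eq_measurable_fun _ _ _ _ _ f).
      by move=> x; rewrite inE => -[Dx /eqP xa]; exact: fg.
    exact: measurable_funS mf.
  by apply: (@eq_measurable_fun _ _ _ _ _ (cst (g a))) => // x; rewrite inE => ->.
Qed.

Lemma measurable_pker_riesz (x : R) :
  measurable_fun [set: RL * RL] (fun z => pker_riesz z.2 x z.1).
Proof.
have m1 : measurable_fun [set: RL * RL] (fun z => z.1 : R) by exact: measurable_fst.
have m2 : measurable_fun [set: RL * RL] (fun z => z.2 : R) by exact: measurable_snd.
have mX (f : RL * RL -> R) : measurable_fun setT f ->
    measurable_fun setT (fun z => f z ^+ 2) by exact: measurable_funX.
apply: measurable_funf_div.
  apply: measurable_funM; first exact: measurable_funM.
  by apply: measurable_funB; [apply: measurable_funB => //; exact: mX|exact: mX].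
apply: measurable_funM.
  by apply: measurable_funD => //; exact: mX.
apply: measurable_funM; apply: measurable_funD; do ?exact: mX.
  by apply: mX; exact: measurable_funB.
by apply: mX; exact: measurable_funD.
Qed.

(** [F] is a mixture of the kernels [pker s] with signed weight [h]. The formula is assumed
    everywhere except possibly at u = 0 when x is nonzero, the point where a slice may leave the
    regular points. The integrability [ih] is the one that Fubini asks for after the inner integral
    in y has been bounded by 3 pi / (s^2 + x^2). *)
Variables (h F : R -> R) (x : R).
Hypothesis mh : measurable_fun pos h.
Hypothesis ih : mu.-integrable pos (EFin \o (fun s => h s / (s ^+ 2 + x ^+ 2))).
Hypothesis ihu : forall u, (u != 0) || (u == x) ->
  mu.-integrable pos (EFin \o (fun s => pker s u * h s)).
Hypothesis FE : forall u, (u != 0) || (u == x) ->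
  F u = \int[mu]_(s in pos) (pker s u * h s).

Let hp : RL -> R := h \_ pos.
Let f (z : RL * RL) : \bar R :=
  (pker_riesz z.2 x z.1 * hp z.2 * (\1_pos : RL -> R) z.1)%:E.

Let mpos : measurable pos. Proof. exact: measurable_itv. Qed.

Let mf : measurable_fun setT f.
Proof.
apply/measurable_EFinP; apply: measurable_funM.
  apply: measurable_funM; first exact: measurable_pker_riesz.
  apply: (@measurableT_comp _ _ _ _ _ _ hp) => //.
  by move/(measurable_restrictT _ mpos) : mh.
exact: (@measurableT_comp _ _ _ _ _ _ (\1_pos : RL -> R)).
Qed.

Let hpE s : 0 < s -> hp s = h s.
Proof. by move=> s0; rewrite /hp patchE mem_set//= in_itv/= s0. Qed.

Let hp0 s : ~ (0 < s) -> hp s = 0.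
Proof.
by move=> s0; rewrite /hp patchE memNset//= in_itv/= andbT.
Qed.

Let f_section s : 0 < s -> (fun y => f (y, s)) =
  (fun y => (h s)%:E * ((EFin \o pker_riesz s x) \_ pos) y)%E.
Proof.
move=> s0; apply/funext => y; rewrite /f/= hpE// patchE indicE.
by case: (y \in pos); rewrite ?mulr1 ?mulr0 ?mule0//= mulrC EFinM.
Qed.

Let f_section0 s : ~ (0 < s) -> (fun y => f (y, s)) = cst 0%E.
Proof.
by move=> s0; apply/funext => y; rewrite /f/= hp0// mulr0 mul0r.
Qed.

Let int_f : (mu \x mu)%E.-integrable setT f.
Proof.
apply/integrable21ltyP => //.
apply: (@le_lt_trans _ _ (\int[mu]_(s in pos)
  `|((3 * pi)%:E * (h s / (s ^+ 2 + x ^+ 2))%:E)%E|)%E); last first.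
  by have /integrableP[] := integrableZl mpos (3 * pi) ih.
rewrite [leRHS]integral_mkcond; apply: ge0_le_integral => //.
- by move=> s _; exact: integral_ge0.
- by apply: (measurable_fun_fubini_tonelli_G (abse \o f)) => //=;
    exact: measurableT_comp.
- apply/(measurable_restrictT _ mpos); apply: measurableT_comp => //.
  by have /measurable_int := integrableZl mpos (3 * pi) ih.
move=> s _; have [s0|s0] := pselect (0 < s); last first.
  under eq_integral => y _ do rewrite (congr1 (@^~ y) (f_section0 s0)) /cst abse0.
  by rewrite integral0 erestrict_ge0.
rewrite patchE mem_set; last by rewrite /= in_itv/= s0.
under eq_integral => y _.
  rewrite (_ : `|f (y, s)| = `|h s|%:E *
    ((fun y => `|(pker_riesz s x y)%:E|) \_ pos) y)%E; last first.
    rewrite (congr1 (@^~ y) (f_section s0)) abseM !patchE.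
    by case: ifPn => // _; rewrite abse0.
  over.
rewrite ge0_integralZl//; last 2 first.
- apply/(measurable_restrictT _ mpos); apply: measurableT_comp => //.
  by have /measurable_int := integrable_pker_riesz x s0.
- by move=> y _; rewrite erestrict_ge0.
rewrite -integral_mkcond abseM.
apply: le_trans (lee_wpmul2l _ (integral_pker_riesz_bound x s0)) _ => //.
rewrite /= -!EFinM lee_fin normf_div [`|3 * pi|]gtr0_norm ?mulr_gt0 ?pi_gt0//.
rewrite [X in _ <= _ * (_ / X)]gtr0_norm ?sqrD_gt0//.
by rewrite le_eqVlt; apply/orP; left; apply/eqP; ring.
Qed.

Let g : RL -> \bar R := fubini_F mu f.

Let ig : mu.-integrable setT g. Proof. exact: integrable_fubini_F. Qed.

(** The integrand evaluates [F] at x - y, x and x + y. For y > 0 the first and last vanish only if y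
    = |x|, and at x the formula is always available. *)
Let riesz_integrandE y : 0 < y -> y != `|x| -> (riesz_integrand F x y)%:E = g y.
Proof.
move=> y0 yx.
have u1 : (x - y != 0) || (x - y == x).
  apply/orP; left; apply: contra yx; rewrite subr_eq0 => /eqP ->.
  by rewrite gtr0_norm.
have u2 : (x + y != 0) || (x + y == x).
  apply/orP; left; apply: contra yx; rewrite addr_eq0 => /eqP ->.
  by rewrite normrN gtr0_norm.
have u3 : (x != 0) || (x == x) by rewrite eqxx orbT.
rewrite /riesz_integrand !FE// -RintegralZl//; last exact: ihu.
rewrite -RintegralB//; [|exact: ihu|by apply: integrable_EFinZl => //; exact: ihu].
have i1 : mu.-integrable pos (EFin \o
    (fun s => pker s (x - y) * h s - 2 * (pker s x * h s))).
  apply: integrable_EFinB => //; first exact: ihu.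
  by apply: integrable_EFinZl => //; exact: ihu.
rewrite -RintegralD//; last exact: ihu.
rewrite mulrC -RintegralZl//; last by apply: integrable_EFinD => //; exact: ihu.
rewrite EFin_Rintegral//; last first.
  by apply: integrable_EFinZl => //; apply: integrable_EFinD => //; exact: ihu.
rewrite integral_mkcond /g /fubini_F; apply: eq_integral => s _.
rewrite patchE; case: ifPn => [|/negP]; rewrite inE/= in_itv/= andbT => s0.
  rewrite /f/= hpE// indicE mem_set ?mulr1 /= ?in_itv/= ?y0//.
  rewrite -pker_rieszE ?gt_eqF// /riesz_integrand; congr (_%:E); ring.
by rewrite /f/= hp0// mulr0 mul0r.
Qed.

Lemma riesz_pker_integral : [/\ riesz_ex F x,
  mu.-integrable pos (EFin \o (fun s => pker_ds s x * h s)) &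
  riesz F x = - \int[mu]_(s in pos) (pker_ds s x * h s)].
Proof.
have mN : measurable ([set `|x|] : set RL) by exact: measurable_set1.
have N0 : mu [set `|x|] = 0%E by exact: lebesgue_measure_set1.
have igp : mu.-integrable pos g by exact: integrableS ig.
have mr : measurable_fun pos (EFin \o riesz_integrand F x).
  apply: (measurable_fun_off_point (a := `|x|) (f := g)) => //.
    exact: measurable_int igp.
  by move=> y; rewrite /= in_itv/= andbT => y0 yx; rewrite riesz_integrandE.
have eqg : {in pos `\` [set `|x|], g =1 EFin \o riesz_integrand F x}.
  move=> y; rewrite inE/= in_itv/= andbT => -[y0 /eqP yx].
  by rewrite riesz_integrandE.
have mD : measurable (pos `\` [set `|x|]) by exact: measurableD.
have ir : mu.-integrable pos (EFin \o riesz_integrand F x).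
  apply/(negligible_integrable mN mpos mr N0).
  by apply: (eq_integrable mD _ _ eqg); apply: integrableS igp => //; exact: subDsetl.
have idsh : mu.-integrable pos (EFin \o (fun s => pker_ds s x * h s)).
  apply: le_integrable ih => //.
    apply/measurable_EFinP; apply: measurable_funM => //.
    apply: measurable_funf_div; first by apply: measurable_funB => //; exact: measurable_funX.
    by apply: measurable_funX; apply: measurable_funD => //; exact: measurable_funX.
  move=> s; rewrite /= in_itv/= andbT => s0.
  rewrite lee_fin normrM [leRHS]normrM mulrC ler_wpM2l// normfV
    (gtr0_norm (sqrD_gt0 x s0)).
  exact: pker_ds_bound.
split => //.
rewrite /riesz {1}/Rintegral.
rewrite (negligible_integral mN)// (eq_integral g); last first.
  by move=> y yD; rewrite eqg.
rewrite -(negligible_integral mN)// integral_mkcond.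
have -> : g \_ pos = g.
  apply/funext => y; rewrite patchE; case: ifPn => // /negP yp.
  rewrite /g /fubini_F integral0_eq// => s _.
  by rewrite /f/= indicE memNset ?mulr0// => ?; apply: yp; rewrite inE.
rewrite (Fubini int_f).
have -> : (\int[mu]_y \int[mu]_x f (x, y))%E =
    (\int[mu]_(s in pos) (pi * (pker_ds s x * h s))%:E)%E.
  rewrite [RHS]integral_mkcond; apply: eq_integral => s _; rewrite patchE.
  case: ifPn => [|/negP]; rewrite inE/= in_itv/= andbT => s0.
    under eq_integral => y _ do rewrite (congr1 (@^~ y) (f_section s0)).
    rewrite integralZl//; last first.
      by apply/(integrable_mkcond _ mpos); exact: integrable_pker_riesz.
    rewrite -integral_mkcond integral_pker_riesz// -EFinM; congr EFin; ring.
  under eq_integral => y _ do rewrite (congr1 (@^~ y) (f_section0 s0)).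
  exact: integral0.
(* The factor pi from [integral_pker_riesz] cancels the normalisation 1 / pi of [riesz]. *)
rewrite -/(Rintegral mu pos _) RintegralZl// mulrA mulNr mulVf ?mulN1r//.
by rewrite gt_eqF// pi_gt0.
Qed.

End riesz_under_integral.

(** * The product of kernels at a regular point and its admissible multipliers *)

Section regular_weight.
Context {R : realType}.
Notation mu := (@lebesgue_measure R).
Notation RL := (measurableTypeR R).
Notation pos := (`]0%R, +oo[%classic : set (measurableTypeR R)).
Implicit Types s t u : R.

Lemma pker_le_inv s u : 0 < s -> pker s u <= s^-1.
Proof.
move=> s0; rewrite /pker ler_pdivrMr ?sqrD_gt0// mulrDr expr2 mulrA mulVf ?gt_eqF//.
by rewrite mul1r lerDl mulr_ge0 ?sqr_ge0// invr_ge0 ltW.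
Qed.

Lemma pker_le_nz s u : 0 < s -> u != 0 -> pker s u <= (u ^+ 2)^-1 * s.
Proof.
move=> s0 u0; rewrite /pker mulrC ler_pM2r// lef_pV2 ?posrE ?sqrD_gt0//.
  by rewrite lerDr sqr_ge0.
by rewrite lt_def sqr_ge0 sqrf_eq0 u0.
Qed.

Lemma prod_pker_gt0 (I : Type) (r : seq I) (P : pred I) (x : I -> R) s : 0 < s ->
  0 < \prod_(i <- r | P i) pker s (x i).
Proof. by move=> s0; apply: prodr_gt0 => i _; exact: pker_gt0. Qed.

Lemma prod_pker_le1 (r : seq R) s : 1 <= s -> \prod_(u <- r) pker s u <= 1.
Proof.
move=> s1; have s0 : 0 < s by exact: lt_le_trans s1.
elim: r => [|u r IH]; first by rewrite big_nil.
rewrite big_cons mulr_ile1// ?(ltW (pker_gt0 _ s0))//.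
  by apply: prodr_ge0 => i _; rewrite ltW// pker_gt0.
by rewrite (le_trans (pker_le_inv _ s0))// invf_le1.
Qed.

(* Near [s = 0] a vanishing coordinate contributes [s^-1] and any other one [O(s)]. *)
Lemma prod_pker_zeros (r : seq R) : exists2 C, 0 < C & forall s, 0 < s ->
  (\prod_(u <- r) pker s u) * s ^+ (2 * count_mem 0 r) <= C * s ^+ size r.
Proof.
elim: r => [|u r [C C0 IH]].
  by exists 1 => // s s0; rewrite big_nil muln0 expr0 mulr1.
have [->|u0] := eqVneq u 0.
  exists C => // s s0; rewrite big_cons /= eqxx add1n mulnS exprD (exprS _ (size r)).
  have -> : pker s 0 = s^-1 by rewrite /pker; field; rewrite gt_eqF.
  rewrite (_ : _ * _ = s * ((\prod_(j <- r) pker s j) *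
    s ^+ (2 * count_mem 0 r))); last by field; rewrite gt_eqF.
  by rewrite [leRHS]mulrCA ler_pM2l// IH.
exists ((u ^+ 2)^-1 * C) => [|s s0].
  by rewrite mulr_gt0// invr_gt0 lt_def sqr_ge0 sqrf_eq0 u0.
rewrite big_cons /= (negbTE u0) add0n (exprS _ (size r)) -mulrA.
rewrite (_ : _ * C * _ = ((u ^+ 2)^-1 * s) * (C * s ^+ size r)); last by ring.
apply: ler_pM.
- by rewrite ltW// pker_gt0.
- by rewrite mulr_ge0// ?exprn_ge0 ?ltW// prod_pker_gt0.
- exact: pker_le_nz.
- exact: IH.
Qed.

Variable d : nat.
Implicit Types x : d.-tuple R.

Definition weight x s := \prod_(j < d) pker s (tnth x j).

Lemma weight_gt0 x s : 0 < s -> 0 < weight x s.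
Proof. exact: prod_pker_gt0. Qed.

(** For s < 1 the exponent d - 2m of [prod_pker_zeros] is at least 2 at a regular point; for s >= 1
    every factor is at most 1 / s <= 1. *)
Lemma weight_bound x : regular_point x -> exists2 K, 0 < K & forall s, 0 < s ->
  weight x s <= K * s ^+ 2 /\ weight x s <= K.
Proof.
move=> regx; have [C C0 CW] := prod_pker_zeros x.
have wE s : weight x s = \prod_(u <- x) pker s u by rewrite big_tuple.
exists (C + 1) => [|s s0]; first by rewrite addr_gt0.
have s20 : 0 <= s ^+ 2 by exact: sqr_ge0.
rewrite wE; have [s1|s1] := leP 1 s.
  have w1 := prod_pker_le1 x s1.
  have s21 : 1 <= s ^+ 2 by rewrite exprn_ege1.
  by split; nra.
have w2 : \prod_(u <- x) pker s u <= C * s ^+ 2.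
  rewrite -(@ler_pM2r _ (s ^+ (2 * count_mem 0 x))) ?exprn_gt0//.
  apply: le_trans (CW _ s0) _; rewrite -mulrA -exprD ler_pM2l//.
  rewrite size_tuple ler_wiXn2l// ?(ltW s0) ?(ltW s1)//.
  by rewrite addnC.
have s21 : s ^+ 2 <= 1 by rewrite exprn_ile1// ltW.
by split; nra.
Qed.

Lemma measurable_pker_s (D : set RL) u : measurable_fun D (pker ^~ u).
Proof.
apply: measurable_funf_div => //.
by apply: measurable_funD => //; exact: measurable_funX.
Qed.

Lemma measurable_pker_x (D : set RL) s : measurable_fun D (pker s).
Proof.
apply: measurable_funf_div => //.
by apply: measurable_funD => //; exact: measurable_funX.
Qed.

Lemma measurable_prod_pker (D : set RL) (P : pred 'I_d) x :
  measurable_fun D (fun s => \prod_(j < d | P j) pker s (tnth x j)).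
Proof.
under eq_fun do rewrite big_mkcond.
apply: measurable_prod => j _.
by case: (P j) => //; exact: measurable_pker_s.
Qed.

Lemma integrable_pker t : 0 < t -> mu.-integrable pos (EFin \o pker t).
Proof.
move=> t0; apply: le_integrable (integrable_pker_pair 0 t0) => //.
  by apply/measurable_EFinP; exact: measurable_pker_x.
move=> s _; rewrite lee_fin subr0 addr0 !ger0_norm ?addr_ge0 ?(ltW (pker_gt0 _ t0))//.
by rewrite lerDl ltW// pker_gt0.
Qed.

(* The multipliers [phi] of [weight x] under which the integral against [pker t]
   still converges at regular points. *)
Definition admissible (phi : R -> R) := measurable_fun pos phi /\
  exists2 M, 0 <= M & forall s, 0 < s -> `|phi s| <= M * (1 + (s ^+ 2)^-1).

Lemma admissible_cst k : admissible (fun=> k).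
Proof.
split=> //; exists `|k| => // s s0; rewrite ler_peMr// lerDl.
by rewrite invr_ge0 sqr_ge0.
Qed.

Lemma admissibleD phi psi : admissible phi -> admissible psi ->
  admissible (fun s => phi s + psi s).
Proof.
move=> [m1 [M1 M10 h1]] [m2 [M2 M20 h2]]; split; first exact: measurable_funD.
exists (M1 + M2) => [|s s0]; first exact: addr_ge0.
by rewrite mulrDl (le_trans (ler_normD _ _))// lerD// ?h1// h2.
Qed.

Lemma admissibleZ k phi : admissible phi -> admissible (fun s => k * phi s).
Proof.
move=> [m1 [M1 M10 h1]]; split; first exact: measurable_funM.
exists (`|k| * M1) => [|s s0]; first exact: mulr_ge0.
by rewrite normrM -mulrA ler_wpM2l// h1.
Qed.

Lemma admissible_sum (I : Type) (r : seq I) (P : pred I) (phi : I -> R -> R) :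
  (forall i, admissible (phi i)) ->
  admissible (fun s => \sum_(i <- r | P i) phi i s).
Proof.
move=> h; elim: r => [|i r IH].
  under eq_fun do rewrite big_nil; exact: admissible_cst.
under eq_fun do rewrite big_cons.
by case: (P i) => //; exact: admissibleD.
Qed.

(** The two bounds of [weight_bound] absorb the two terms of 1 + s^-2, leaving a multiple of the
    integrable [pker t]. *)
Lemma integrable_weight x phi t : regular_point x -> admissible phi -> 0 < t ->
  mu.-integrable pos (EFin \o (fun s => weight x s * phi s * pker t s)).
Proof.
move=> regx [mphi [M M0 hM]] t0.
have [K K0 hK] := weight_bound regx.
apply: (@integrable_EFin_le _ RL R mu pos _ _ (fun s => (2 * (K * M)) * pker t s)) => //.
- apply: measurable_funM; last exact: measurable_pker_x.
  by apply: measurable_funM => //; exact: measurable_prod_pker.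
- move=> s; rewrite /= in_itv/= andbT => s0.
  rewrite normrM [`|pker t s|]ger0_norm; last by rewrite ltW// pker_gt0.
  rewrite ler_pM2r ?pker_gt0// normrM gtr0_norm ?weight_gt0//.
  have [w1 w2] := hK _ s0.
  apply: (le_trans (ler_wpM2l (ltW (weight_gt0 x s0)) (hM _ s0))).
  rewrite [leLHS](_ : _ = M * (weight x s + weight x s / s ^+ 2)); last by ring.
  rewrite [leRHS](_ : _ = M * (K + K)); last by ring.
  rewrite ler_wpM2l// lerD// ler_pdivrMr ?exprn_gt0//.
- by apply: integrable_EFinZl => //; exact: integrable_pker.
Qed.

End regular_weight.

(** * Differentiating twice under the integral sign *)

Section twice_under_integral.
Context {R : realType}.
Notation mu := (@lebesgue_measure R).
Notation RL := (measurableTypeR R).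
Notation pos := (`]0%R, +oo[%classic : set (measurableTypeR R)).

Lemma derive_under_pos (k k1 : R -> RL -> R) (G : RL -> R) (a b u : R) :
  a < u -> u < b ->
  (forall v s, a < v < b -> 0 < s -> is_derive v 1 (k ^~ s) (k1 v s)) ->
  (forall v, a < v < b -> mu.-integrable pos (EFin \o k v)) ->
  (forall v s, a < v < b -> 0 < s -> `|k1 v s| <= G s) ->
  mu.-integrable pos (EFin \o G) ->
  is_derive u 1 (fun v => \int[mu]_(s in pos) k v s)
    (\int[mu]_(s in pos) k1 u s).
Proof.
move=> au ub dk ik k1G iG.
have posP s : pos s -> 0 < s by rewrite /= in_itv/= andbT.
have mpos : measurable pos by exact: measurable_itv.
have Iu : `]a, b[%classic u by rewrite /= in_itv/= au ub.
have intf v : `]a, b[%classic v -> mu.-integrable pos (EFin \o k v).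
  by rewrite /= in_itv/=; exact: ik.
have der v s : `]a, b[%classic v -> pos s -> derivable (k ^~ s) v 1.
  by rewrite /= in_itv/= => vab /posP s0; case: (dk v s vab s0).
have k1E v s : a < v < b -> 0 < s -> partial1of2 k v s = k1 v s.
  by move=> vab s0; rewrite partial1of2E; case: (dk v s vab s0).
have Gb v s : `]a, b[%classic v -> pos s -> `|partial1of2 k v s| <= `|G s|.
  rewrite /= in_itv/= => vab /posP s0; rewrite k1E//.
  by rewrite (le_trans (k1G _ _ vab s0))// ler_norm.
have G0 s : 0 <= `|G s| by [].
have iG' : mu.-integrable pos (EFin \o (fun s => `|G s|)).
  by have := integrable_abse iG.
apply: DeriveDef.
  exact: (derivable_under_integral mpos Iu intf der G0 iG' Gb).
rewrite -derive1E (differentiation_under_integral mpos Iu intf der G0 iG' Gb).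
apply: eq_Rintegral => s; rewrite inE => /posP s0.
by rewrite k1E// au ub.
Qed.

Lemma twice_derivable_under_pos (k k1 k2 : R -> RL -> R) (G1 G2 : RL -> R)
    (a b u : R) : a < u < b ->
  (forall v s, a < v < b -> 0 < s -> is_derive v 1 (k ^~ s) (k1 v s)) ->
  (forall v s, a < v < b -> 0 < s -> is_derive v 1 (k1 ^~ s) (k2 v s)) ->
  (forall v, a < v < b -> mu.-integrable pos (EFin \o k v)) ->
  (forall v, a < v < b -> measurable_fun pos (k1 v)) ->
  (forall v s, a < v < b -> 0 < s -> `|k1 v s| <= G1 s) ->
  (forall v s, a < v < b -> 0 < s -> `|k2 v s| <= G2 s) ->
  mu.-integrable pos (EFin \o G1) -> mu.-integrable pos (EFin \o G2) ->
  let F v := \int[mu]_(s in pos) k v s in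
  twice_derivable F u /\ (F^`(2))%classic u = \int[mu]_(s in pos) k2 u s.
Proof.
move=> /andP[au ub] d1 d2 ik mk1 b1 b2 iG1 iG2 F.
have posP s : pos s -> 0 < s by rewrite /= in_itv/= andbT.
have ik1 v : a < v < b -> mu.-integrable pos (EFin \o k1 v).
  move=> vab; apply: (@integrable_EFin_le _ RL R mu pos _ _ G1) => //.
    exact: mk1.
  by move=> s /posP s0; exact: b1.
have dF v : a < v < b -> is_derive v 1 F (\int[mu]_(s in pos) k1 v s).
  by move=> /andP[av vb]; apply: (derive_under_pos av vb d1 ik b1 iG1).
have dF1 := derive_under_pos au ub d2 ik1 b2 iG2.
have nearI : \forall v \near u, a < v < b.
  have : u \in `]a, b[ by rewrite in_itv/= au ub.
  move=> /near_in_itvoo; apply: filterS => v.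
  by rewrite in_itv.
have nF : \forall v \near u, (\int[mu]_(s in pos) k1 v s) = (F^`())%classic v.
  near=> v; rewrite derive1E; have vab : a < v < b by near: v.
  by case: (dF v vab).
have d2F := near_eq_is_derive nF dF1.
split; last first.
  by rewrite [LHS](_ : _ = ((F^`())%classic^`())%classic u)// derive1E; case: d2F.
split; last by case: d2F.
by near=> v; have [] : is_derive v 1 F (\int[mu]_(s in pos) k1 v s);
  [apply: dF; near: v|].
Unshelve. all: by end_near. Qed.

Lemma twice_derivableZ (c u : R) (F : R -> R) : twice_derivable F u ->
  twice_derivable (fun v => c * F v) u /\
  ((fun v => c * F v)^`(2))%classic u = c * (F^`(2))%classic u.
Proof.
move=> [dF ddF].
have nF : \forall v \near u,
    c * (F^`())%classic v = ((fun v => c * F v)^`())%classic v.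
  near=> v; rewrite !derive1E.
  have /derivableP dFv : derivable F v 1 by near: v.
  have := is_derive_mul (is_derive_cst c v 1) dFv.
  by rewrite mul0r add0r => -[_ ->].
have d2 : is_derive u 1 (fun v => c * (F^`())%classic v) (c * (F^`(2))%classic u).
  have /derivableP dFu := ddF.
  apply: (is_derive_ext (is_derive_mul (is_derive_cst c u 1) dFu)) => //.
  by rewrite mul0r add0r /= derive1E.
have d2F := near_eq_is_derive nF d2.
split; last by rewrite /= derive1E; case: d2F.
split; last by case: d2F.
near=> v; have /derivableP dFv : derivable F v 1 by near: v.
by have [] := is_derive_mul (is_derive_cst c v 1) dFv.
Unshelve. all: by end_near. Qed.

End twice_under_integral.

(** * Slices of the density and its first Riesz derivatives *)

Section slices.
Context {R : realType}.
Notation mu := (@lebesgue_measure R).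
Notation RL := (measurableTypeR R).
Notation pos := (`]0%R, +oo[%classic : set (measurableTypeR R)).

Lemma pos_gt0 (s : R) : pos s -> 0 < s.
Proof. by rewrite /= in_itv/= andbT. Qed.

(** Compares the kernel at u with the one at the base point v uniformly in s, which fails only for u
    = 0 and v nonzero. For u = v = 0 the quotient v^2 / u^2 is 0 by convention and the constant is
    1. *)
Lemma pker_ratio_bound (s u v : R) : 0 < s -> (u != 0) || (u == v) ->
  pker s u <= (1 + v ^+ 2 / u ^+ 2) * pker s v.
Proof.
move=> s0 uv; have A := sqrD_gt0 u s0; have B := sqrD_gt0 v s0.
rewrite /pker mulrA ler_pdivrMr// mulrAC ler_pdivlMr// mulrAC [leRHS]mulrC.
rewrite ler_pM2l//; have [u0|u0] := eqVneq u 0.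
  move: uv; rewrite u0 eqxx/= => /eqP <-.
  by rewrite expr0n/= mul0r !addr0 mul1r.
rewrite [leRHS](_ : _ = s ^+ 2 + u ^+ 2 + v ^+ 2 + s ^+ 2 * (v / u) ^+ 2); last first.
  by field.
have := sqr_ge0 u; have : 0 <= s ^+ 2 * (v / u) ^+ 2 by rewrite mulr_ge0 ?sqr_ge0.
lra.
Qed.

Variable d : nat.
Implicit Types x : d.-tuple R.

Definition weight_off (k : 'I_d) x s := \prod_(i < d | i != k) pker s (tnth x i).

Definition weight_off2 (k j : 'I_d) x s :=
  \prod_(i < d | (i != j) && (i != k)) pker s (tnth x i).

Lemma weightE k x s : weight x s = pker s (tnth x k) * weight_off k x s.
Proof. by rewrite /weight (bigD1 k). Qed.

Lemma weight_off2E k j x s : j != k ->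
  weight_off j x s = pker s (tnth x k) * weight_off2 k j x s.
Proof. by move=> jk; rewrite /weight_off (bigD1 k) 1?eq_sym. Qed.

Lemma tnth_upd x k u i : tnth (upd x k u) i = if i == k then u else tnth x i.
Proof. by rewrite tnth_mktuple. Qed.

Lemma weight_off_upd k x u s : weight_off k (upd x k u) s = weight_off k x s.
Proof. by apply: eq_bigr => i /negbTE ik; rewrite tnth_upd ik. Qed.

Lemma weight_off2_upd k j x u s :
  weight_off2 k j (upd x k u) s = weight_off2 k j x s.
Proof. by apply: eq_bigr => i /andP[_ /negbTE ik]; rewrite tnth_upd ik. Qed.

Lemma count_mem0E x : count_mem 0%R x = (\sum_(i < d) (tnth x i == 0%R))%N.
Proof.
rewrite -sum1_count big_tuple big_mkcond; apply: eq_bigr => i _.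
by rewrite /=; case: (tnth x i == 0%R). Qed.

(** Regularity can be lost only by creating a zero; here a zero value of u was already the k-th
    coordinate. *)
Lemma regular_upd x k u : regular_point x -> (u != 0) || (u == tnth x k) ->
  regular_point (upd x k u).
Proof.
move=> regx uk; apply: leq_trans regx; rewrite leq_add2r leq_mul2l.
apply/orP; right; rewrite !count_mem0E; apply: leq_sum => i _; rewrite tnth_upd.
case: (i =P k) => [->|//]; case: (u =P 0) uk => //= -> /eqP <-.
by rewrite eqxx.
Qed.

Definition p_CC_cst : R := 2 / pi ^+ d.+1.

Lemma p_CCE x t : p_CC x t = p_CC_cst * \int[mu]_(s in pos) (weight x s * pker t s).
Proof. by []. Qed.

Lemma slice_p_CC k x t u : slice (@p_CC R d ^~ t) x k u =
  p_CC_cst * \int[mu]_(s in pos) (pker s u * (weight_off k x s * pker t s)).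
Proof.
rewrite /slice p_CCE; congr (_ * _); apply: eq_Rintegral => s _.
by rewrite (weightE k) weight_off_upd tnth_upd eqxx mulrA.
Qed.

Lemma admissible_inv : @admissible R (fun s => s^-1).
Proof.
split; first exact: measurable_inv.
exists 1 => // s s0; rewrite mul1r gtr0_norm ?invr_gt0//.
rewrite -exprVn; have : 0 < s^-1 by rewrite invr_gt0.
by nra.
Qed.

Lemma measurable_weight_off k x (D : set RL) : measurable_fun D (weight_off k x).
Proof. exact: measurable_prod_pker. Qed.

Lemma measurable_weight_off2 k j x (D : set RL) :
  measurable_fun D (weight_off2 k j x).
Proof. exact: measurable_prod_pker. Qed.

Section at_regular_point.
Variables (x : d.-tuple R) (t : R).
Hypotheses (regx : regular_point x) (t0 : 0 < t).

Let mpos : measurable pos. Proof. exact: measurable_itv. Qed.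

Lemma integrable_weight_le (f phi : R -> R) : measurable_fun pos f ->
  admissible phi -> (forall s, 0 < s -> `|f s| <= weight x s * phi s * pker t s) ->
  mu.-integrable pos (EFin \o f).
Proof.
move=> mf ap le_f; apply: (@integrable_EFin_le _ RL R mu pos _ _
  (fun s : RL => weight x s * phi s * pker t s)) => //.
- by move=> s /pos_gt0; exact: le_f.
- exact: integrable_weight.
Qed.

Lemma integrable_slice k u : (u != 0) || (u == tnth x k) ->
  mu.-integrable pos
    (EFin \o (fun s => pker s u * (weight_off k x s * pker t s))).
Proof.
move=> uk; pose M := 1 + tnth x k ^+ 2 / u ^+ 2.
apply: (@integrable_weight_le _ (fun=> M)).
- apply: measurable_funM; first exact: measurable_pker_s.
  apply: measurable_funM; first exact: measurable_weight_off.
  exact: measurable_pker_x.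
- exact: admissible_cst.
- move=> s s0; rewrite (weightE k).
  have w0 : 0 < weight_off k x s by exact: prod_pker_gt0.
  have t1 := pker_gt0 s t0; have u1 := pker_gt0 u s0.
  rewrite gtr0_norm; last by rewrite mulr_gt0// mulr_gt0.
  rewrite mulrA ler_pM2r// [leRHS]mulrAC ler_pM2r// [leRHS]mulrC.
  exact: pker_ratio_bound.
Qed.

Lemma priesz_p_CC j : [/\ priesz_ex j (@p_CC R d ^~ t) x,
  mu.-integrable pos (EFin \o (fun s =>
    pker_ds s (tnth x j) * (p_CC_cst * (weight_off j x s * pker t s)))) &
  priesz j (@p_CC R d ^~ t) x =
  - \int[mu]_(s in pos)
      (pker_ds s (tnth x j) * (p_CC_cst * (weight_off j x s * pker t s)))].
Proof.
have mh : measurable_fun pos (fun s => p_CC_cst * (weight_off j x s * pker t s)).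
  apply: measurable_funM => //; apply: measurable_funM.
    exact: measurable_weight_off.
  exact: measurable_pker_x.
apply: riesz_pker_integral => //.
(* Since 1 / (s^2 + x_j^2) is the kernel in x_j divided by s, the missing factor of [weight x] is
   restored at the price of s^-1. *)
- apply: (@integrable_weight_le _ (fun s => `|p_CC_cst| * s^-1)).
  + apply: measurable_funf_div => //.
    by apply: measurable_funD => //; exact: measurable_funX.
  + by apply: admissibleZ; exact: admissible_inv.
  + move=> s s0; have w0 : 0 < weight_off j x s by exact: prod_pker_gt0.
    rewrite normf_div normrM (ger0_norm (ltW (sqrD_gt0 _ s0))).
    have t1 := pker_gt0 s t0.
    rewrite [`|weight_off _ _ _ * _|]gtr0_norm; last by rewrite mulr_gt0.
    rewrite (weightE j) {2}/pker le_eqVlt; apply/orP; left; apply/eqP.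
    have A0 := lt0r_neq0 (sqrD_gt0 (tnth x j) s0).
    by field; rewrite A0 gt_eqF.
- move=> u uk; rewrite [X in mu.-integrable _ X](_ : _ = EFin \o (fun s =>
    p_CC_cst * (pker s u * (weight_off j x s * pker t s)))); last first.
    by apply/funext => s /=; congr EFin; ring.
  by apply: integrable_EFinZl => //; exact: integrable_slice.
- move=> u uk; rewrite slice_p_CC -RintegralZl//; last exact: integrable_slice.
  by apply: eq_Rintegral => s _; ring.
Qed.

End at_regular_point.
End slices.

(** * Multipliers of the derivatives and the mixed Riesz derivatives *)

Section derivatives.
Context {R : realType}.
Notation mu := (@lebesgue_measure R).
Notation RL := (measurableTypeR R).
Notation pos := (`]0%R, +oo[%classic : set (measurableTypeR R)).

Lemma admissible_mul_inv (f g : R -> R) : measurable_fun pos f ->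
  measurable_fun pos g -> (forall s, 0 < s -> `|f s| <= s^-1) ->
  (forall s, 0 < s -> `|g s| <= s^-1) -> admissible (fun s => f s * g s).
Proof.
move=> mf mg hf hg; split; first exact: measurable_funM.
exists 1 => // s s0; rewrite mul1r normrM -exprVn.
apply: (@le_trans _ _ (s^-1 * s^-1)); first by rewrite ler_pM ?hf ?hg.
by rewrite -expr2 lerDr.
Qed.

Lemma admissible_le_inv (f : R -> R) : measurable_fun pos f ->
  (forall s, 0 < s -> `|f s| <= s^-1) -> admissible f.
Proof.
move=> mf hf; split => //; have [_ [M M0 hM]] := @admissible_inv R.
exists M => // s s0; rewrite (le_trans (hf _ s0))//.
by rewrite (le_trans _ (hM _ s0))// ler_norm.
Qed.

Lemma measurable_sqrD (D : set RL) (u : R) : measurable_fun D (fun s => s ^+ 2 + u ^+ 2).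
Proof. by apply: measurable_funD => //; exact: measurable_funX. Qed.

Lemma measurable_pker_ld (D : set RL) (u : R) : measurable_fun D (pker_ld ^~ u).
Proof.
apply: measurable_funf_div.
  by apply: measurable_funB => //; exact: measurable_funX.
by apply: measurable_funM => //; exact: measurable_sqrD.
Qed.

Lemma measurable_pker_ds (D : set RL) (u : R) : measurable_fun D (pker_ds ^~ u).
Proof.
apply: measurable_funf_div.
  by apply: measurable_funB => //; exact: measurable_funX.
by apply: measurable_funX; exact: measurable_sqrD.
Qed.

(** The ratio of the second x-derivative of the kernel to the kernel. Its size 6 / s^2 is the
    largest order that [admissible] tolerates. *)
Definition pker_ldx (s u : R) := (6 * u ^+ 2 - 2 * s ^+ 2) / (s ^+ 2 + u ^+ 2) ^+ 2.

Lemma pker_dxxE (s u : R) : 0 < s -> pker_dxx s u = pker s u * pker_ldx s u.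
Proof.
move=> s0; have A0 := lt0r_neq0 (sqrD_gt0 u s0).
by rewrite /pker_dxx /pker_ldx /pker; field.
Qed.

Lemma pker_ldx_bound (s u : R) : 0 < s -> `|pker_ldx s u| <= 6 / s ^+ 2.
Proof.
move=> s0; have A0 := sqrD_gt0 u s0.
rewrite /pker_ldx normf_div (gtr0_norm (exprn_gt0 2 A0)).
have s2 : 0 < s ^+ 2 by rewrite exprn_gt0.
rewrite ler_pdivrMr ?exprn_gt0// mulrAC ler_pdivlMr//.
have := sqr_ge0 u => u2.
have : `|6 * u ^+ 2 - 2 * s ^+ 2| <= 6 * (s ^+ 2 + u ^+ 2).
  by rewrite ler_norml; apply/andP; split; lra.
move=> h; apply: (@le_trans _ _ (6 * (s ^+ 2 + u ^+ 2) * s ^+ 2)).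
  by rewrite ler_pM2r.
by rewrite -mulrA ler_pM2l// expr2 ler_pM2l// lerDl.
Qed.

Lemma admissible_pker_ldx (u : R) : @admissible R (pker_ldx ^~ u).
Proof.
split.
  apply: measurable_funf_div.
    by apply: measurable_funB => //; apply: measurable_funM => //; exact: measurable_funX.
  by apply: measurable_funX; exact: measurable_sqrD.
exists 6 => // s s0; apply: le_trans (pker_ldx_bound u s0) _.
by rewrite ler_pM2l// lerDr.
Qed.

Lemma admissible_pker_ld2 (u v : R) :
  @admissible R (fun s => pker_ld s u * pker_ld s v).
Proof.
by apply: admissible_mul_inv; do ?exact: measurable_pker_ld;
  move=> s s0; exact: pker_ld_bound.
Qed.

Variable d : nat.
Variables (x : d.-tuple R) (t : R).
Hypotheses (regx : regular_point x) (t0 : 0 < t).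

Let mpos : measurable pos. Proof. exact: measurable_itv. Qed.

Definition wint (phi : R -> R) := \int[mu]_(s in pos) (weight x s * phi s * pker t s).

(** As j and k differ, the inner Riesz derivative is again a mixture of kernels in the k-th
    variable, with signed weight [h2], so [riesz_pker_integral] applies a second time. The two minus
    signs cancel. *)
Lemma mixed_priesz_p_CC (k j : 'I_d) : (j < k)%N -> mixed_priesz_ex k j (@p_CC R d ^~ t) x /\
  priesz k (priesz j (@p_CC R d ^~ t)) x =
  p_CC_cst d * wint (fun s => pker_ld s (tnth x j) * pker_ld s (tnth x k)).
Proof.
move=> jk; have jk' : j != k by rewrite neq_ltn jk.
pose h2 s := - (pker_ds s (tnth x j) *
  (p_CC_cst d * (weight_off2 k j x s * pker t s))).
have h2E u : (u != 0) || (u == tnth x k) ->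
    priesz j (@p_CC R d ^~ t) (upd x k u) =
    \int[mu]_(s in pos) (pker s u * h2 s).
  move=> uk; have [_ ids ->] := priesz_p_CC (regular_upd regx uk) t0 j.
  rewrite tnth_upd (negbTE jk') in ids *; rewrite -mulN1r -RintegralZl//.
  apply: eq_Rintegral => s _.
  rewrite (weight_off2E _ _ jk') weight_off2_upd tnth_upd eqxx /h2; ring.
have mh : measurable_fun pos h2.
  apply: measurableT_comp => //; apply: measurable_funM; first exact: measurable_pker_ds.
  apply: measurable_funM => //; apply: measurable_funM.
    exact: measurable_weight_off2.
  exact: measurable_pker_x.
have wk s : 0 < s -> weight x s = pker s (tnth x j) *
    (pker s (tnth x k) * weight_off2 k j x s).
  by move=> s0; rewrite (weightE j) (weight_off2E _ _ jk').
have wo s : 0 < s -> 0 < weight_off2 k j x s by exact: prod_pker_gt0.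
have w2 s : 0 < s -> `|h2 s| = `|p_CC_cst d| * (pker s (tnth x j) *
    `|pker_ld s (tnth x j)| * (weight_off2 k j x s * pker t s)).
  move=> s0; have t1 := pker_gt0 s t0; have o1 := wo _ s0.
  rewrite /h2 normrN pker_dsE// (normrM (pker _ _ * _)) (normrM (pker s _))
    (normrM (p_CC_cst d)) (normrM (weight_off2 _ _ _ _)) (gtr0_norm t1) (gtr0_norm o1).
  rewrite (gtr0_norm (pker_gt0 _ s0)); ring.
have ih : mu.-integrable pos (EFin \o (fun s => h2 s / (s ^+ 2 + tnth x k ^+ 2))).
  apply: (@integrable_weight_le _ _ _ _ regx t0 _
    (fun s => `|p_CC_cst d| * (`|pker_ld s (tnth x j)| * s^-1))).
  - by apply: measurable_funf_div => //; exact: measurable_sqrD.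
  - apply: admissibleZ; apply: admissible_mul_inv.
    + by apply: measurableT_comp => //; exact: measurable_pker_ld.
    + exact: measurable_inv.
    + by move=> s s0; rewrite normr_id; exact: pker_ld_bound.
    + by move=> s s0; rewrite gtr0_norm// invr_gt0.
  - move=> s s0; have A0 := sqrD_gt0 (tnth x k) s0.
    rewrite normf_div w2// (gtr0_norm A0) wk// {4}/pker le_eqVlt.
    apply/orP; left; apply/eqP.
    by field; rewrite !gt_eqF.
have ihu u : (u != 0) || (u == tnth x k) ->
    mu.-integrable pos (EFin \o (fun s => pker s u * h2 s)).
  move=> uk; pose M := 1 + tnth x k ^+ 2 / u ^+ 2.
  apply: (@integrable_weight_le _ _ _ _ regx t0 _
    (fun s => (`|p_CC_cst d| * M) * `|pker_ld s (tnth x j)|)).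
  - by apply: measurable_funM => //; exact: measurable_pker_s.
  - apply: admissibleZ; apply: admissible_le_inv.
      by apply: measurableT_comp => //; exact: measurable_pker_ld.
    by move=> s s0; rewrite normr_id; exact: pker_ld_bound.
  - move=> s s0; rewrite normrM w2// wk// (gtr0_norm (pker_gt0 _ s0)).
    rewrite [leRHS](_ : _ = M * pker s (tnth x k) * (`|p_CC_cst d| *
      (pker s (tnth x j) * `|pker_ld s (tnth x j)| *
      (weight_off2 k j x s * pker t s)))); last by ring.
    rewrite ler_wpM2r//; last exact: pker_ratio_bound.
    apply: mulr_ge0 => //; apply: mulr_ge0; [apply: mulr_ge0 => //|apply: mulr_ge0];
      apply: ltW; [exact: pker_gt0|exact: wo|exact: pker_gt0].
have [rex ids rE] := riesz_pker_integral mh ih ihu h2E.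
split; first split => //.
- by have [] := priesz_p_CC regx t0 j.
(* The inner integral can fail only where the updated point is not regular, which forces u = 0. *)
- exists [set 0]; split; [exact: measurable_set1|exact: lebesgue_measure_set1|].
  move=> u /= nu; apply: contrapT => /eqP u0; apply: nu.
  have uk : (u != 0) || (u == tnth x k) by rewrite u0.
  by have [] := priesz_p_CC (regular_upd regx uk) t0 j.
rewrite [LHS]rE /wint -[LHS]mulN1r -[LHS]RintegralZl// -[RHS]RintegralZl//; last first.
  by apply: integrable_weight => //; exact: admissible_pker_ld2.
apply: eq_Rintegral => s; rewrite inE => /pos_gt0 s0.
rewrite wk// /h2 !pker_dsE//; ring.
Qed.

End derivatives.

(** * Second derivatives in space and in time *)

Section second_derivatives.
Context {R : realType}.
Notation mu := (@lebesgue_measure R).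
Notation RL := (measurableTypeR R).
Notation pos := (`]0%R, +oo[%classic : set (measurableTypeR R)).

Lemma admissible_inv2 : @admissible R (fun s => (s ^+ 2)^-1).
Proof.
split; first by apply: measurable_funV; exact: measurable_funX.
exists 1 => // s s0; rewrite mul1r ger0_norm ?invr_ge0 ?sqr_ge0//.
by rewrite lerDr.
Qed.

Variable d : nat.
Variables (x : d.-tuple R) (t : R).
Hypotheses (regx : regular_point x) (t0 : 0 < t).

Let mpos : measurable pos. Proof. exact: measurable_itv. Qed.

Lemma pderive2_p_CC k : pderive2_ex k (@p_CC R d ^~ t) x /\
  pderive2 k (@p_CC R d ^~ t) x =
  p_CC_cst d * wint x t (pker_ldx ^~ (tnth x k)).
Proof.
set v := tnth x k.
pose h s := weight_off k x s * pker t s.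
have mh : measurable_fun pos h.
  by apply: measurable_funM; [exact: measurable_weight_off|exact: measurable_pker_x].
have h0 s : 0 < s -> 0 < h s.
  by move=> s0; rewrite mulr_gt0 ?pker_gt0//; exact: prod_pker_gt0.
have hE s : pker s v * h s = weight x s * pker t s.
  by rewrite (weightE k) mulrA.
have sliceE : slice (@p_CC R d ^~ t) x k =
    (fun u => p_CC_cst d * \int[mu]_(s in pos) (pker s u * h s)).
  by apply/funext => u; rewrite slice_p_CC.
(* On the interval of radius [e] around v one has |v| <= 2 |u|: it avoids 0 when v is nonzero, and
   any radius serves when v = 0. This makes the kernels at u and v comparable with constant 4. *)
pose e := if v == 0 then 1 else `|v| / 2.
have e0 : 0 < e.
  by rewrite /e; case: eqVneq => // v0; rewrite divr_gt0// normr_gt0.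
have Ie u : v - e < u < v + e -> v ^+ 2 <= 4 * u ^+ 2.
  rewrite /e; case: eqVneq => [-> _|v0 /andP[u1 u2]].
    by rewrite expr0n/= mulr_ge0// sqr_ge0.
  have [v1|v1] := leP 0 v.
    by rewrite ger0_norm// in u1; nra.
  by rewrite ltr0_norm// in u2; nra.
have Inz u : v - e < u < v + e -> (u != 0) || (u == v).
  move=> /Ie; case: eqVneq => //= ->; rewrite expr0n/= mulr0 => v2.
  by rewrite eq_sym -sqrf_eq0 eq_le v2 sqr_ge0.
have Iinv u s : v - e < u < v + e -> 0 < s ->
    (s ^+ 2 + u ^+ 2)^-1 <= 4 * (s ^+ 2 + v ^+ 2)^-1.
  move=> /Ie uv s0; have A := sqrD_gt0 u s0; have B := sqrD_gt0 v s0.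
  rewrite -ler_pdivrMl// -invfM lef_pV2 ?posrE ?mulr_gt0//.
  by have := sqr_ge0 s; lra.
(* One factor 1 / (s^2 + u^2), at most 4 / (s^2 + v^2), rebuilds the kernel at v up to s. In [G2]
   the other one is at most 4 / s^2, and 96 = 6 * 4 * 4 with the 6 of [pker_dxx_bound]. *)
pose G1 s := weight x s * (4 * s^-1) * pker t s.
pose G2 s := weight x s * (96 * (s ^+ 2)^-1) * pker t s.
have [] := @twice_derivable_under_pos R (fun u s => pker s u * h s)
   (fun u s => pker_dx s u * h s) (fun u s => pker_dxx s u * h s)
   G1 G2 (v - e) (v + e) v.
- by rewrite ltrBlDr ltrDl e0.
- move=> u s _ s0; apply: (is_derive_ext (is_derive_mul
    (is_derive_pker_x u s0) (is_derive_cst (h s) u 1))) => //=.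
  by rewrite mulr0 addr0.
- move=> u s _ s0; apply: (is_derive_ext (is_derive_mul
    (is_derive_pker_xx u s0) (is_derive_cst (h s) u 1))) => //=.
  by rewrite mulr0 addr0.
- by move=> u /Inz uv; exact: integrable_slice.
- move=> u _; apply: measurable_funM => //.
  apply: measurable_funf_div; last by apply: measurable_funX; exact: measurable_sqrD.
  by apply: measurableT_comp => //; apply: measurable_funM => //; exact: measurable_funM.
- move=> u s uI s0; rewrite /G1 [leRHS]mulrAC -hE normrM (gtr0_norm (h0 _ s0)).
  rewrite mulrAC ler_pM2r ?h0//.
  apply: le_trans (pker_dx_bound u s0) _; apply: le_trans (Iinv _ _ uI s0) _.
  rewrite le_eqVlt; apply/orP; left; apply/eqP; rewrite /pker.
  by have A0 := lt0r_neq0 (sqrD_gt0 v s0); field; rewrite A0 gt_eqF.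
- move=> u s uI s0; rewrite /G2 [leRHS]mulrAC -hE normrM (gtr0_norm (h0 _ s0)).
  rewrite mulrAC ler_pM2r ?h0//.
  apply: le_trans (pker_dxx_bound u s0) _.
  have i1 := Iinv _ _ uI s0.
  have i0 : 0 < (s ^+ 2 + u ^+ 2)^-1 by rewrite invr_gt0 sqrD_gt0.
  have i2 : 0 < (s ^+ 2 + v ^+ 2)^-1 by rewrite invr_gt0 sqrD_gt0.
  have i3 : (s ^+ 2 + v ^+ 2)^-1 <= (s ^+ 2)^-1.
    by rewrite lef_pV2 ?posrE ?sqrD_gt0 ?exprn_gt0// lerDl sqr_ge0.
  rewrite /pker -!mulrA.
  rewrite [leLHS](_ : _ = (6 * s) *
    ((s ^+ 2 + u ^+ 2)^-1 * (s ^+ 2 + u ^+ 2)^-1)); last by ring.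
  rewrite [leRHS](_ : _ = (6 * s) *
    ((4 * (s ^+ 2 + v ^+ 2)^-1) * (4 * (s ^+ 2)^-1))); last by ring.
  rewrite ler_pM2l ?mulr_gt0// ler_pM ?(ltW i0)//.
  by rewrite (le_trans i1)// ler_pM2l.
- by apply: integrable_weight => //; apply: admissibleZ; exact: admissible_inv.
- by apply: integrable_weight => //; apply: admissibleZ; exact: admissible_inv2.
move=> tF F2; have [tcF cF2] := twice_derivableZ (p_CC_cst d) tF.
rewrite /pderive2_ex /pderive2 sliceE; split => //.
rewrite [LHS]cF2 F2 /wint; congr (_ * _).
apply: eq_Rintegral => s; rewrite inE => /pos_gt0 s0.
by rewrite pker_dxxE// mulrAC hE mulrAC.
Qed.

(** The parameter stays away from 0 near t, so the dominating multipliers are constant in s. The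
    minus sign is the harmonicity of the kernel. *)
Lemma derive2_t_p_CC : twice_derivable (@p_CC R d x) t /\
  ((@p_CC R d x)^`(2))%classic t =
  p_CC_cst d * wint x t (fun s => - pker_ldx t s).
Proof.
have pE : @p_CC R d x =
    (fun u => p_CC_cst d * \int[mu]_(s in pos) (weight x s * pker u s)).
  by apply/funext => u; rewrite p_CCE.
have It u : t / 2 < u < 2 * t -> 0 < u by move=> /andP[]; lra.
have Iinv u s : t / 2 < u < 2 * t -> (u ^+ 2 + s ^+ 2)^-1 <= 4 * (t ^+ 2 + s ^+ 2)^-1.
  move=> uI; have u0 := It _ uI; have A := sqrD_gt0 s u0; have B := sqrD_gt0 s t0.
  rewrite -ler_pdivrMl// -invfM lef_pV2 ?posrE ?mulr_gt0//.
  have : t ^+ 2 <= (2 * u) ^+ 2.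
    by move: uI => /andP[u1 u2]; rewrite ler_sqr ?nnegrE//; lra.
  by have := sqr_ge0 s; lra.
(* For u in ]t/2, 2t[ each factor 1 / (u^2 + s^2) costs 4, and the numerator u costs 2: 192 = 6 * 2
   * 4 * 4. *)
pose G1 s := weight x s * (4 / t) * pker t s.
pose G2 s := weight x s * (192 / t ^+ 2) * pker t s.
have mw : measurable_fun pos (weight x) by exact: measurable_prod_pker.
have [] := @twice_derivable_under_pos R (fun u s => weight x s * pker u s)
   (fun u s => weight x s * pker_ds u s)
   (fun u s => weight x s * (2 * u * (u ^+ 2 - 3 * s ^+ 2) / (u ^+ 2 + s ^+ 2) ^+ 3))
   G1 G2 (t / 2) (2 * t) t.
- apply/andP; split; first by rewrite ltr_pdivrMr// ltr_pMr// ltr1n.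
  by rewrite ltr_pMl// ltr1n.
- move=> u s /It u0 s0; apply: (is_derive_ext (is_derive_mul
    (is_derive_cst (weight x s) u 1) (is_derive_pker_s s u0))) => //=.
  by rewrite mul0r add0r.
- move=> u s /It u0 s0; apply: (is_derive_ext (is_derive_mul
    (is_derive_cst (weight x s) u 1) (is_derive_pker_ss s u0))) => //=.
  by rewrite mul0r add0r.
- move=> u /It u0; have := integrable_weight regx (admissible_cst (1 : R)) u0.
  rewrite [X in mu.-integrable _ X -> _](_ : _ = EFin \o (fun s => weight x s * pker u s))//.
  by apply/funext => s /=; rewrite mulr1.
- move=> u _; apply: measurable_funM => //.
  apply: measurable_funf_div; last first.
    by apply: measurable_funX; apply: measurable_funD => //; exact: measurable_funX.
  by apply: measurable_funB => //; exact: measurable_funX.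
- move=> u s uI s0; rewrite /G1 normrM (gtr0_norm (weight_gt0 x s0)) -mulrA.
  rewrite ler_pM2l ?weight_gt0//.
  apply: le_trans (pker_ds_bound s (It _ uI)) _; apply: le_trans (Iinv _ s uI) _.
  rewrite le_eqVlt; apply/orP; left; apply/eqP; rewrite /pker.
  by have A0 := lt0r_neq0 (sqrD_gt0 s t0); field; rewrite A0 gt_eqF.
- move=> u s uI s0; have u0 := It _ uI.
  rewrite /G2 normrM (gtr0_norm (weight_gt0 x s0)) -[leRHS]mulrA ler_pM2l ?weight_gt0//.
  apply: le_trans (pker_ss_bound s u0) _.
  have i1 := Iinv _ s uI.
  have i0 : 0 < (u ^+ 2 + s ^+ 2)^-1 by rewrite invr_gt0 sqrD_gt0.
  have i2 : 0 < (t ^+ 2 + s ^+ 2)^-1 by rewrite invr_gt0 sqrD_gt0.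
  have i3 : (t ^+ 2 + s ^+ 2)^-1 <= (t ^+ 2)^-1.
    by rewrite lef_pV2 ?posrE ?sqrD_gt0 ?exprn_gt0// lerDl sqr_ge0.
  rewrite /pker.
  rewrite [leLHS](_ : _ = 6 *
    (u * ((u ^+ 2 + s ^+ 2)^-1 * (u ^+ 2 + s ^+ 2)^-1))); last by ring.
  rewrite [leRHS](_ : _ = 6 *
    ((2 * t) * ((4 * (t ^+ 2 + s ^+ 2)^-1) * (4 * (t ^+ 2)^-1)))); last by ring.
  rewrite ler_pM2l//; apply: ler_pM.
  + exact: ltW.
  + by rewrite mulr_ge0// ltW.
  + by move: uI => /andP[_ /ltW].
  + by rewrite ler_pM ?(ltW i0)// (le_trans i1)// ler_pM2l.
- by apply: integrable_weight => //; exact: admissible_cst.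
- by apply: integrable_weight => //; exact: admissible_cst.
move=> tF F2; have [tcF cF2] := twice_derivableZ (p_CC_cst d) tF.
rewrite pE; split => //; rewrite [LHS]cF2 F2 /wint; congr (_ * _).
apply: eq_Rintegral => s _; rewrite -[RHS]mulrA; congr (_ * _).
rewrite /pker_ldx /pker.
by have A0 := lt0r_neq0 (sqrD_gt0 s t0); field.
Qed.

End second_derivatives.

(** * The fractional equation at regular points *)

Section equation.
Context {R : realType}.
Notation mu := (@lebesgue_measure R).
Notation RL := (measurableTypeR R).
Notation pos := (`]0%R, +oo[%classic : set (measurableTypeR R)).

(** Applied to the logarithmic derivatives, it yields the double sum over j < k of the mixed Riesz
    terms. *)
Lemma sqr_sum (n : nat) (a : 'I_n -> R) :
  (\sum_i a i) ^+ 2 = \sum_i a i ^+ 2 +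
    2 * \sum_(k < n) \sum_(j < n | (j < k)%N) a j * a k.
Proof.
have H : \sum_(k < n) \sum_(j < n | (j < k)%N) a j * a k =
         \sum_(k < n) \sum_(j < n | (k < j)%N) a j * a k.
  under eq_bigr do rewrite big_mkcond.
  rewrite exchange_big; apply: eq_bigr => k _; rewrite [RHS]big_mkcond.
  by apply: eq_bigr => j _; case: ifP => // _; rewrite mulrC.
rewrite mulr2n mulrDl mul1r {2}H -!big_split expr2 big_distrl /=.
apply: eq_bigr => k _; rewrite big_distrr /= (bigD1 k)//= -expr2; congr (_ + _).
rewrite [X in _ = X + _]big_mkcond [X in _ = _ + X]big_mkcond -big_split big_mkcond.
apply: eq_bigr => j _; rewrite -val_eqE /=.
by case: ltngtP => _; rewrite ?addr0 ?add0r// mulrC.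
Qed.

Lemma is_derive_bigsum (I : Type) (r : seq I) (f g : I -> R -> R) (s : R) :
  (forall i, is_derive s 1 (f i) (g i s)) ->
  is_derive s 1 (fun s => \sum_(i <- r) f i s) (\sum_(i <- r) g i s).
Proof.
move=> df; elim: r => [|i r IH].
  under eq_fun do rewrite big_nil.
  by rewrite big_nil; exact: is_derive_cst.
under eq_fun do rewrite big_cons.
by rewrite big_cons; exact: is_derive_add.
Qed.

Lemma continuous_bigsum (I : Type) (r : seq I) (f : I -> R -> R) (s : R) :
  (forall i, {for s, continuous (f i)}) ->
  {for s, continuous (fun s => \sum_(i <- r) f i s)}.
Proof.
move=> cf; elim: r => [|i r IH].
  rewrite (_ : (fun s => _) = cst 0); first exact: cvg_cst.
  by apply/funext => z; rewrite big_nil.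
rewrite (_ : (fun s => _) = (fun s => f i s + \sum_(i <- r) f i s)).
  by apply: cvgD => //; exact: cf.
by apply/funext => z; rewrite big_cons.
Qed.

Lemma continuous_pker_ldx_s (s u : R) : 0 < s -> {for s, continuous (pker_ldx ^~ u)}.
Proof.
move=> s0; have A0 := lt0r_neq0 (sqrD_gt0 u s0).
have A2 : (s ^+ 2 + u ^+ 2) ^+ 2 != 0 by rewrite sqrf_eq0.
have [df h1] : exists df, is_derive s 1 (fun s => 6 * u ^+ 2 - 2 * s ^+ 2) df.
  eexists; apply: (is_derive_ext (is_derive_sub (is_derive_cst (6 * u ^+ 2) s 1)
    (is_derive_mul (is_derive_cst (2 : R) s 1) (is_derive_sqr (is_derive_id s 1))))) => //;
  reflexivity.
have h2 := is_derive_sqr (is_derive_sqr_addl s (u ^+ 2)).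
exact: (is_derive_continuous (is_derive_div
  (f := fun s => 6 * u ^+ 2 - 2 * s ^+ 2)
  (g := fun s => (s ^+ 2 + u ^+ 2) ^+ 2) A2 h1 h2)).
Qed.

Lemma continuous_pker_ldx_u (s u : R) : 0 < s -> {for u, continuous (pker_ldx s)}.
Proof.
move=> s0; have A0 := lt0r_neq0 (sqrD_gt0 u s0).
have A2 : (s ^+ 2 + u ^+ 2) ^+ 2 != 0 by rewrite sqrf_eq0.
have [df h1] : exists df, is_derive u 1 (fun u => 6 * u ^+ 2 - 2 * s ^+ 2) df.
  eexists; apply: (is_derive_ext (is_derive_sub (is_derive_mul (is_derive_cst (6 : R) u 1)
    (is_derive_sqr (is_derive_id u 1))) (is_derive_cst (2 * s ^+ 2) u 1))) => //;
  reflexivity.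
have h2 := is_derive_sqr (is_derive_sqr_addr u (s ^+ 2)).
exact: (is_derive_continuous (is_derive_div
  (f := fun u => 6 * u ^+ 2 - 2 * s ^+ 2)
  (g := fun u => (s ^+ 2 + u ^+ 2) ^+ 2) A2 h1 h2)).
Qed.

Variable d : nat.
Variables (x : d.-tuple R) (t : R).
Hypotheses (regx : regular_point x) (t0 : 0 < t).

Let mpos : measurable pos. Proof. exact: measurable_itv. Qed.

Lemma wintD phi psi : admissible phi -> admissible psi ->
  wint x t (fun s => phi s + psi s) = wint x t phi + wint x t psi.
Proof.
move=> h1 h2; rewrite /wint -RintegralD//; try exact: integrable_weight.
by apply: eq_Rintegral => s _; ring.
Qed.

Lemma wintZ k phi : admissible phi ->
  wint x t (fun s => k * phi s) = k * wint x t phi.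
Proof.
move=> h1; rewrite /wint -RintegralZl//; try exact: integrable_weight.
by apply: eq_Rintegral => s _; ring.
Qed.

Lemma wint_sum (I : Type) (r : seq I) (P : pred I) (phi : I -> R -> R) :
  (forall i, admissible (phi i)) ->
  wint x t (fun s => \sum_(i <- r | P i) phi i s) =
  \sum_(i <- r | P i) wint x t (phi i).
Proof.
move=> h; elim: r => [|i r IH].
  under eq_fun do rewrite big_nil; rewrite big_nil /wint.
  under eq_Rintegral do rewrite mulr0 mul0r.
  by rewrite Rintegral_cst// mul0r.
under eq_fun do rewrite big_cons; rewrite big_cons -IH.
by case: (P i) => //; rewrite wintD//; exact: admissible_sum.
Qed.

(** [S] is the logarithmic derivative of [weight x] and - [T] is the derivative of [S], so the
    second derivative of the weight is the weight times [S]^2 - [T]. *)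
Let S s := \sum_(j < d) pker_ld s (tnth x j).
Let T s := \sum_(j < d) (pker_ldx s (tnth x j) + pker_ld s (tnth x j) ^+ 2).

Lemma admissible_pker_ldx_t : @admissible R (pker_ldx t).
Proof.
split.
  apply: measurable_funf_div.
    by apply: measurable_funB => //; apply: measurable_funM => //; exact: measurable_funX.
  by apply: measurable_funX; apply: measurable_funD => //; exact: measurable_funX.
exists (6 / t ^+ 2); first by rewrite divr_ge0// sqr_ge0.
move=> s s0; rewrite (le_trans (pker_ldx_bound s t0))// ler_peMr//.
  by rewrite divr_ge0// sqr_ge0.
by rewrite lerDl invr_ge0 sqr_ge0.
Qed.

Lemma is_derive_weight (s : R) : 0 < s -> is_derive s 1 (weight x) (weight x s * S s).
Proof.
move=> s0; apply: (@is_derive_bigprod _ _ _ (fun j s => pker s (tnth x j))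
  (fun j s => pker_ld s (tnth x j))) => j.
by rewrite -pker_dsE//; exact: is_derive_pker_s.
Qed.

Lemma is_derive_weight_ld (s : R) : 0 < s -> is_derive s 1 S (- T s).
Proof.
move=> s0; rewrite /T -sumrN; apply: (@is_derive_bigsum _ _
  (fun j s => pker_ld s (tnth x j)) (fun j s => - (pker_ldx s (tnth x j) +
    pker_ld s (tnth x j) ^+ 2))) => j.
apply: (is_derive_eq (is_derive_pker_ld (tnth x j) s0)).
by rewrite /pker_ldx; ring.
Qed.

Lemma weight_ld_bound (s : R) : 0 < s -> `|S s| <= d%:R * s^-1.
Proof.
move=> s0; apply: le_trans (ler_norm_sum _ _ _) _.
apply: le_trans (ler_sum _ (fun j _ => pker_ld_bound (tnth x j) s0)) _.
by rewrite sumr_const card_ord mulr_natl.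
Qed.

(* The integrand is the derivative of [weight x * (pker_dx t - S * pker t)], where
   [S] is the logarithmic derivative of [weight x]: this performs both
   integrations by parts at once. *)
Lemma wint_wave : wint x t (fun s => pker_ldx t s + (T s - S s ^+ 2)) = 0.
Proof.
have adm : admissible (fun s => pker_ldx t s + (T s - S s ^+ 2)).
  apply: admissibleD; first exact: admissible_pker_ldx_t.
  rewrite (_ : (fun s => T s - S s ^+ 2) = (fun s =>
    (\sum_(k < d) pker_ldx s (tnth x k)) + (- 2) * \sum_(k < d)
      \sum_(j < d | (j < k)%N) pker_ld s (tnth x j) * pker_ld s (tnth x k))).
    apply: admissibleD; first by apply: admissible_sum => k; exact: admissible_pker_ldx.
    apply: admissibleZ; apply: admissible_sum => k; apply: admissible_sum => j.
    exact: admissible_pker_ld2.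
  by apply/funext => s; rewrite /T /S sqr_sum big_split /=; ring.
rewrite /wint /Rintegral.
pose F s := weight x s * (pker_dx t s - S s * pker t s).
have cf (s : R) : 0 < s -> {for s, continuous (fun s =>
    weight x s * (pker_ldx t s + (T s - S s ^+ 2)) * pker t s)}.
  move=> s0; have cS := is_derive_continuous (is_derive_weight_ld s0).
  apply: cvgM; last exact: pker_continuous.
  apply: cvgM; first exact: is_derive_continuous (is_derive_weight s0).
  apply: cvgD; first exact: continuous_pker_ldx_u.
  apply: cvgB; last by apply: cvgM; exact: cS.
  apply: continuous_bigsum => j; apply: cvgD; first exact: continuous_pker_ldx_s.
  have cl := is_derive_continuous (is_derive_pker_ld (tnth x j) s0).
  by apply: cvgM; exact: cl.
have dF (s : R) : 0 < s -> is_derive s 1 F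
    (weight x s * (pker_ldx t s + (T s - S s ^+ 2)) * pker t s).
  move=> s0; apply: (is_derive_ext (is_derive_mul (is_derive_weight s0)
    (is_derive_sub (is_derive_pker_xx s t0)
      (is_derive_mul (is_derive_weight_ld s0) (is_derive_pker_x s t0))))) => //.
  by rewrite pker_dxxE//; ring.
have [K K0 hK] := weight_bound regx.
have F_le (s : R) : 0 < s -> `|F s| <= weight x s *
    ((t ^+ 2 + s ^+ 2)^-1 + d%:R * s^-1 * pker t s).
  move=> s0; rewrite /F normrM (gtr0_norm (weight_gt0 x s0)) ler_pM2l ?weight_gt0//.
  apply: le_trans (ler_normB _ _) _; apply: lerD; first exact: pker_dx_bound.
  rewrite normrM (gtr0_norm (pker_gt0 s t0)) ler_pM2r ?pker_gt0//.
  exact: weight_ld_bound.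
have bnd_ge0 (s : R) : 0 < s ->
    0 <= (t ^+ 2 + s ^+ 2)^-1 + d%:R * s^-1 * pker t s.
  move=> s0; apply: addr_ge0; first by rewrite invr_ge0 ltW// sqrD_gt0.
  apply: mulr_ge0; first by rewrite mulr_ge0// invr_ge0 ltW.
  by rewrite ltW// pker_gt0.
(* Near 0 the weight is at most K s^2, which beats the factor 1 / s of [S] and leaves C s. *)
have F0 : F s @[s --> 0^'+] --> 0.
  pose C := K * ((t ^+ 2)^-1 + d%:R * t^-1).
  have C0 : 0 <= C.
    by rewrite mulr_ge0 ?(ltW K0)// addr_ge0 ?mulr_ge0 ?invr_ge0 ?sqr_ge0 ?(ltW t0).
  apply/cvgr0Pnorm_le => e e0; near=> s.
  have s0 : 0 < s by near: s; exact: nbhs_right_gt.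
  have s1 : s <= 1 by near: s; apply: nbhs_right_le.
  have sC : s <= e / (C + 1).
    by near: s; apply: nbhs_right_le; rewrite divr_gt0// ltr_wpDl.
  apply: le_trans (F_le _ s0) _; apply: (@le_trans _ _ (C * s)); last first.
    by move: sC; rewrite ler_pdivlMr ?ltr_wpDl//; nra.
  have [w1 _] := hK _ s0.
  apply: (@le_trans _ _ (K * s ^+ 2 * ((t ^+ 2)^-1 + d%:R * s^-1 * t^-1))).
    apply: ler_pM => //.
    - by rewrite ltW// weight_gt0.
    - exact: bnd_ge0.
    - apply: lerD.
        by rewrite lef_pV2 ?posrE ?sqrD_gt0 ?exprn_gt0// lerDl sqr_ge0.
      by rewrite ler_wpM2l ?pker_le_inv// mulr_ge0// invr_ge0 ltW.
  rewrite [leLHS](_ : _ = K * (s * (t ^+ 2)^-1 + d%:R * t^-1) * s); last first.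
    by field; rewrite !gt_eqF.
  rewrite ler_pM2r// /C ler_pM2l// lerD2r ler_piMl// invr_ge0 sqr_ge0//.
(* At infinity the weight is only used as bounded by K; both terms of the other factor are O(1 /
   s). *)
have Fy : F s @[s --> +oo] --> 0.
  pose C := K * (1 + d%:R * t^-1).
  have C0 : 0 <= C by rewrite mulr_ge0 ?(ltW K0)// addr_ge0 ?mulr_ge0 ?invr_ge0 ?(ltW t0).
  apply/cvgr0Pnorm_le => e e0; near=> s.
  have s1 : 1 <= s by near: s; apply: nbhs_pinfty_ge; rewrite num_real.
  have sC : C / e <= s by near: s; apply: nbhs_pinfty_ge; rewrite num_real.
  have s0 : 0 < s by exact: lt_le_trans s1.
  apply: le_trans (F_le _ s0) _; apply: (@le_trans _ _ (C * s^-1)); last first.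
    by move: sC; rewrite ler_pdivrMr// ler_pdivrMr// mulrC.
  have [_ w2] := hK _ s0.
  rewrite /C -[leRHS]mulrA; apply: ler_pM => //.
  - by rewrite ltW// weight_gt0.
  - exact: bnd_ge0.
  - rewrite mulrDl mul1r; apply: lerD.
      rewrite lef_pV2 ?posrE ?sqrD_gt0//.
      by have := sqr_ge0 t; nra.
    rewrite mulrAC ler_pM2r ?invr_gt0// ler_wpM2l// pker_le_inv//.
rewrite (FTC_0y (integrable_weight regx adm t0) cf dF F0 Fy).
by rewrite subrr.
Unshelve. all: by end_near. Qed.

Lemma fractional_equation_p_CC : fractional_equation_at (@p_CC R d) x t.
Proof.
have [dt dtE] := derive2_t_p_CC regx t0.
split; first exact: dt.
- by move=> k; have [] := pderive2_p_CC regx t0 k.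
- by move=> k j jk; have [] := mixed_priesz_p_CC regx t0 jk.
have e1 : \sum_(k < d) pderive2 k (@p_CC R d ^~ t) x =
    \sum_(k < d) p_CC_cst d * wint x t (pker_ldx ^~ (tnth x k)).
  by apply: eq_bigr => k _; have [] := pderive2_p_CC regx t0 k.
have e2 : \sum_(k < d) \sum_(j < d | (j < k)%N)
      priesz k (priesz j (@p_CC R d ^~ t)) x =
    \sum_(k < d) \sum_(j < d | (j < k)%N) p_CC_cst d *
      wint x t (fun s => pker_ld s (tnth x j) * pker_ld s (tnth x k)).
  by apply: eq_bigr => k _; apply: eq_bigr => j jk; have [] := mixed_priesz_p_CC regx t0 jk.
rewrite dtE e1 e2.
have a1 k : @admissible R (pker_ldx ^~ (tnth x k)) by exact: admissible_pker_ldx.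
have a2 k j : @admissible R (fun s => pker_ld s (tnth x j) * pker_ld s (tnth x k)).
  exact: admissible_pker_ld2.
under [in X in _ - _ * X]eq_bigr => k _ do rewrite -big_distrr/= -wint_sum//.
rewrite -!big_distrr /= -wint_sum// -wint_sum//; last first.
  by move=> k; apply: admissible_sum.
rewrite mulrCA -mulrBr; congr (_ * _).
have -> : (fun s => - pker_ldx t s) = (fun s => -1 * pker_ldx t s).
  by apply/funext => s; rewrite mulN1r.
rewrite wintZ; last exact: admissible_pker_ldx_t.
(* Expanding [S]^2 cancels the squares contained in [T], so [T] - [S]^2 becomes the multiplier of
   the right-hand side of the equation. *)
have := wint_wave.
rewrite (_ : (fun s => _) = (fun s => pker_ldx t s + ((\sum_(k < d) pker_ldx s (tnth x k)) +
    (- 2) * \sum_(k < d) \sum_(j < d | (j < k)%N)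
      pker_ld s (tnth x j) * pker_ld s (tnth x k)))); last first.
  by apply/funext => s; rewrite /T /S sqr_sum big_split /=; ring.
have a3 : admissible (fun s => \sum_(k < d) \sum_(j < d | (j < k)%N)
      pker_ld s (tnth x j) * pker_ld s (tnth x k)).
  by apply: admissible_sum => k; apply: admissible_sum.
have a4 : admissible (fun s => \sum_(k < d) pker_ldx s (tnth x k)).
  exact: admissible_sum.
rewrite wintD; [|exact: admissible_pker_ldx_t|]; last first.
  by apply: admissibleD => //; exact: admissibleZ.
rewrite wintD//; last exact: admissibleZ.
by rewrite wintZ// => h; lra.
Qed.

End equation.

(** * Lebesgue measure on tuples: sigma-finiteness and iterated integrals *)

Definition sigma_finite_pack d (T : measurableType d) (R : realType)
    (m : {measure set T -> \bar R}) (sf : sigma_finite setT m) :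
    {sigma_finite_measure set T -> \bar R} :=
  HB.pack_for (SigmaFiniteMeasure.type T R) (Measure.sort m)
    (isSFinite.Build _ _ _ _ (sfinite_measure_sigma_finite sf))
    (isSigmaFinite.Build _ _ _ _ sf).

Section tuple_measure.
Context {R : realType}.
Notation mu := (@lebesgue_measure R).
Notation RL := (measurableTypeR R).

Lemma ge0_integral_lebesgue_tuple0 (f : 0.-tuple R -> \bar R) :
  measurable_fun setT f ->
  (\int[lebesgue_tuple 0]_x f x = f [tuple])%E.
Proof.
move=> mf.
have := @integral_dirac _ (0.-tuple R) [tuple] R setT measurableT f mf.
by rewrite diracT mul1e.
Qed.

Lemma measurable_tuple_box n (B : 'I_n -> set R) : (forall i, measurable (B i)) ->
  measurable [set x : n.-tuple R | forall i, B i (tnth x i)].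
Proof.
move=> mB; rewrite (_ : [set x | _] = \bigcap_(i in setT) ((@tnth n R ^~ i) @^-1` B i)).
  apply: fin_bigcap_measurable => // i _; rewrite -[X in measurable X]setTI.
  exact: measurable_tnth.
by apply/seteqP; split => [x h i _|x h i]; [exact: h|exact: h].
Qed.

Lemma measurable_tuple_consL n :
  measurable_fun [set: n.-tuple R * RL] (@tuple_cons R n).
Proof. exact: measurable_tuple_cons. Qed.

Lemma lebesgue_tupleS n (A : set (n.+1.-tuple R)) :
  lebesgue_tuple n.+1 A = (lebesgue_tuple n \x mu)%E (@tuple_cons R n @^-1` A).
Proof. by []. Qed.

Lemma tuple_cons_box n (B : 'I_n.+1 -> set R) :
  @tuple_cons R n @^-1` [set x | forall i, B i (tnth x i)] =
  [set v | forall i, B (lift ord0 i) (tnth v i)] `*` B ord0.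
Proof.
apply/seteqP; split => [[v u] /= h|[v u] /= [h1 h2] i].
  split=> [i|]; last by have := h ord0; rewrite /tuple_cons.
  by have := h (lift ord0 i); rewrite tnthS.
by case: (unliftP ord0 i) => [j ->|->]; rewrite ?tnthS//.
Qed.

Lemma lebesgue_tuple_box_lty n (B : 'I_n -> set RL) :
  (forall i, measurable (B i)) -> (forall i, mu (B i) < +oo)%E ->
  (lebesgue_tuple n [set x | forall i, B i (tnth x i)] < +oo)%E.
Proof.
elim: n B => [|n IH] B mB fB.
  by rewrite /= diracE ltry.
rewrite lebesgue_tupleS tuple_cons_box.
have mB' : measurable [set v : n.-tuple R | forall i, B (lift ord0 i) (tnth v i)].
  by apply: (measurable_tuple_box (B := fun i => B (lift ord0 i))) => i; exact: mB.
rewrite (product_measure1E (lebesgue_tuple n) mu mB' (mB ord0)).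
apply: lte_mul_pinfty => //; last exact: fB.
rewrite ge0_fin_numE//.
by apply: (IH (fun i => B (lift ord0 i))) => i; [exact: mB|exact: fB].
Qed.

Lemma lebesgue_tuple_sigma_finite n : sigma_finite setT (@lebesgue_tuple R n).
Proof.
exists (fun k => [set x | forall i, `[- k%:R, k%:R]%classic (tnth x i)]).
  apply/esym/seteqP; split => // x _.
  pose m : R := \sum_i `|tnth x i|.
  have [k mk] : exists k, m <= k%:R.
    exists (Num.truncn m).+1; apply/ltW; rewrite truncnS_gt//.
  exists k => //= i; rewrite in_itv/= -ler_norml (le_trans _ mk)// /m (bigD1 i)//=.
  by rewrite lerDl sumr_ge0.
move=> k; split; first exact: (measurable_tuple_box
  (B := fun=> `[- k%:R, k%:R]%classic) (fun=> measurable_itv _)).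
apply: (lebesgue_tuple_box_lty (B := fun=> `[- k%:R, k%:R]%classic)) => i.
  exact: measurable_itv.
rewrite [ltLHS]lebesgue_measure_itv/=; case: ifPn => _; by rewrite ltry.
Qed.

(** Carries the structure that Tonelli and Radon-Nikodym ask for; the underlying set function is
    still [lebesgue_tuple n], so integrals agree by conversion. *)
Definition lebesgue_tuple_sf n : {sigma_finite_measure set (n.-tuple R) -> \bar R} :=
  sigma_finite_pack (@lebesgue_tuple_sigma_finite n).

Lemma ge0_integral_lebesgue_tupleS n (f : n.+1.-tuple R -> \bar R) :
  measurable_fun setT f -> (forall y, 0 <= f y)%E ->
  (\int[lebesgue_tuple n.+1]_x f x =
   \int[lebesgue_tuple n]_v \int[mu]_u f (tuple_cons (v, u)))%E.
Proof.
move=> mf f0.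
have mc := @measurable_tuple_consL n.
have mfc : measurable_fun [set: n.-tuple R * RL] (f \o @tuple_cons R n).
  exact: measurableT_comp.
have e := @ge0_integral_pushforward _ _ (n.-tuple R * RL)%type _ R
  (@tuple_cons R n) mc (lebesgue_tuple n \x mu)%E setT f measurableT mf
  (fun y _ => f0 y).
transitivity (\int[(lebesgue_tuple n \x mu)%E]_z (f \o @tuple_cons R n) z)%E.
  exact: e.
have h0 z : (0 <= (f \o @tuple_cons R n) z)%E by exact: f0.
exact: (@fubini_tonelli1 _ _ (n.-tuple R) RL R (lebesgue_tuple_sf n) mu _ mfc h0).
Qed.

End tuple_measure.

(** * Mass of the density on boxes *)

Section product_integral.
Context {R : realType}.
Notation mu := (@lebesgue_measure R).
Notation RL := (measurableTypeR R).
Notation pos := (`]0%R, +oo[%classic : set (measurableTypeR R)).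

Lemma measurable_prod_tnth n (f : 'I_n -> RL -> R) :
  (forall i, measurable_fun setT (f i)) ->
  measurable_fun [set: n.-tuple R] (fun x => \prod_(i < n) f i (tnth x i)).
Proof.
move=> mf; apply: measurable_prod => i _.
by apply: (@measurableT_comp _ _ _ _ _ _ (f i)); [exact: mf|exact: measurable_tnth].
Qed.

Lemma ge0_integral_prod_tuple n (f : 'I_n -> RL -> R) :
  (forall i, measurable_fun setT (f i)) -> (forall i u, 0 <= f i u) ->
  (\int[lebesgue_tuple n]_x (\prod_(i < n) f i (tnth x i))%:E =
   \prod_(i < n) \int[mu]_u (f i u)%:E)%E.
Proof.
elim: n f => [|n IH] f mf f0.
  rewrite ge0_integral_lebesgue_tuple0; last first.
    by apply/measurable_EFinP; exact: measurable_prod_tnth mf.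
  by rewrite !big_ord0.
have mp : measurable_fun [set: n.-tuple R]
    (fun v => (\prod_(i < n) f (lift ord0 i) (tnth v i))%:E).
  apply/measurable_EFinP.
  exact: (measurable_prod_tnth (f := fun i => f (lift ord0 i))).
have p0 v : (0 <= (\prod_(i < n) f (lift ord0 i) (tnth v i))%:E)%E.
  by rewrite lee_fin prodr_ge0.
rewrite ge0_integral_lebesgue_tupleS; last 2 first.
- by apply/measurable_EFinP; exact: measurable_prod_tnth mf.
- by move=> y; rewrite lee_fin prodr_ge0.
rewrite big_ord_recl muleC -(IH (fun i => f (lift ord0 i)))// -ge0_integralZr//; last first.
  by apply: integral_ge0 => u _; rewrite lee_fin.
apply: eq_integral => v _; rewrite -ge0_integralZl//; last 2 first.
- exact/measurable_EFinP.
- by move=> u _; rewrite lee_fin.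
apply: eq_integral => u _; rewrite big_ord_recl -EFinM mulrC; congr (_ * _)%:E.
by apply: eq_bigr => i _; rewrite tnthS.
Qed.

Lemma cauchy_densityE (s x : R) : cauchy_density s x = pi^-1 * pker s x.
Proof. by rewrite /cauchy_density /pker invfM mulrCA. Qed.

Lemma cauchy_density_ge0 (s x : R) : 0 < s -> 0 <= cauchy_density s x.
Proof.
by move=> s0; rewrite cauchy_densityE mulr_ge0 ?invr_ge0 ?pi_ge0// ltW// pker_gt0.
Qed.

Lemma measurable_cauchy_density (s : R) (D : set RL) :
  measurable_fun D (cauchy_density s).
Proof.
rewrite (_ : cauchy_density s = fun x => pi^-1 * pker s x).
  by apply: measurable_funM => //; exact: measurable_pker_x.
by apply/funext => x; rewrite cauchy_densityE.
Qed.

Lemma integral_cauchy_density_pos (s : R) : 0 < s ->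
  (\int[mu]_(x in pos) (2 * cauchy_density s x)%:E = 1)%E.
Proof.
move=> s0; rewrite (eq_integral (fun x : RL =>
    (pi^-1)%:E * (pker s (x - 0) + pker s (x + 0))%:E)%E); last first.
  move=> x _; rewrite cauchy_densityE subr0 addr0 -EFinM; congr EFin; ring.
rewrite integralZl//; last exact: integrable_pker_pair.
by rewrite integral_pker_pair// -EFinM mulVf// gt_eqF// pi_gt0.
Qed.

Lemma integral_cauchy_density (s : R) : 0 < s ->
  (\int[mu]_x (cauchy_density s x)%:E = 1)%E.
Proof.
move=> s0.
have cE : cauchy_density s = fun x => pi^-1 * pker s x.
  by apply/funext => x; rewrite cauchy_densityE.
have cc : continuous (cauchy_density s).
  by rewrite cE => x; apply: cvgM; [exact: cvg_cst|exact: pker_continuous].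
rewrite ge0_symfun_integralT//; last 2 first.
- by move=> x; exact: cauchy_density_ge0.
- by move=> x /=; rewrite /cauchy_density sqrrN.
rewrite -(integral_cauchy_density_pos s0) -set_itvcy -integral_itv_obnd_cbnd; last first.
  exact: continuous_measurable_EFin.
rewrite -ge0_integralZl//.
- exact: continuous_measurable_EFin.
- by move=> x _; rewrite lee_fin cauchy_density_ge0.
Qed.

Variables (d : nat) (t : R).
Hypothesis t0 : 0 < t.

Let mpos : measurable pos. Proof. exact: measurable_itv. Qed.

Lemma p_CC_cstM (x : d.-tuple R) (s : R) : p_CC_cst d * p_CC_integrand x t s =
  2 * cauchy_density t s * \prod_(j < d) cauchy_density s (tnth x j).
Proof.
under eq_bigr do rewrite cauchy_densityE.
rewrite big_split/= prodr_const card_ord cauchy_densityE /p_CC_cst /p_CC_integrand.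
by rewrite exprVn exprS invfM /pker; ring.
Qed.

Lemma measurable_p_CC_integrand :
  measurable_fun [set: d.-tuple R * RL] (fun z => p_CC_integrand z.1 t z.2).
Proof.
have m2 : measurable_fun [set: d.-tuple R * RL] (fun z => z.2 : R) by exact: measurable_snd.
apply: measurable_funM.
  apply: measurable_prod => j _; apply: measurable_funf_div => //.
  apply: measurable_funD; apply: measurable_funX => //.
  by apply: (@measurableT_comp _ _ _ _ _ _ (fun x => tnth x j)) => //; exact: measurable_tnth.
apply: measurable_funf_div => //.
by apply: measurable_funD => //; exact: measurable_funX.
Qed.

(** The density before infinite values are replaced by the default 0; Tonelli applies to this
    extended version. *)
Definition p_CC_ereal (x : d.-tuple R) : \bar R :=
  (\int[mu]_(s in pos) (p_CC_integrand x t s)%:E)%E.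

Let integrand_ge0 (x : d.-tuple R) s : 0 < s -> 0 <= p_CC_integrand x t s.
Proof.
move=> s0; rewrite mulr_ge0//; last by rewrite ltW// -/(pker t s) pker_gt0.
by apply: prodr_ge0 => j _; rewrite ltW// -/(pker s (tnth x j)) pker_gt0.
Qed.

Lemma p_CC_ereal_ge0 x : (0 <= p_CC_ereal x)%E.
Proof.
apply: integral_ge0 => s /pos_gt0 s0; rewrite lee_fin; exact: integrand_ge0.
Qed.

Lemma p_CC_erealE x : p_CC x t = p_CC_cst d * fine (p_CC_ereal x).
Proof. by []. Qed.

Let kern (z : d.-tuple R * RL) : \bar R :=
  (p_CC_integrand z.1 t z.2 * (\1_pos : RL -> R) z.2)%:E.

Let kern_ge0 z : (0 <= kern z)%E.
Proof.
rewrite lee_fin indicE; case: (boolP (z.2 \in pos)); rewrite ?mulr0// inE mulr1.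
by move=> /pos_gt0 s0; exact: integrand_ge0.
Qed.

Let mkern : measurable_fun setT kern.
Proof.
apply/measurable_EFinP; apply: measurable_funM; first exact: measurable_p_CC_integrand.
exact: (@measurableT_comp _ _ _ _ _ _ (\1_pos : RL -> R)).
Qed.

Let p_CC_ereal_kern x : p_CC_ereal x = (\int[mu]_s kern (x, s))%E.
Proof.
rewrite /p_CC_ereal integral_mkcond; apply: eq_integral => s _.
rewrite patchE /kern/= indicE; case: ifPn => _; by rewrite ?mulr1 ?mulr0.
Qed.

Lemma measurable_p_CC_ereal : measurable_fun setT p_CC_ereal.
Proof.
rewrite (_ : p_CC_ereal = fubini_F mu kern).
  exact: measurable_fun_fubini_tonelli_F.
by apply/funext => x; rewrite p_CC_ereal_kern.
Qed.

Lemma measurable_p_CC : measurable_fun [set: d.-tuple R] (fun x => p_CC x t).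
Proof.
apply: measurable_funM => //.
by apply: measurableT_comp => //; exact: measurable_p_CC_ereal.
Qed.

Lemma p_CC_ge0 (x : d.-tuple R) : 0 <= p_CC x t.
Proof.
rewrite p_CC_erealE mulr_ge0// ?fine_ge0 ?p_CC_ereal_ge0//.
by rewrite divr_ge0// exprn_ge0// pi_ge0.
Qed.

Definition cauchy_mass (B : set RL) (s : R) : \bar R :=
  (\int[mu]_(u in B) (cauchy_density s u)%:E)%E.

(** The right-hand side is a mean over |C(t)|, whose density on s > 0 is [2 * cauchy_density t s];
    given |C(t)| = s the coordinates are independent Cauchy variables of scale s. *)
Lemma p_CC_ereal_box (B : 'I_d -> set RL) : (forall j, measurable (B j)) ->
  (\int[lebesgue_tuple d]_(x in [set x | forall j, B j (tnth x j)])
     ((p_CC_cst d)%:E * p_CC_ereal x) =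
   \int[mu]_(s in pos)
     ((2 * cauchy_density t s)%:E * \prod_(j < d) cauchy_mass (B j) s))%E.
Proof.
move=> mB; pose A := [set x : d.-tuple R | forall j, B j (tnth x j)].
have mA : measurable A by exact: measurable_tuple_box.
pose h (z : d.-tuple R * RL) : \bar R := (p_CC_cst d * (p_CC_integrand z.1 t z.2 *
  (\1_pos : RL -> R) z.2) * (\1_A : _ -> R) z.1)%:E.
have c0 : 0 <= p_CC_cst d :> R by rewrite divr_ge0// exprn_ge0// pi_ge0.
have h0 z : (0 <= h z)%E.
  have := kern_ge0 z; rewrite /kern /h !lee_fin => k0.
  by apply: mulr_ge0; [exact: mulr_ge0|rewrite indicE ler0n].
have mh : measurable_fun setT h.
  apply/measurable_EFinP; apply: measurable_funM.
    by apply: measurable_funM => //; apply/measurable_EFinP; exact: mkern.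
  apply: (@measurableT_comp _ _ _ _ _ _ (\1_A : d.-tuple R -> R)) => //.
transitivity (\int[lebesgue_tuple_sf d]_x \int[mu]_s h (x, s))%E.
  rewrite [LHS]integral_mkcond -/A; apply: eq_integral => x _.
  rewrite patchE; case: ifPn => xA; last first.
    by rewrite integral0_eq// => s _; rewrite /h/= [\1_A _]indicE (negbTE xA) mulr0.
  rewrite p_CC_ereal_kern -ge0_integralZl//; last exact: measurable_fun_pair2.
  by apply: eq_integral => s _; rewrite /h/= [\1_A _]indicE xA mulr1.
rewrite (fubini_tonelli h mh h0) [RHS]integral_mkcond.
apply: eq_integral => s _; rewrite patchE; case: ifPn => [|/negP] sp; last first.
  rewrite integral0_eq// => x _; rewrite /h/= [\1_pos _]indicE memNset ?mulr0 ?mul0r//.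
  by move=> ?; apply: sp; rewrite inE.
have s0 : 0 < s by move: sp; rewrite inE => /pos_gt0.
pose f j (u : RL) := cauchy_density s u * (\1_(B j) : RL -> R) u.
have mf j : measurable_fun setT (f j).
  by apply: measurable_funM => //; exact: measurable_cauchy_density.
have f0 j u : 0 <= f j u by rewrite mulr_ge0 ?cauchy_density_ge0.
transitivity (\int[lebesgue_tuple d]_x ((2 * cauchy_density t s)%:E *
    (\prod_(j < d) f j (tnth x j))%:E))%E.
  apply: eq_integral => x _; rewrite /h/= [\1_pos _]indicE sp mulr1 p_CC_cstM -EFinM.
  rewrite -mulrA; congr (_ * _)%:E; rewrite /f [RHS]big_split/=; congr (_ * _).
  have [xA|xA] := pselect (A x).
    rewrite indicE mem_set// big1// => j _; rewrite indicE mem_set//; exact: xA.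
  rewrite indicE memNset//; apply/esym/eqP/prodf_eq0.
  have /existsNP[j nBj] := xA.
  by exists j => //; rewrite indicE memNset.
rewrite ge0_integralZl//; last 3 first.
- by apply/measurable_EFinP; exact: measurable_prod_tnth mf.
- by move=> x _; rewrite lee_fin prodr_ge0.
- by rewrite lee_fin mulr_ge0 ?cauchy_density_ge0.
rewrite ge0_integral_prod_tuple//; congr (_ * _)%E.
apply: eq_bigr => j _; rewrite /cauchy_mass [RHS]integral_mkcond.
apply: eq_integral => u _; rewrite patchE /f indicE.
by case: ifPn => _; rewrite ?mulr1 ?mulr0.
Qed.

Lemma p_CC_ereal_total :
  (\int[lebesgue_tuple d]_x ((p_CC_cst d)%:E * p_CC_ereal x) = 1)%E.
Proof.
have := p_CC_ereal_box (fun=> measurableT).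
rewrite (_ : [set x | _] = setT); last by apply/seteqP; split.
move=> ->; rewrite -[RHS](integral_cauchy_density_pos t0).
apply: eq_integral => s; rewrite inE => /pos_gt0 s0.
rewrite (_ : (\prod_(j < d) _ = 1)%E) ?mule1//.
apply: (big_ind (fun y : \bar R => y = 1%E)) => // [u v -> ->|j _].
  by rewrite mule1.
exact: integral_cauchy_density.
Qed.

(** Total mass 1 forces the extended density to be finite almost everywhere, so the default value in
    [p_CC] is invisible to integrals. *)
Lemma p_CC_integralE (A : set (d.-tuple R)) : measurable A ->
  (\int[lebesgue_tuple d]_(x in A) (p_CC x t)%:E =
   \int[lebesgue_tuple d]_(x in A) ((p_CC_cst d)%:E * p_CC_ereal x))%E.
Proof.
move=> mA.
have c0 : 0 < p_CC_cst d :> R by rewrite divr_gt0// exprn_gt0// pi_gt0.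
have mg : measurable_fun setT (fun x => (p_CC_cst d)%:E * p_CC_ereal x)%E.
  by apply: measurable_funeM; exact: measurable_p_CC_ereal.
have g0 x : (0 <= (p_CC_cst d)%:E * p_CC_ereal x)%E.
  by rewrite mule_ge0 ?lee_fin ?(ltW c0)// p_CC_ereal_ge0.
have ig : (lebesgue_tuple d).-integrable setT (fun x => (p_CC_cst d)%:E * p_CC_ereal x)%E.
  apply/integrableP; split => //.
  under eq_integral do rewrite gee0_abs//.
  by rewrite p_CC_ereal_total ltry.
apply: ge0_ae_eq_integral => //.
- by apply/measurable_EFinP; apply: measurable_funTS; exact: measurable_p_CC.
- exact: measurable_funTS.
- by move=> x _; rewrite lee_fin p_CC_ge0.
have := integrable_ae measurableT ig; apply: filterS => x /(_ I) fx _.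
rewrite p_CC_erealE EFinM fineK//.
move: fx; have := p_CC_ereal_ge0 x; case: (p_CC_ereal x) => [r||]//= _.
by rewrite gt0_muley ?lte_fin.
Qed.

Lemma p_CC_box (B : 'I_d -> set RL) : (forall j, measurable (B j)) ->
  (\int[lebesgue_tuple d]_(x in [set x | forall j, B j (tnth x j)]) (p_CC x t)%:E =
   \int[mu]_(s in pos)
     ((2 * cauchy_density t s)%:E * \prod_(j < d) cauchy_mass (B j) s))%E.
Proof.
by move=> mB; rewrite p_CC_integralE ?p_CC_ereal_box//; exact: measurable_tuple_box.
Qed.

Lemma p_CC_total : (\int[lebesgue_tuple d]_x (p_CC x t)%:E = 1)%E.
Proof. by rewrite p_CC_integralE// p_CC_ereal_total. Qed.

End product_integral.

(** * Measures with a density *)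

Section density.
Context d (T : measurableType d) (R : realType).
Variables (m : {measure set T -> \bar R}) (g : T -> R).
Hypotheses (mg : measurable_fun setT g) (g0 : forall x, 0 <= g x).

Let nu (A : set T) : \bar R := (\int[m]_(x in A) (g x)%:E)%E.

Let nu0 : nu set0 = 0%E. Proof. exact: integral_set0. Qed.

Let nu_ge0 A : (0 <= nu A)%E.
Proof. by apply: integral_ge0 => x _; rewrite lee_fin. Qed.

Let nu_sigma_additive : semi_sigma_additive nu.
Proof.
move=> /= F mF tF mUF; rewrite /nu; apply: cvg_toP.
  apply: ereal_nondecreasing_is_cvgn => i j ij.
  by apply: lee_sum_nneg_natr => // k _ _; exact: nu_ge0.
rewrite ge0_integral_bigcup//.
- by apply/measurable_EFinP; exact: measurable_funTS.
- by move=> x _; rewrite lee_fin.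
Qed.

Definition density_measure : {measure set T -> \bar R} :=
  HB.pack_for (Measure.type T R) nu
    (isMeasure.Build _ _ _ nu nu0 nu_ge0 nu_sigma_additive).

End density.

Section integral_density.
Context d (T : measurableType d) (R : realType).
Variables (m : {sigma_finite_measure set T -> \bar R})
  (nu : {finite_measure set T -> \bar R}) (g : T -> R).
Hypothesis (mg : measurable_fun setT g).
Hypothesis nuE : forall A, measurable A -> nu A = (\int[m]_(x in A) (g x)%:E)%E.

(** [g] agrees almost everywhere with the Radon-Nikodym derivative, because both integrate to [nu]
    on every measurable set. The signed case is needed for the test functions of the initial
    condition. *)
Lemma integral_density (f : T -> \bar R) : nu.-integrable setT f ->
  (\int[nu]_x f x = \int[m]_x (f x * (g x)%:E))%E.
Proof.
move=> intf.
have mf : measurable_fun setT f by exact: measurable_int intf.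
have num : nu `<< m.
  apply/null_content_dominatesP => A mA mA0; apply: etrans (nuE mA) _.
  by rewrite null_set_integral//; apply/measurable_EFinP; exact: measurable_funTS.
rewrite -(Radon_Nikodym_change_of_variables num)//.
have num' : charge_of_finite_measure nu `<< m by [].
have iD := Radon_Nikodym_integrable num'.
apply: ae_eq_integral => //.
- by apply: emeasurable_funM => //; exact: measurable_int iD.
- by apply: emeasurable_funM => //; exact/measurable_EFinP.
- apply: ae_eqe_mul2l; apply: integral_ae_eq => //; first exact/measurable_EFinP.
  by move=> E _ mE; rewrite -Radon_Nikodym_integral//; exact: nuE.
Qed.

End integral_density.

(** * Probabilities of almost surely comparable events and of limits of events *)

Section events.
Context d (T : measurableType d) (R : realType) (P : probability T R).

Lemma ae_le_measure (A B : set T) : measurable A -> measurable B ->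
  {ae P, forall w, A w -> B w} -> (P A <= P B)%E.
Proof.
move=> mA mB [N [mN N0 sub]].
apply: (@le_trans _ _ (P (B `|` N))).
  apply: le_measure; rewrite ?inE//; first exact: measurableU.
  move=> w Aw; have [Bw|nBw] := pselect (B w); [by left|right].
  by apply: sub => /= h; exact/nBw/h.
by apply: le_trans (measureU2 _ mB mN) _; rewrite [X in (_ + X)%E]N0 adde0.
Qed.

Lemma ae_eq_measure (A B : set T) : measurable A -> measurable B ->
  {ae P, forall w, A w <-> B w} -> P A = P B.
Proof.
move=> mA mB h; apply/eqP; rewrite eq_le; apply/andP; split;
  by apply: ae_le_measure => //; apply: filterS h => w [].
Qed.

(** Fatou's lemma for events: the tail intersections increase, and the m-th one is contained in
    [A m]. *)
Lemma measure_liminf_le (A : (set T)^nat) (l : \bar R) :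
  (forall n, measurable (A n)) -> P (A n) @[n --> \oo] --> l ->
  (P (\bigcup_m \bigcap_(n in [set n | (m <= n)%N]) A n) <= l)%E.
Proof.
move=> mA Al; pose F m := \bigcap_(n in [set n | (m <= n)%N]) A n.
have mF m : measurable (F m) by apply: bigcap_measurableType.
have ndF : nondecreasing_seq F.
  move=> i j ij; apply/subsetPset => w Fw n /= jn; apply: Fw.
  exact: leq_trans jn.
have cF := nondecreasing_cvg_mu (mu := P) mF (bigcup_measurable (fun i _ => mF i)) ndF.
apply: (lee_cvg_to cF Al); apply: nearW => m /=.
by apply: le_measure; rewrite ?inE// => w Fw; apply: Fw => /=.
Qed.

End events.

(** * Integrals of even functions *)

Section symmetric.
Context (R : realType).
Notation mu := (@lebesgue_measure R).
Notation RL := (measurableTypeR R).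
Notation pos := (`]0%R, +oo[%classic : set (measurableTypeR R)).

Lemma ge0_integral_even (f : RL -> \bar R) : measurable_fun setT f ->
  (forall x, 0 <= f x)%E -> (forall x, f (- x) = f x) ->
  (\int[mu]_x f x = \int[mu]_(x in pos) f x + \int[mu]_(x in pos) f x)%E.
Proof.
move=> mf f0 fN.
have e1 : (\int[mu]_(x in pos) f x = \int[mu]_(x in `[0%R, +oo[) f x)%E.
  by rewrite integral_itv_obnd_cbnd//; exact: measurable_funTS.
have e2 : (\int[mu]_(x in `]-oo, 0%R[) f x = \int[mu]_(x in `[0%R, +oo[) f x)%E.
  rewrite ge0_integration_by_substitution0//.
  under [RHS]eq_integral do rewrite fN.
  by rewrite integral_itv_bndo_bndc//; exact: measurable_funTS.
have UT : [set: RL] = (`]-oo, 0%R[%classic : set RL) `|` `[0%R, +oo[%classic.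
  apply/seteqP; split => x //= _; rewrite !in_itv/= andbT.
  by have [x0|x0] := ltP x 0; [left|right].
rewrite e1 -{1}e2 [in LHS]UT ge0_integral_setU//.
- exact: measurable_funTS.
- apply/disj_setPS => x [/=]; rewrite !in_itv/= andbT => x0 x1.
  by have := lt_le_trans x0 x1; rewrite ltxx.
Qed.

End symmetric.

(** * Open lower orthants and continuous functions on tuples *)

Section tuple_topology.
Context {R : realType} (d : nat).
Notation RL := (measurableTypeR R).

Definition ray (b : 'I_d -> R) : set (d.-tuple R) :=
  [set x | forall j, `]-oo, b j[%classic (tnth x j)].

Lemma measurable_ray b : measurable (ray b).
Proof.
exact: (measurable_tuple_box (B := fun j => `]-oo, b j[%classic)
  (fun=> measurable_itv _)).
Qed.

Lemma rayE b x : ray b x <-> forall j, tnth x j < b j.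
Proof. by split => h j; have := h j; rewrite /= in_itv. Qed.

Lemma exists_nat_gt_tnth (x : d.-tuple R) : exists k : nat, forall j, tnth x j < k%:R.
Proof.
exists (Num.truncn (\sum_j `|tnth x j|)).+1 => j.
apply: (@le_lt_trans _ _ (\sum_j `|tnth x j|)); last exact: truncnS_gt.
by rewrite (bigD1 j)//= (le_trans (ler_norm _))// lerDl sumr_ge0.
Qed.

Lemma measurable_rays :
  @measurable _ (d.-tuple R) = <<s range ray >>.
Proof.
apply/seteqP; split; last first.
  apply: smallest_sub; first exact: sigma_algebra_measurable.
  by move=> _ [b _ <-]; exact: measurable_ray.
pose T1 := g_sigma_algebraType (range ray).
have mid : measurable_fun [set: T1] (fun x : T1 => (x : d.-tuple R)).
  apply/measurable_fun_tnthP => i.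
  have := @measurability _ _ T1 RL setT (fun x => tnth x i) _ (RGenInftyO.measurableE R).
  apply => _ [_ [c ->] <-]; rewrite setTI.
  (* A half-line condition on one coordinate is the increasing union of orthants whose other bounds
     k tend to infinity. *)
  rewrite (_ : _ @^-1` _ =
    \bigcup_(k : nat) ray (fun j => if j == i then c else k%:R)); last first.
    apply/seteqP; split => [x xc|x [k _ /rayE/(_ i)]]; last first.
      by rewrite eqxx => xc; rewrite /= in_itv.
    have {}xc : tnth x i < c by move: xc; rewrite /= in_itv.
    have [k xk] := exists_nat_gt_tnth x.
    by exists k => //; apply/rayE => j; case: eqP => [->|_].
  apply: bigcup_measurable => k _; apply: sub_sigma_algebra; by eexists.
by move=> A mA; have := mid measurableT A mA; rewrite setTI.
Qed.

Lemma measure_unique_rays (m1 m2 : {measure set (d.-tuple R) -> \bar R}) :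
  (forall b, m1 (ray b) = m2 (ray b)) -> (forall b, m1 (ray b) < +oo)%E ->
  forall A, measurable A -> m1 A = m2 A.
Proof.
move=> h hoo; apply: (measure_unique (range ray) (fun k : nat => ray (fun=> k%:R))).
- exact: measurable_rays.
- move=> _ _ [b _ <-] [c _ <-]; exists (fun j => Num.min (b j) (c j)) => //.
  apply/seteqP; split => [x /rayE xbc|x [/rayE xb /rayE xc]].
    by split; apply/rayE => j; have := xbc j; rewrite lt_min => /andP[].
  by apply/rayE => j; rewrite lt_min xb xc.
- by move=> k; eexists.
- apply/seteqP; split => // x _; have [k xk] := exists_nat_gt_tnth x.
  by exists k => //; apply/rayE.
- by move=> _ [b _ <-].
- by move=> k; exact: hoo.
Qed.

Lemma cvg_rV (u : nat -> 'rV[R]_d) (l : 'rV[R]_d) :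
  (forall j, u n 0 j @[n --> \oo] --> l 0 j) -> u n @[n --> \oo] --> l.
Proof.
move=> ul; apply/cvgrPdist_lt => e e0.
have H : \forall n \near \oo, forall j, `|l 0 j - u n 0 j| < e.
  by apply: filter_forall => j; move/cvgrPdist_lt : (ul j); exact.
apply: filterS H => n ln; rewrite [ltLHS]mx_normrE.
apply/bigmax_ltP; split => //= -[i j] _; rewrite !mxE /=.
by rewrite (ord1 i) ln.
Qed.

(* Continuous functions are limits of functions of the coordinates rounded to
   multiples of [1 / (n + 1)], which take countably many values. *)
Lemma measurable_continuous_rV (phi : 'rV[R]_d -> R) : continuous phi ->
  measurable_fun [set: d.-tuple R] (fun x => phi (\row_j tnth x j)).
Proof.
move=> cphi.
pose fl n (x : d.-tuple R) : d.-tuple int :=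
  [tuple Num.Def.floor (tnth x j * n.+1%:R) | j < d].
pose rd n (z : d.-tuple int) : 'rV[R]_d := \row_j ((tnth z j)%:~R / n.+1%:R).
apply: (@measurable_fun_cvg _ _ _ _ (fun n x => phi (rd n (fl n x)))).
- move=> n _ V mV; rewrite setTI.
  (* The integer tuples are enumerated through [unpickle]; a code of no tuple contributes the empty
     set. *)
  pose F (k : nat) : set (d.-tuple R) :=
    if unpickle k is Some z then [set x | V (phi (rd n z)) /\ fl n x = z] else set0.
  rewrite (_ : _ @^-1` _ = \bigcup_k F k); last first.
    apply/seteqP; split => [x /= Vx|x [k _]].
      by exists (pickle (fl n x)) => //; rewrite /F pickleK.
    by rewrite /F; case: unpickle => // z [Vz flx]; rewrite -flx in Vz.
  apply: bigcup_measurable => k _; rewrite /F; case: unpickle => // z.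
  have [Vz|nVz] := pselect (V (phi (rd n z))); last first.
    by rewrite (_ : [set x | _] = set0)//; apply/seteqP; split => // x [].
  rewrite (_ : [set x | _] = [set x | forall j,
    `[(tnth z j)%:~R / n.+1%:R, (tnth z j + 1)%:~R / n.+1%:R[%classic (tnth x j)]).
    exact: (measurable_tuple_box (B := fun j => `[(tnth z j)%:~R / n.+1%:R,
      (tnth z j + 1)%:~R / n.+1%:R[%classic) (fun=> measurable_itv _)).
  have fE (x : d.-tuple R) j : (Num.Def.floor (tnth x j * n.+1%:R) == tnth z j) =
      (tnth x j \in `[(tnth z j)%:~R / n.+1%:R, (tnth z j + 1)%:~R / n.+1%:R[).
    by apply: etrans (floor_eq _ _) _; rewrite in_itv/= ler_pdivrMr// ltr_pdivlMr.
  apply/seteqP; split => [x [_ flx] j|x xz].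
    have zj : tnth z j = Num.Def.floor (tnth x j * n.+1%:R) by rewrite -flx tnth_mktuple.
    by have := fE x j; rewrite -zj eqxx => /esym.
  split => //; apply: eq_from_tnth => j; rewrite tnth_mktuple; apply/eqP.
  by rewrite fE; exact: xz.
- move=> x _; apply: continuous_cvg; first exact: cphi.
  apply: cvg_rV => j; rewrite !mxE.
  apply/cvgrPdist_le => e e0; have := @cvg_harmonic R.
  move=> /cvgrPdist_lt/(_ _ e0); apply: filterS => n.
  have h0 : 0 < harmonic n :> R by rewrite /harmonic invr_gt0.
  rewrite sub0r normrN gtr0_norm// => /ltW ne.
  rewrite !mxE tnth_mktuple; apply: le_trans ne; rewrite /harmonic /=.
  have := floor_itv (tnth x j * n.+1%:R); set z := (_)%:~R; rewrite intrD => /andP[z1 z2].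
  rewrite (_ : _ - _ = (tnth x j * n.+1%:R - z) / n.+1%:R); last first.
    by field.
  rewrite normf_div [X in _ / X]ger0_norm// ler_pdivrMr// mulVf//.
  by rewrite ger0_norm ?subr_ge0// lerBlDl ltW.
Qed.

End tuple_topology.

(** * Cauchy masses as functions of the scale *)

Section cauchy_mass.
Context {R : realType}.
Notation mu := (@lebesgue_measure R).
Notation RL := (measurableTypeR R).
Notation pos := (`]0%R, +oo[%classic : set (measurableTypeR R)).

(** Dominates the density for scales near s. The numerator costs 2 and the denominator 4, since s^2
    + x^2 <= 4 (u^2 + x^2). *)
Lemma cauchy_density_near (s u x : R) : 0 < s -> s / 2 < u < 2 * s ->
  cauchy_density u x <= 8 * cauchy_density s x.
Proof.
move=> s0 /andP[su us]; have u0 : 0 < u by lra.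
rewrite !cauchy_densityE [leRHS]mulrCA ler_pM2l ?invr_gt0 ?pi_gt0// /pker.
rewrite [leRHS](_ : _ = (2 * s) * (4 * (s ^+ 2 + x ^+ 2)^-1)); last by ring.
have A := sqrD_gt0 x u0; have B := sqrD_gt0 x s0.
apply: ler_pM; [exact: ltW|by rewrite invr_ge0 ltW|exact: ltW|].
rewrite -ler_pdivrMl// -invfM lef_pV2 ?posrE ?mulr_gt0//.
have : s ^+ 2 <= (2 * u) ^+ 2 by rewrite ler_sqr ?nnegrE//; lra.
by have := sqr_ge0 x; lra.
Qed.

Lemma integrable_cauchy_density (s : R) (B : set RL) : 0 < s -> measurable B ->
  mu.-integrable B (EFin \o cauchy_density s).
Proof.
move=> s0 mB; apply: (@integrableS _ _ _ mu setT) => //.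
apply/integrableP; split.
  by apply/measurable_EFinP; exact: measurable_cauchy_density.
under eq_integral do rewrite /= ger0_norm ?cauchy_density_ge0//.
by rewrite integral_cauchy_density// ltry.
Qed.

Definition massr (B : set RL) (s : R) : R := \int[mu]_(x in B) cauchy_density s x.

Lemma cauchy_massE (B : set RL) (s : R) : 0 < s -> measurable B ->
  cauchy_mass B s = (massr B s)%:E.
Proof.
by move=> s0 mB; rewrite /massr EFin_Rintegral//; exact: integrable_cauchy_density.
Qed.

Lemma massr_ge0 (B : set RL) (s : R) : 0 < s -> 0 <= massr B s.
Proof.
by move=> s0; apply: Rintegral_ge0 => x _; exact: cauchy_density_ge0.
Qed.

Lemma massr_le1 (B : set RL) (s : R) : 0 < s -> measurable B -> massr B s <= 1.
Proof.
move=> s0 mB; rewrite -lee_fin -cauchy_massE// -(integral_cauchy_density s0).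
apply: ge0_subset_integral => //.
- by apply/measurable_EFinP; exact: measurable_cauchy_density.
- by move=> x _; rewrite lee_fin cauchy_density_ge0.
Qed.

Lemma continuous_massr (B : set RL) (s : R) : 0 < s -> measurable B ->
  {for s, continuous (massr B)}.
Proof.
move=> s0 mB.
have Is : s \in (`]s / 2, 2 * s[%classic : set R).
  by rewrite inE/= in_itv/=; apply/andP; split; lra.
have Ipos u : `]s / 2, 2 * s[%classic u -> s / 2 < u < 2 * s /\ 0 < u.
  by rewrite /= in_itv/= => h; split => //; case/andP: h; lra.
apply: (@continuity_under_integral _ _ RL mu cauchy_density B mB (s / 2) (2 * s) _ _
  (fun x => 8 * cauchy_density s x)) => //.
- by move=> u /Ipos[_ u0]; exact: integrable_cauchy_density.
- apply: aeW => x _ u; rewrite inE => /Ipos[_ u0].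
  rewrite (_ : cauchy_density ^~ x = fun v => pi^-1 * pker v x); last first.
    by apply/funext => v; rewrite cauchy_densityE.
  apply: cvgM; first exact: cvg_cst.
  exact: is_derive_continuous (is_derive_pker_s x u0).
- by apply: integrable_EFinZl => //; exact: integrable_cauchy_density.
- move=> u /Ipos[us u0]; apply: aeW => x _.
  by rewrite ger0_norm ?cauchy_density_ge0// cauchy_density_near.
Qed.

Variable d : nat.
Variable B : 'I_d -> set RL.
Hypothesis mB : forall j, measurable (B j).

Definition box_mass (s : R) : R := \prod_(j < d) massr (B j) s.

Lemma box_massE (s : R) : 0 < s ->
  (\prod_(j < d) cauchy_mass (B j) s)%E = (box_mass s)%:E.
Proof.
move=> s0; rewrite /box_mass; elim/big_rec2: _ => // j x y _ ->.
by rewrite cauchy_massE// EFinM.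
Qed.

Lemma box_mass_ge0 (s : R) : 0 < s -> 0 <= box_mass s.
Proof. by move=> s0; apply: prodr_ge0 => j _; exact: massr_ge0. Qed.

Lemma box_mass_le1 (s : R) : 0 < s -> box_mass s <= 1.
Proof.
move=> s0; apply: prodr_ile1 => j _.
by rewrite massr_ge0// massr_le1.
Qed.

Lemma continuous_box_mass (s : R) : 0 < s -> {for s, continuous box_mass}.
Proof.
move=> s0; rewrite /box_mass; elim: (index_enum _) => [|j r IH].
  rewrite (_ : (fun s => _) = cst 1); first exact: cvg_cst.
  by apply/funext => z; rewrite big_nil.
rewrite (_ : (fun s => _) = (fun s => massr (B j) s * \prod_(i <- r) massr (B i) s)).
  by apply: cvgM; [exact: continuous_massr|exact: IH].
by apply/funext => z; rewrite big_cons.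
Qed.

Lemma measurable_box_mass : measurable_fun [set: RL] (box_mass \_ pos).
Proof.
have mpos : measurable pos by exact: measurable_itv.
apply/(measurable_restrictT _ mpos).
have : measurable_fun (`]0, +oo[%classic : set R) box_mass.
  apply: open_continuous_measurable_fun; first exact: interval_open.
  by move=> s; rewrite inE => /pos_gt0 s0; exact: continuous_box_mass.
exact.
Qed.

End cauchy_mass.

(** * Measurability along a countable partition *)

Section partition.
Context d d' (T : measurableType d) (T' : measurableType d').

(** Serves for a process sampled at a random time with countably many values: on each cell the time
    is fixed, and measurability at fixed times is enough. *)
Lemma measurable_fun_countable_partition (E : nat -> set T) (h : nat -> T -> T')
    (f : T -> T') : (forall k, measurable (E k)) -> \bigcup_k E k = setT ->
  (forall k, measurable_fun setT (h k)) -> (forall k w, E k w -> f w = h k w) ->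
  measurable_fun setT f.
Proof.
move=> mE cE mh fh _ V mV; rewrite setTI.
rewrite (_ : _ @^-1` _ = \bigcup_k (E k `&` h k @^-1` V)).
  apply: bigcup_measurable => k _; apply: measurableI => //.
  by have := mh k measurableT V mV; rewrite setTI.
apply/seteqP; split => [w /= Vf|w [k _ [Ek]]] /=.
  have [k _ Ek] : (\bigcup_k E k) w by rewrite cE.
  by exists k => //; split => //=; rewrite -(fh k).
by rewrite -(fh k).
Qed.

End partition.

(** * Marginal laws of a Cauchy process *)

Section marginal.
Context {R : realType} {dsp : measure_display} {T : measurableType dsp}.
Variable P : probability T R.
Notation RL := (measurableTypeR R).

Lemma RV_measurable (X : {RV P >-> R}) : measurable_fun setT (X : T -> RL).
Proof.
have mX : measurable_fun setT (X : T -> R) by exact: measurable_funP.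
exact: mX.
Qed.

Lemma RV_preimage (X : {RV P >-> R}) (B : set RL) : measurable B ->
  measurable (X @^-1` B).
Proof. by move=> mB; have := RV_measurable X measurableT mB; rewrite setTI. Qed.

Lemma cauchy_marginal (X : R -> {RV P >-> R}) (s : R) (B : set RL) :
  standard_cauchy_process X -> 0 < s -> measurable B ->
  P (X s @^-1` B) = cauchy_mass B s.
Proof.
move=> [X0 _ incr _] s0 mB.
rewrite /cauchy_mass -[s in RHS]subr0 -(incr 0 s B)//.
apply: ae_eq_measure.
- exact: RV_preimage.
- have mXB : measurable_fun setT (fun w => X s w - X 0 w : RL).
    by apply: measurable_funB; exact: RV_measurable.
  by have := mXB measurableT B mB; rewrite setTI.
- by apply: filterS X0 => w Xw /=; rewrite Xw subr0.
Qed.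

Lemma big_option_EFin (I : finType) (F : option I -> \bar R) :
  (\prod_i F i = F None * \prod_(i : I) F (Some i))%E.
Proof.
rewrite (bigD1 None)//=; congr (_ * _)%E.
rewrite (reindex_omap Some id)/=; last by case.
by apply: eq_bigl => i; rewrite eqxx.
Qed.

End marginal.

(** * Sampling at grid times approaching |C(t)| from above *)

Section sampling.
Context {R : realType} {dsp : measure_display} {T : measurableType dsp}.
Variables (P : probability T R) (d : nat).
Variables (C : 'I_d -> R -> {RV P >-> R}) (C0 : R -> {RV P >-> R}).
Hypothesis cauchyC : forall j, standard_cauchy_process (C j).
Hypothesis cauchyC0 : standard_cauchy_process C0.
Hypothesis indep : mutually_independent P
  (with_last (fun j s => C j s : T -> R) (fun s => C0 s : T -> R)).
Variable t : R.
Hypothesis t0 : 0 < t.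
Notation mu := (@lebesgue_measure R).
Notation RL := (measurableTypeR R).
Notation pos := (`]0%R, +oo[%classic : set (measurableTypeR R)).

Let mpos : measurable pos. Proof. exact: measurable_itv. Qed.

Let tau w : R := `|C0 t w|.

Let tm n k : R := k.+1%:R / n.+1%:R.

(* Rounding strictly upwards, so that right-continuity of the paths applies along
   these countably many times. *)
Definition grid_time n w : R := tm n (Num.truncn (tau w * n.+1%:R)).

Let tm_gt0 n k : 0 < tm n k. Proof. by rewrite divr_gt0. Qed.

Lemma grid_time_gt n w : tau w < grid_time n w.
Proof. by rewrite ltr_pdivlMr// truncnS_gt. Qed.

Lemma grid_time_le n w : grid_time n w <= tau w + n.+1%:R^-1.
Proof.
rewrite ler_pdivrMr// mulrDl mulVf// -natr1 lerD2r.
by rewrite truncn_le mulr_ge0// normr_ge0.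
Qed.

Lemma cvg_grid_time w : grid_time n w @[n --> \oo] --> tau w.
Proof.
apply/cvgrPdist_le => e e0; have := @cvg_harmonic R.
move=> /cvgrPdist_lt/(_ _ e0); apply: filterS => n.
have h0 : 0 < harmonic n :> R by rewrite /harmonic invr_gt0.
rewrite sub0r normrN gtr0_norm// => /ltW ne.
rewrite distrC ger0_norm ?subr_ge0 ?(ltW (grid_time_gt _ _))//.
by rewrite lerBlDl (le_trans (grid_time_le n w))// lerD2l.
Qed.

Let D n k : set RL := [set u | Num.truncn (`|u| * n.+1%:R) = k].

Let mD n k : measurable (D n k).
Proof.
rewrite (_ : D n k = (fun u : RL => `|u| : R) @^-1` `[k%:R / n.+1%:R, k.+1%:R / n.+1%:R[).
  rewrite -[X in measurable X]setTI.
  have : measurable_fun [set: RL] (fun u : RL => `|u| : R).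
    exact: normr_measurable.
  by apply => //; exact: measurable_itv.
apply/seteqP; split => u; rewrite /D /= in_itv/=;
  rewrite ler_pdivrMr// ltr_pdivlMr// -truncn_eq ?mulr_ge0// => /eqP //.
Qed.

Let E n k : set T := C0 t @^-1` D n k.

Let mE n k : measurable (E n k). Proof. exact: RV_preimage. Qed.

Let EP n k w : E n k w <-> Num.truncn (tau w * n.+1%:R) = k. Proof. by []. Qed.

Let E_cover n : \bigcup_k E n k = setT.
Proof.
by apply/seteqP; split => // w _; exists (Num.truncn (tau w * n.+1%:R)).
Qed.

Let E_triv n : trivIset setT (E n).
Proof. by move=> i j _ _ [w [/EP <- /EP <-]]. Qed.

Lemma measurable_grid_sample n j :
  measurable_fun setT (fun w => C j (grid_time n w) w : RL).
Proof.
apply: (measurable_fun_countable_partition (h := fun k w => C j (tm n k) w)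
  (mE n) (E_cover n)).
- by move=> k; exact: RV_measurable.
- by move=> k w /EP wk; rewrite /grid_time wk.
Qed.

Definition sample_event n (B : 'I_d -> set RL) : set T :=
  [set w | forall j, B j (C j (grid_time n w) w)].

Variable B : 'I_d -> set RL.
Hypothesis mB : forall j, measurable (B j).

Lemma measurable_sample_event n : measurable (sample_event n B).
Proof.
rewrite (_ : sample_event n B =
    \bigcap_(j in setT) ((fun w => C j (grid_time n w) w) @^-1` B j)).
  apply: fin_bigcap_measurable => // j _; rewrite -[X in measurable X]setTI.
  by apply: measurable_grid_sample.
by apply/seteqP; split => [w h j _|w h j]; [exact: h|exact: h].
Qed.

(** On the cell the sampling time is the constant [tm n k], and the cell itself is an event of the
    last process alone, so the product rule applies with one event per process. *)
Lemma sample_event_cell n k :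
  P (sample_event n B `&` E n k) = (P (E n k) * (box_mass B (tm n k))%:E)%E.
Proof.
pose F (i : option 'I_d) : set T :=
  if i is Some j then C j (tm n k) @^-1` B j else E n k.
have -> : sample_event n B `&` E n k = \bigcap_i F i.
  apply/seteqP; split => [w [Bw Ew] [j|] _ //|w Fw].
    by have := Bw j; rewrite /grid_time (EP n k w).1.
  have Ew : E n k w := Fw None I.
  by split => // j; rewrite /grid_time ((EP n k w).1 Ew); exact: (Fw (Some j) I).
rewrite indep; last first.
  move=> [j|]; apply: sub_sigma_algebra.
    by exists (tm n k), (B j); split => //; [exact: ltW|exact: mB].
  by exists t, (D n k); split => //; [exact: ltW|exact: mD].
rewrite big_option_EFin; congr (_ * _)%E.
rewrite -box_massE//; apply: eq_bigr => j _.
exact: cauchy_marginal.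
Qed.

Let G : RL -> R := box_mass B \_ pos.

Let GE s : 0 < s -> G s = box_mass B s.
Proof. by move=> s0; rewrite /G patchE mem_set//= in_itv/= s0. Qed.

Let G0 s : ~ (0 < s) -> G s = 0.
Proof. by move=> s0; rewrite /G patchE memNset//= in_itv/= andbT. Qed.

Let G_ge0 s : 0 <= G s.
Proof.
by have [s0|s0] := pselect (0 < s); [rewrite GE// box_mass_ge0|rewrite G0].
Qed.

Let G_le1 s : G s <= 1.
Proof.
by have [s0|s0] := pselect (0 < s); [rewrite GE// box_mass_le1|rewrite G0].
Qed.

Let mG : measurable_fun [set: RL] G. Proof. exact: measurable_box_mass. Qed.

Let mG_grid n : measurable_fun setT (fun w => (G (grid_time n w))%:E).
Proof.
apply: (measurable_fun_countable_partition (h := fun k w => (G (tm n k))%:E)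
  (mE n) (E_cover n)) => // k w /EP wk.
by rewrite /grid_time wk.
Qed.

Lemma sample_event_integral n :
  P (sample_event n B) = (\int[P]_w (G (grid_time n w))%:E)%E.
Proof.
have -> : P (sample_event n B) = (\sum_(k <oo) P (sample_event n B `&` E n k))%E.
  rewrite (@eq_eseriesl _ _ (fun k => k \in [set: nat])); last first.
    by move=> k; rewrite in_setT.
  rewrite -measure_bigcup//.
  - by rewrite -setI_bigcupr E_cover setIT.
  - by move=> k _; apply: measurableI => //; exact: measurable_sample_event.
  - exact: trivIset_setIl.
rewrite -(E_cover n) ge0_integral_bigcup//; last 2 first.
- exact: measurable_funTS.
- by move=> w _; rewrite lee_fin.
apply: eq_eseriesr => k _; rewrite sample_event_cell -GE//.
rewrite (eq_integral (fun=> (G (tm n k))%:E)); last first.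
  by move=> w; rewrite inE => /EP wk; rewrite /grid_time wk.
by rewrite integral_cst// muleC.
Qed.

(** The masses are continuous only at positive scales, so time 0 has to be excluded before passing
    to the limit in the grid. *)
Lemma tau_gt0_ae : {ae P, forall w, 0 < tau w}.
Proof.
exists (C0 t @^-1` [set 0]); split.
- by apply: RV_preimage; exact: measurable_set1.
- have m0 : measurable ([set 0] : set RL) by exact: measurable_set1.
  rewrite (cauchy_marginal cauchyC0 t0 m0).
  by rewrite /cauchy_mass integral_set1.
- move=> w /= h; apply: contrapT => /eqP w0; apply: h.
  by rewrite /tau normr_gt0.
Qed.

(** The law of [C0 t] has an even density; folding the negative half-line produces the factor 2 in
    the density of |C(t)|. *)
Lemma integral_G_tau : (\int[P]_w (G (tau w))%:E =
  \int[lebesgue_tuple d]_(x in [set x | forall j, B j (tnth x j)]) (p_CC x t)%:E)%E.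
Proof.
rewrite p_CC_box//.
pose X : {RV P >-> RL} := HB.pack (C0 t : T -> RL)
  (isMeasurableFun.Build _ _ T RL (C0 t : T -> RL) (RV_measurable (C0 t))).
have mn : measurable_fun [set: RL] (fun u : RL => `|u| : RL).
  exact: normr_measurable.
have mGn : measurable_fun [set: RL] (fun u => (G `|u|)%:E).
  by apply/measurable_EFinP; apply: measurableT_comp mG mn.
transitivity (\int[distribution P X]_u (G `|u|)%:E)%E.
  by rewrite ge0_integral_distribution// => u; rewrite lee_fin.
have distE A : measurable A ->
    distribution P X A = (\int[mu]_(u in A) (cauchy_density t u)%:E)%E.
  by move=> mA; exact: (cauchy_marginal cauchyC0 t0 mA).
have iG : (distribution P X).-integrable setT (fun u => (G `|u|)%:E).
  apply/integrableP; split => //.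
  apply: (@le_lt_trans _ _ (\int[distribution P X]_u 1)%E).
    apply: ge0_le_integral => //; first exact: measurableT_comp.
    by move=> u _; rewrite /= lee_fin ger0_norm.
  by rewrite integral_cst// mul1e [ltLHS]probability_setT ltry.
have mc : measurable_fun [set: RL] (cauchy_density t) by exact: measurable_cauchy_density.
rewrite (integral_density mc distE iG).
have mf : measurable_fun [set: RL] (fun u => (G `|u|)%:E * (cauchy_density t u)%:E)%E.
  by apply: emeasurable_funM => //; exact/measurable_EFinP.
have f0 u : (0 <= (G `|u|)%:E * (cauchy_density t u)%:E)%E.
  by rewrite mule_ge0// lee_fin ?cauchy_density_ge0.
rewrite ge0_integral_even//; last first.
  by move=> u; rewrite normrN /cauchy_density sqrrN.
rewrite -ge0_integralD//; try exact: measurable_funTS.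
apply: eq_integral => s; rewrite inE => /pos_gt0 s0.
rewrite gtr0_norm// GE// box_massE// -!EFinM -EFinD; congr EFin; ring.
Qed.

Lemma cvg_sample_event : P (sample_event n B) @[n --> \oo] -->
  (\int[lebesgue_tuple d]_(x in [set x | forall j, B j (tnth x j)]) (p_CC x t)%:E)%E.
Proof.
rewrite -integral_G_tau.
under eq_cvg do rewrite sample_event_integral.
have mtau : measurable_fun setT (tau : T -> RL).
  by apply: (@measurableT_comp _ _ _ _ _ _ (fun u : RL => `|u| : RL)) => //;
    [exact: normr_measurable|exact: RV_measurable].
have mf : measurable_fun setT (fun w => (G (tau w))%:E).
  by apply/measurable_EFinP; apply: measurableT_comp mG mtau.
have cf : {ae P, forall w, setT w -> (G (grid_time n w))%:E @[n --> \oo] --> (G (tau w))%:E}.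
  apply: filterS tau_gt0_ae => w w0 _.
  have h : G (grid_time n w) @[n --> \oo] --> G (tau w).
    rewrite GE// (_ : (fun n => G _) = (fun n => box_mass B (grid_time n w))).
      apply: continuous_cvg; first exact: continuous_box_mass.
      exact: cvg_grid_time.
    by apply/funext => n; apply: GE; exact: tm_gt0.
  by apply: cvg_EFin; [exact: nearW|exact: h].
have i1 : P.-integrable setT (fun=> 1%E : \bar R).
  exact: finite_measure_integrable_cst.
have b1 : {ae P, forall w n, setT w -> (`|(G (grid_time n w))%:E| <= 1)%E}.
  by apply: aeW => w n _; rewrite lee_fin ger0_norm.
by have [_ _] := @dominated_convergence _ _ _ P _ measurableT _ _ _ mG_grid mf cf i1 b1.
Qed.

End sampling.

(** * Law of the subordinated vector and its limit at time 0 *)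

Section subordination.
Context {R : realType} {dsp : measure_display} {T : measurableType dsp}.
Variables (P : probability T R) (d : nat).
Variables (C : 'I_d -> R -> {RV P >-> R}) (C0 : R -> {RV P >-> R}).
Hypothesis cauchyC : forall j, standard_cauchy_process (C j).
Hypothesis cauchyC0 : standard_cauchy_process C0.
Hypothesis indep : mutually_independent P
  (with_last (fun j s => C j s : T -> R) (fun s => C0 s : T -> R)).
Notation RL := (measurableTypeR R).

Let J t w := J_CC (fun j s => C j s : T -> R) (fun s => C0 s : T -> R) t w.

Lemma cadlag_ae : {ae P, forall w j, cadlag (fun s => C j s w)}.
Proof. by apply: filter_forall => j; have [] := cauchyC j. Qed.

(** The grid times lie strictly above |C(t)|, so right-continuity makes [J] the almost sure limit of
    measurable samples, which gives it a measurable version. *)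
Lemma sampled_limit (t : R) : exists Y : {RV P >-> d.-tuple R},
  {ae P, forall w, J t w = Y w} /\
  {ae P, forall w j, C j (grid_time C0 t n w) w @[n --> \oo] --> tnth (Y w) j}.
Proof.
have [N [mN N0 subN]] := cadlag_ae.
have cad w : ~ N w -> forall j, cadlag (fun s => C j s w).
  by move=> Nw; apply: contrapT => h; apply: Nw; exact: subN.
have mNC : measurable (~` N) by exact: measurableC.
(* Limit and samples get the same default value on the null set [N], so that convergence holds
   everywhere and measurability passes to the limit. *)
pose Yj j : T -> R := (fun w => C j `|C0 t w| w) \_ (~` N).
pose Zj n j : T -> R := (fun w => C j (grid_time C0 t n w) w) \_ (~` N).
have mZ n j : measurable_fun setT (Zj n j).
  apply/(measurable_restrictT _ mNC); apply: measurable_funTS.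
  exact: measurable_grid_sample.
have cY w j : ~ N w -> C j (grid_time C0 t n w) w @[n --> \oo] --> C j `|C0 t w| w.
  move=> Nw; have [rc _] := cad w Nw j.
  have /cvg_at_rightP := rc `|C0 t w| (normr_ge0 _); apply; split.
    by move=> n; exact: grid_time_gt.
  exact: cvg_grid_time.
have mY j : measurable_fun setT (Yj j).
  apply: (@measurable_fun_cvg _ _ _ _ (fun n => Zj n j)) => // w _.
  rewrite /Zj /Yj patchE; case: ifPn => [|wN].
    rewrite inE => Nw; rewrite (_ : (fun n => _) = (fun n => C j (grid_time C0 t n w) w)).
      exact: cY.
    by apply/funext => n; rewrite patchE mem_set.
  rewrite (_ : (fun n => _) = cst point); first exact: cvg_cst.
  by apply/funext => n; rewrite patchE (negbTE wN).
pose Yf w : d.-tuple R := [tuple Yj j w | j < d].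
have mYf : measurable_fun setT Yf.
  apply/measurable_fun_tnthP => j.
  rewrite (_ : _ \o _ = Yj j); first exact: mY.
  by apply/funext => w /=; rewrite tnth_mktuple.
pose Y : {RV P >-> d.-tuple R} := HB.pack Yf (isMeasurableFun.Build _ _ _ _ Yf mYf).
have YE w j : ~ N w -> tnth (Y w) j = C j `|C0 t w| w.
  by move=> Nw; rewrite tnth_mktuple /Yj patchE mem_set.
have aeN : {ae P, forall w, ~ N w}.
  by exists N; split => // w /contrapT.
exists Y; split; apply: filterS aeN => w Nw.
- by apply: eq_from_tnth => j; rewrite YE// tnth_mktuple.
- by move=> j; rewrite YE//; exact: cY.
Qed.

Section fixed_time.
Variable t : R.
Hypothesis t0 : 0 < t.

Let law : {measure set (d.-tuple R) -> \bar R} := density_measure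
  (lebesgue_tuple d) (measurable_p_CC (d := d) t0) (fun x => p_CC_ge0 t0 x).

Let rays (b : 'I_d -> R) j : set RL := `]-oo, b j[%classic.

Let cvg_law b : P (sample_event C C0 t n (rays b)) @[n --> \oo] --> law (ray b).
Proof.
apply: cvg_sample_event => // j; exact: measurable_itv.
Qed.

Let law_lty b : (law (ray b) < +oo)%E.
Proof.
apply: (@le_lt_trans _ _ (law setT)).
  by apply: le_measure; rewrite ?inE//; exact: measurable_ray.
by rewrite [ltLHS](p_CC_total d t0) ltry.
Qed.

Let law_fin b : law (ray b) \is a fin_num.
Proof. by rewrite ge0_fin_numE. Qed.

Let mS n b : measurable (sample_event C C0 t n (rays b)).
Proof. by apply: measurable_sample_event => j; exact: measurable_itv. Qed.

(** A portmanteau argument: a strict inequality for the limit holds eventually for the samples, so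
    Fatou bounds the probability of an open orthant from above, and that of its complement at the
    cost of a slightly smaller orthant. *)
Lemma law_of_limit (Y : {RV P >-> d.-tuple R}) :
  {ae P, forall w j, C j (grid_time C0 t n w) w @[n --> \oo] --> tnth (Y w) j} ->
  forall A, measurable A -> distribution P Y A = law A.
Proof.
move=> cY; have mU b : measurable (Y @^-1` ray b).
  by rewrite -[X in measurable X]setTI; apply: measurable_funP => //; exact: measurable_ray.
have le_law b : (P (Y @^-1` ray b) <= law (ray b))%E.
  have lim_le := measure_liminf_le (fun n => mS n b) (@cvg_law b).
  apply: (le_trans _ lim_le).
  apply: ae_le_measure => //.
    by apply: bigcup_measurable => m _; apply: bigcap_measurableType.
  apply: filterS cY => w cw /rayE Yb.
  have [m _ hm] : \forall n \near \oo, forall j, C j (grid_time C0 t n w) w < b j.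
    by apply: filter_forall => j; apply: cvgr_lt (cw j) _ (Yb j).
  exists m => // n /= mn j; rewrite /rays /= in_itv/=; exact: hm.
(* Outside the orthant some coordinate satisfies only b_j <= Y_j, which does not pass to the
   samples; the gap c_j < b_j makes it strict. *)
have law_le b c : (forall j, c j < b j) -> (law (ray c) <= P (Y @^-1` ray b))%E.
  move=> cb.
  have mSC n : measurable (~` sample_event C C0 t n (rays c)) by exact: measurableC.
  have cvgC : P (~` sample_event C C0 t n (rays c)) @[n --> \oo] --> (1 - law (ray c))%E.
    under eq_cvg do rewrite probability_setC//.
    apply: cvgeB => //; last exact: cvg_cst.
  have le1 : (P (~` (Y @^-1` ray b)) <= 1 - law (ray c))%E.
    have lim_le := measure_liminf_le mSC cvgC.
    apply: (le_trans _ lim_le).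
    apply: ae_le_measure; first exact: measurableC.
      by apply: bigcup_measurable => m _; apply: bigcap_measurableType.
    apply: filterS cY => w cw nYb.
    have [j Yj] : exists j, b j <= tnth (Y w) j.
      apply: contrapT => h; apply: nYb; apply/rayE => j; rewrite ltNge; apply/negP => bj.
      by apply: h; exists j.
    have [m _ hm] : \forall n \near \oo, c j < C j (grid_time C0 t n w) w.
      by apply: cvgr_gt (cw j) _ (lt_le_trans (cb j) Yj).
    exists m => // n /= mn h; have := h j; rewrite /rays /= in_itv/=.
    by have /= cj := hm n mn; rewrite ltNge (ltW cj).
  move: le1; rewrite probability_setC//.
  have fP : P (Y @^-1` ray b) \is a fin_num by exact: fin_num_measure.
  rewrite -(fineK fP) -(fineK (law_fin c)) -!EFinB !lee_fin; lra.
apply: measure_unique_rays => b; last first.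
  by rewrite (le_lt_trans (probability_le1 _ (measurable_ray b)))// ltry.
apply/eqP; rewrite eq_le le_law /=.
(* The shrunken orthants increase to the open orthant, which removes the gap. *)
pose c k j : R := b j - k.+1%:R^-1.
have rb : ray b = \bigcup_k ray (c k).
  apply/seteqP; split => [x /rayE xb|x [k _ /rayE xc]]; last first.
    by apply/rayE => j; rewrite (lt_trans (xc j))// /c ltrBlDr ltrDl.
  have [k _ hk] : \forall k \near \oo, forall j, harmonic k < b j - tnth x j.
    by apply: filter_forall => j; apply: cvgr_lt (@cvg_harmonic R) _ _; rewrite subr_gt0.
  exists k => //; apply/rayE => j; rewrite /c ltrBrDl -ltrBrDr.
  by apply: hk => /=.
have ndc : nondecreasing_seq (fun k => ray (c k)).
  move=> k l kl; apply/subsetPset => x /rayE xc; apply/rayE => j.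
  rewrite (lt_le_trans (xc j))// /c lerD2l lerN2 lef_pV2 ?posrE//.
  by rewrite ler_nat ltnS.
have cvc := nondecreasing_cvg_mu (mu := law) (fun k => measurable_ray (c k))
  (bigcup_measurable (fun k _ => measurable_ray (c k))) ndc.
rewrite {1}rb; apply: (lee_cvg_to cvc (cvg_cst (P (Y @^-1` ray b)))).
apply: nearW => k; apply: law_le => j.
by rewrite /c ltrBlDr ltrDl.
Qed.

End fixed_time.

Lemma has_density_J_CC (t : R) : 0 < t -> has_density P (J t) (fun x => p_CC x t).
Proof.
move=> t0; have [Y [JY cY]] := sampled_limit t.
by exists Y; split => // B mB; exact: (law_of_limit t0 cY mB).
Qed.

Lemma initial_delta_p_CC : initial_delta (@p_CC R d).
Proof.
(* Along a sequence of times only countably many measurable versions [Y n] occur, so their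
   exceptional events form one null set. *)
move=> phi cphi [M phiM]; apply/cvg_at_rightP => u [u0 ucvg].
have /choice[Y HY] : forall n, exists Y : {RV P >-> d.-tuple R},
    {ae P, forall w, J (u n) w = Y w} /\
    forall A, measurable A -> distribution P Y A =
      (\int[lebesgue_tuple d]_(x in A) (p_CC x (u n))%:E)%E.
  by move=> n; exact: has_density_J_CC.
pose psi (x : d.-tuple R) : R := phi (\row_j tnth x j).
have mpsi : measurable_fun setT psi by exact: measurable_continuous_rV.
have mpsiY n : measurable_fun setT (fun w => (psi (Y n w))%:E).
  by apply/measurable_EFinP; apply: measurableT_comp mpsi _; exact: measurable_funP.
have iM d' (T' : measurableType d') (m : probability T' R) :
    m.-integrable setT (fun=> M%:E : \bar R).
  exact: finite_measure_integrable_cst.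
have lawE n : \int[lebesgue_tuple d]_x (psi x * p_CC x (u n)) =
    \int[P]_w psi (Y n w).
  rewrite /Rintegral; congr fine.
  have ipsi : (distribution P (Y n)).-integrable setT (EFin \o psi).
    apply: le_integrable (iM _ _ (distribution P (Y n))) => //.
      exact/measurable_EFinP.
    by move=> x _; rewrite lee_fin (le_trans (phiM _))// ler_norm.
  have e := integral_density (m := lebesgue_tuple_sf d)
    (measurable_p_CC (d := d) (u0 n)) (HY n).2 ipsi.
  rewrite [RHS](_ : _ = \int[distribution P (Y n)]_x (EFin \o psi) x)%E.
    exact: esym e.
  rewrite integral_distribution//; first exact/measurable_EFinP.
  apply: le_integrable (iM _ _ P) => //; first exact: mpsiY.
  by move=> w _; rewrite lee_fin (le_trans (phiM _))// ler_norm.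
rewrite (_ : (fun n => _) = (fun n => \int[P]_w psi (Y n w))); last first.
  by apply/funext => n; exact: lawE.
have [J0 _ _ cadlag0] := cauchyC0.
have C_0 : {ae P, forall w j, C j 0 w = 0}.
  by apply: filter_forall => j; have [] := cauchyC j.
have JY : {ae P, forall w n, J (u n) w = Y n w}.
  by apply/ae_foralln => n; exact: (HY n).1.
have lim : {ae P, forall w, setT w -> (psi (Y n w))%:E @[n --> \oo] --> (phi 0)%:E}.
  have C00 : {ae P, forall w, C0 0 w = 0 /\ cadlag (fun s => C0 s w)}.
    by apply: filterS2 J0 cadlag0.
  have CC : {ae P, forall w, (forall j, C j 0 w = 0) /\
      forall j, cadlag (fun s => C j s w)}.
    by apply: filterS2 C_0 cadlag_ae.
  apply: filterS3 JY C00 CC => w JYw [J0w cad0w] [C_0w cadw] _.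
  suff h : psi (Y n w) @[n --> \oo] --> phi 0.
    by apply: cvg_EFin; [exact: nearW|exact: h].
  apply: continuous_cvg; first exact: cphi.
  apply: cvg_rV => j; rewrite mxE.
  have v0 : `|C0 (u n) w| @[n --> \oo] --> (0 : R).
    rewrite -(normr0 R) -J0w; apply: cvg_norm.
    have /cvg_at_rightP := cad0w.1 0 (lexx _); exact.
  apply/cvgrPdist_lt => e e0.
  have right0 : \forall s \near (0 : R), 0 < s -> `|C j 0 w - C j s w| < e.
    by have /cvgrPdist_lt/(_ _ e0) := (cadw j).1 0 (lexx _).
  have near_n : \forall n \near \oo, 0 < `|C0 (u n) w| ->
    `|C j 0 w - C j `|C0 (u n) w| w| < e by exact: v0 right0.
  apply: filterS near_n => n; rewrite C_0w => near_e.
  rewrite mxE -JYw tnth_mktuple.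
  (* The right limit at 0 says nothing about time 0 itself, which |C(u_n)| may hit; there C_j(0) = 0
     is used directly. *)
  have [v_gt0|v_le0] := ltP 0 `|C0 (u n) w|; first exact: near_e.
  have -> : `|C0 (u n) w| = 0 by apply/eqP; rewrite eq_le v_le0 normr_ge0.
  by rewrite C_0w subrr normr0.
have dom : {ae P, forall w n, setT w -> (`|(psi (Y n w))%:E| <= M%:E)%E}.
  by apply: aeW => w n _; rewrite lee_fin phiM.
have [_ _ cvg] := @dominated_convergence _ _ _ P _ measurableT _ _ _
  mpsiY (measurable_cst _) lim (iM _ _ P) dom.
have e : (\int[P]_w (phi 0)%:E = (phi 0)%:E)%E.
  by rewrite integral_cst//= [P setT]probability_setT mule1.
by move: cvg; rewrite e => /fine_cvg.
Qed.

End subordination.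

Theorem theorem3p6 (R : realType) (dsp : measure_display)
  (T : measurableType dsp) (P : probability T R) (d : nat)
  (C : 'I_d -> R -> {RV P >-> R}) (C0 : R -> {RV P >-> R}) :
  (0 < d)%N ->
  (forall j, standard_cauchy_process (C j)) ->
  standard_cauchy_process C0 ->
  mutually_independent P
    (with_last (fun j s => C j s : T -> R) (fun s => C0 s : T -> R)) ->
  (forall t : R, 0 < t ->
     has_density P
       (J_CC (fun j s => C j s : T -> R) (fun s => C0 s : T -> R) t)
       (fun x => p_CC x t)) /\
  ((1 < d)%N ->
     (forall (x : d.-tuple R) (t : R), regular_point x -> 0 < t ->
        lebesgue_measure.-integrable `]0, +oo[ (EFin \o p_CC_integrand x t) /\
        fractional_equation_at (@p_CC R d) x t) /\
     initial_delta (@p_CC R d)).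
Proof.
move=> _ cauchyC cauchyC0 indep; split.
  by move=> t; exact: (has_density_J_CC cauchyC cauchyC0 indep).
move=> _; split; last exact: (initial_delta_p_CC cauchyC cauchyC0 indep).
move=> x t regx t0; split; last exact: fractional_equation_p_CC.
(* Convergence of the defining integral is the case of the multiplier 1. *)
have := integrable_weight regx (admissible_cst 1) t0.
rewrite [X in _.-integrable _ X -> _](_ : _ = EFin \o p_CC_integrand x t)//.
by apply/funext => s /=; rewrite mulr1.
Qed.
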